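(* Let $E>\varepsilon^{T}g$ and suppose $G(N)$ is in one of the following regimes: 1) $\lim_{N\to\infty}G(N)/N=\infty$ and $\lim_{N\to\infty}N^{3/2}/G(N)=0$; 2) $G(N)/N=\alpha+\beta(N)$ with $\alpha>0$, $\lim_{N\to\infty}\beta(N)=0$ and $\lim_{N\to\infty}\beta(N)\sqrt N=0$; 3) $\lim_{N\to\infty}G(N)/N=0$ and $\lim_{N\to\infty}G(N)^{3/2}/N=0$. Let $X(N)$ be the random vector with values in $\mathcal{A}_E\cap L_N$ and $P(X(N)=x)=e^{S(x,N)}/\sum_{y\in\mathcal{A}_{E}\cap L_{N}}e^{S(y,N)}$, and let $X'(N)=(X_1(N),\dots,X_{m-1}(N))$. Let $\delta\in\left(0,\frac{1}{3(m+1)}\right)$. Then the random vector $Z(N)=\sqrt{h(N)}\,(x'^{*}-X'(N))$ converges in distribution to the normal law $\mathcal{N}\big(0,(-D^{2}f(x'^{*}))^{-1}\big)$, and its moment generating function $M_{Z(N)}(\xi)=\mathbb{E}\,e^{\xi^TZ(N)}$, $\xi\in\mathbb{R}^{m-1}$, satisfies $$M_{Z(N)}(\xi)=\exp\left(\tfrac12\,\xi^{T}(-D^{2}f(x'^{*}))^{-1}\xi\right)\left(1+\frac{O(1)}{h(N)^{1/2-3\delta}}+O(1)\frac{h(N)^{1/2+(m+1)\delta}}{N}+O(1)\epsilon(N)\sqrt{h(N)}\right),\quad N\to\infty.$$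
   Context: Setting. $m$ is a fixed number of energy levels with energies $\varepsilon=(\varepsilon_1,\dots,\varepsilon_m)$, $\varepsilon_1<\dots<\varepsilon_m$; $N$ is the number of particles; $E>\varepsilon_1$ is a constant. $g=(g_1,\dots,g_m)$ has constant entries $g_i>0$ with $\sum_i g_i=1$. $G(N)$ is an increasing positive function of $N$ (total degeneracy), and level $i$ has degeneracy $g_iG(N)$. $\mathcal{A}_E$ is the set of $x\in\mathbb{R}^m$ with $x_i\ge 0$, $\sum_{i=1}^m x_i=1$, $\varepsilon^Tx\le E$. $L_N=\{n/N: n\in\mathbb{N}^m\}$ with $0\in\mathbb{N}$. The entropy is $$S(x,N)=\sum_{i=1}^{m}\ln\frac{(x_{i}N+g_{i}G(N)-1)!}{(x_{i}N)!\,(g_{i}G(N)-1)!},$$ with $\lambda!=\Gamma(\lambda+1)$. Functions associated with the three regimes: 1) $h(N)=N$; $f(x)=\sum_i x_i\ln\frac{g_i}{x_i}$; $\epsilon(N)=\frac1N$ if $\lim_{N\to\infty} N^2/G(N)=0$ and $\epsilon(N)=\frac{N}{G(N)}$ otherwise. 2) $h(N)=N$; $f(x)=\sum_i\big((x_i+g_i\alpha)\ln(x_i+g_i\alpha)-x_i\ln x_i\big)$; $\epsilon(N)=\frac1N$ if $\lim_{N\to\infty}\beta(N)N=0$ and $\epsilon(N)=|\beta(N)|$ otherwise. 3) $h(N)=G(N)$; $f(x)=\sum_i g_i\ln x_i$; $\epsilon(N)=\frac1{G(N)}$ if $\lim_{N\to\infty} G(N)^2/N=0$ and $\epsilon(N)=\frac{G(N)}{N}$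 otherwise. Since $x_m=1-\sum_{i=1}^{m-1}x_i$ on $\mathcal{A}_E$, a point $x\in\mathcal{A}_E$ is identified with $x'=(x_1,\dots,x_{m-1})$, and $f(x')$ denotes $f(x_1,\dots,x_{m-1},1-\sum_{i<m}x_i)$; $D^2f(x'^* )$ is its $(m-1)\times(m-1)$ Hessian at $x'^*$. $x^*$ is the unique point of maximum of $f$ on $\mathcal{A}_E$; for $E>\varepsilon^Tg$ it is $x^*=g$, so $x'^*=(g_1,\dots,g_{m-1})$. Each $O(1)$ denotes a quantity bounded as $N\to\infty$ (for fixed $\xi$).
   Formalization: The formal statement additionally assumes G(N)→∞; this is automatic in regimes 1 and 2, while in regime 3 a bounded increasing G (m≥2) makes Z(N) bounded, so it cannot converge to a nondegenerate normal law. *)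

(* Defs.v *)
From HB Require Import structures.
From mathcomp Require Import all_boot all_order all_algebra.
From mathcomp Require Import all_classical all_reals all_analysis.

Set Implicit Arguments.
Unset Strict Implicit.
Unset Printing Implicit Defensive.

Import Order.TTheory GRing.Theory Num.Theory.
Import numFieldNormedType.Exports.

Local Open Scope classical_set_scope.
Local Open Scope ring_scope.

(* The m >= 1 levels are indexed by 'I_n.+1, i.e. m = n.+1, so that the
   reduced vectors x' = (x_1, ..., x_(m-1)) live in 'rV[R]_n.               *)

Section Vectors.
Context {R : realType}.

Definition dot m (u v : 'rV[R]_m) : R := \sum_i u ord0 i * v ord0 i.

Definition quad_form m (A : 'M[R]_m) (u : 'rV[R]_m) : R :=
  (u *m A *m u^T) ord0 ord0.

Definition drop_last n (x : 'rV[R]_n.+1) : 'rV[R]_n := col' ord_max x.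

(* (x_1, ..., x_(m-1)) |-> (x_1, ..., x_(m-1), 1 - \sum_(i < m) x_i) *)
Definition complete n (x' : 'rV[R]_n) : 'rV[R]_n.+1 :=
  \row_i oapp (x' ord0) (1 - \sum_j x' ord0 j) (unlift ord_max i).

Definition hessian n (F : 'rV[R]_n -> R) (a : 'rV[R]_n) : 'M[R]_n :=
  \matrix_(i, j) 'D_(delta_mx ord0 i) ('D_(delta_mx ord0 j) F) a.

Definition is_unique_max (T : eqType) (F : T -> \bar R) (A : set T) (x : T) :=
  A x /\ forall y, A y -> y != x -> (F y < F x)%E.

End Vectors.

Section Probability.
Context {R : realType}.

(* Meaningful for a > 0, where the integral converges. *)
Definition Gamma (a : R) : R :=
  \int[lebesgue_measure]_(t in `]0, +oo[) (t `^ (a - 1) * expR (- t)).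

Definition rfact (a : R) : R := Gamma (a + 1).

(* Lebesgue integral over R^n, as the iterated integral
   \int ... \int F(t_1, ..., t_n) dt_n ... dt_1.                             *)
Fixpoint rV_integral n : ('rV[R]_n -> \bar R) -> \bar R :=
  match n with
  | 0 => fun F => F 0
  | n'.+1 => fun F =>
      (\int[lebesgue_measure]_(t in setT)
         rV_integral (fun v : 'rV[R]_n' =>
           F (row_mx (t%:M : 'rV[R]_1) v : 'rV[R]_n'.+1)))%E
  end.

Definition mvnormal_pdf n (Sigma : 'M[R]_n) (z : 'rV[R]_n) : R :=
  (Num.sqrt ((2 * pi) ^+ n * \det Sigma))^-1
  * expR (- (quad_form (invmx Sigma) z / 2)).

Definition random_vector d (T : measurableType d) m (X : T -> 'rV[R]_m) :=
  forall i, measurable_fun setT (fun w => X w ord0 i).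

(* Convergence in distribution of Z_N (each Z_N being defined on its own
   probability space) to the law with Lebesgue density p: convergence of
   the expectations of all bounded continuous test functions.                *)
Definition cvg_in_distribution n (d : nat -> measure_display)
    (T : forall N, measurableType (d N)) (P : forall N, probability (T N) R)
    (Z : forall N, T N -> 'rV[R]_n) (p : 'rV[R]_n -> R) :=
  forall phi : 'rV[R]_n -> R, continuous phi -> bounded_fun phi ->
    ('E_(P N)[fun w => phi (Z N w)] @[N --> \oo]
       --> rV_integral (fun z => (phi z * p z)%:E))%E.

Definition mgf n d (T : measurableType d) (P : probability T R)
    (Z : T -> 'rV[R]_n) (xi : 'rV[R]_n) : \bar R :=
  'E_P[fun w => expR (dot xi (Z w))]%E.

End Probability.

Section Model.
Context {R : realType}.

Definition simplex_le m (energy : 'rV[R]_m) (E : R) : set 'rV[R]_m :=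
  [set x : 'rV[R]_m | [/\ (forall i, 0 <= x ord0 i), \sum_i x ord0 i = 1
             & dot energy x <= E]].

Definition lattice m (N : nat) : set 'rV[R]_m :=
  [set x | exists k : 'I_m -> nat, x = \row_i ((k i)%:R / N%:R)].

Definition entropy m (g : 'rV[R]_m) (G : nat -> R) (x : 'rV[R]_m) (N : nat) :=
  \sum_i ln (rfact (x ord0 i * N%:R + g ord0 i * G N - 1) /
             (rfact (x ord0 i * N%:R) * rfact (g ord0 i * G N - 1))).

(* The normalizing sum has finite support: for N > 0, A is a finite set. *)
Definition entropy_distributed m (energy g : 'rV[R]_m) (E : R) (G : nat -> R)
    (N : nat) d (T : measurableType d) (P : probability T R)
    (Y : T -> 'rV[R]_m) :=
  let A := simplex_le energy E `&` lattice N in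
  [/\ random_vector Y, (forall w, A (Y w)) &
      forall x, A x ->
        P (Y @^-1` [set x]) =
        (expR (entropy g G x N) / \sum_(y \in A) expR (entropy g G y N))%:E].

(* The limit alpha of G(N)/N is a parameter of the second regime. *)
Inductive regime := Regime1 | Regime2 of R | Regime3.

Definition beta (G : nat -> R) (alpha : R) (N : nat) : R := G N / N%:R - alpha.

Definition in_regime (G : nat -> R) (r : regime) : Prop :=
  match r with
  | Regime1 => (G N / N%:R @[N --> \oo] --> +oo) /\
               (N%:R `^ (3 / 2) / G N @[N --> \oo] --> 0)
  | Regime2 alpha => [/\ 0 < alpha,
                         beta G alpha N @[N --> \oo] --> 0 &
                         beta G alpha N * Num.sqrt N%:R @[N --> \oo] --> 0]
  | Regime3 => (G N / N%:R @[N --> \oo] --> 0) /\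
               (G N `^ (3 / 2) / N%:R @[N --> \oo] --> 0)
  end.

Definition hfun (G : nat -> R) (r : regime) (N : nat) : R :=
  match r with
  | Regime1 | Regime2 _ => N%:R
  | Regime3 => G N
  end.

(* In the first two regimes the library convention ln 0 = 0 realizes
   0 ln 0 = 0 on the boundary; in the third one f is -oo where some x_i
   vanishes, hence the extended logarithm.                                   *)
Definition ffun_limit m (g : 'rV[R]_m) (r : regime) (x : 'rV[R]_m) : \bar R :=
  match r with
  | Regime1 => (\sum_i x ord0 i * ln (g ord0 i / x ord0 i))%:E
  | Regime2 alpha =>
      (\sum_i ((x ord0 i + g ord0 i * alpha) * ln (x ord0 i + g ord0 i * alpha)
               - x ord0 i * ln (x ord0 i)))%:E
  | Regime3 => (\sum_i (g ord0 i)%:E * lne (x ord0 i)%:E)%E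
  end.

Definition freduced n (g : 'rV[R]_n.+1) (r : regime) (x' : 'rV[R]_n) : R :=
  fine (ffun_limit g r (complete x')).

Definition epsfun (G : nat -> R) (r : regime) (N : nat) : R :=
  match r with
  | Regime1 => if `[< N%:R ^+ 2 / G N @[N --> \oo] --> 0 >]
               then N%:R^-1 else N%:R / G N
  | Regime2 alpha => if `[< beta G alpha N * N%:R @[N --> \oo] --> 0 >]
                     then N%:R^-1 else `|beta G alpha N|
  | Regime3 => if `[< G N ^+ 2 / N%:R @[N --> \oo] --> 0 >]
               then (G N)^-1 else G N / N%:R
  end.

End Model.
Arguments regime : clear implicits.

(* Main.v *)
Require Import Defs.
From HB Require Import structures.
From mathcomp Require Import all_boot all_order all_algebra.
From mathcomp Require Import all_classical all_reals all_analysis.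
From mathcomp Require Import measurable_realfun.
From mathcomp Require Import ring lra.

Set Implicit Arguments.
Unset Strict Implicit.
Unset Printing Implicit Defensive.

Import Order.TTheory GRing.Theory Num.Theory.
Import numFieldNormedType.Exports.

Local Open Scope classical_set_scope.
Local Open Scope ring_scope.

(** The law of [X N] is explicit. At [x = k / N] the exponential of the entropy
    is the product over the levels of
    [Gamma (k i + a i) / (Gamma (k i + 1) * Gamma (a i))], where
    [a i = g i * G N]. So [N * X N] is a Dirichlet-multinomial vector
    conditioned on the energy bound ([expectation_dmcond]). The proof is
    Stein's method for that vector; no factorial is ever estimated.

    Moving one particle from level [j] to level [i] multiplies the weight by a
    rational function of [k], so that detailed balance ([dm_exchange]) gives,
    for the fluctuations [Z i = sqrt h * (g i - k i / N)], the identity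
      [E ((Z i * g j - Z j * g i) * F) = E (D i j * (difference quotient of F))]
    along that move ([dm_stein]). The rate [D i j] is close to
    [s2 * g i * g j], with [s2] depending on the regime only; this is Gaussian
    integration by parts on a lattice. The three regimes enter through
    [scaling] alone: the mesh of the fluctuations and the error on [s2] are
    [O (1 / sqrt h)] ([scaling_regime]).

    For the moment generating function, [F = expR (t * L)] with [L] a linear
    function of the fluctuations, of limit variance [v], turns the identity into
    [M' t = t * v * M t + O (1 / sqrt h)], whence
    [M 1 = expR (v / 2) * (1 + O (1 / sqrt h))] ([dmmgf_approx]). As
    [dot energy g < E], to violate the energy bound takes a deviation of order
    [sqrt h], whose probability is tiny; conditioning costs [O (1 / sqrt h)]
    once more ([dmcond_mgf]). Since [1 / sqrt h] is at most
    [1 / h ^ (1/2 - 3 delta)], the first of the three error terms absorbs the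
    whole error.

    Convergence in distribution is obtained one coordinate at a time. For a
    bounded continuous function [phi] of the first [j + 1] fluctuations, the
    identity, applied to the solution of the one-dimensional Stein equation in
    the last of them ([stein_equation]), shows that [E phi] changes by [o(1)]
    when [phi] is replaced by its mean under the Gaussian law of that
    coordinate given the previous ones ([stein_step]). Integrating the last
    coordinate of the Gaussian density does exactly the same to the limit
    ([rV_integral_condmean]), and [dm_weak_limit] follows by induction.

    It remains to recognize the limit. The summands of [f] lie below their
    tangents at [g i], which all have the same slope; hence [f] is maximal at
    [g] ([unique_max_g]). Their second derivatives at [g i] are
    [- 1 / (s2 * g i)], so that [- hessian] is the inverse of
    [s2 * (diag g - g g^T)] ([hessian_freduced], [precmx_covmx]), and a
    triangular factorization of that matrix identifies the product of the
    conditional densities with the multivariate normal one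
    ([mvnormal_jointpdf]). *)

(** * The Gamma function *)

Section GammaFunction.
Context {R : realType}.
Local Notation mu := (@lebesgue_measure R).
Implicit Types (a t x y : R).

Let gint a t : R := t `^ (a - 1) * expR (- t).
Let eGamma a : \bar R := (\int[mu]_(t in `]0%R, +oo[%classic) (gint a t)%:E)%E.

Lemma gint_ge0 a t : 0 <= gint a t.
Proof. by rewrite mulr_ge0 ?powR_ge0 ?expR_ge0. Qed.

Lemma is_derive_powR_expRN a t : 0 < t ->
  is_derive t 1 (fun s => s `^ a * expR (- s))
    (a * gint a t - gint (a + 1) t).
Proof.
move=> t0; have H := is_derive1_powR a t0.
apply: is_derive_eq; rewrite /gint /GRing.scale/= addrK. ring.
Qed.

Lemma continuous_gint a t : 0 < t -> {for t, continuous (gint a)}.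
Proof.
move=> t0; apply: differentiable_continuous; apply/derivable1_diffP.
by have := is_derive_powR_expRN (a - 1) t0; case.
Qed.

Lemma measurable_gint a : measurable_fun setT (gint a).
Proof.
apply: measurable_funM; first exact: measurable_powR.
by apply: measurableT_comp => //; exact: measurable_funN.
Qed.

Lemma eGamma_ge0 a : (0 <= eGamma a)%E.
Proof. by apply: integral_ge0 => t _; rewrite lee_fin gint_ge0. Qed.

Let E_ (k : nat) : set R := `[k.+1%:R^-1, k.+2%:R].

Lemma bigcup_E : \bigcup_k E_ k = `]0, +oo[%classic.
Proof.
apply/seteqP; split=> [t [k _]|t].
  rewrite /E_/= !in_itv/= andbT => /andP[+ _]; apply: lt_le_trans.
  by rewrite invr_gt0.
rewrite /= in_itv/= andbT => t0.
pose k := maxn (Num.trunc t) (Num.trunc t^-1).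
exists k => //; rewrite /E_/= in_itv/=; apply/andP; split.
  rewrite invf_ple ?posrE ?invr_gt0//.
  apply/ltW/(lt_le_trans (truncnS_gt _)).
  by rewrite ler_nat ltnS leq_maxr.
apply/ltW/(lt_le_trans (truncnS_gt _)).
by rewrite ler_nat ltnS (leq_trans _ (leqnSn _))// leq_maxl.
Qed.

Lemma nd_E : nondecreasing_seq E_.
Proof.
move=> k l kl; apply/subsetPset => t; rewrite /E_/= !in_itv/= => /andP[h1 h2].
apply/andP; split.
  by apply: le_trans h1; rewrite lef_pV2 ?posrE// ler_nat.
by apply: le_trans h2 _; rewrite ler_nat.
Qed.

Lemma gint_cvg a :
  (\int[mu]_(t in E_ k) (gint a t)%:E)%E @[k --> \oo] --> eGamma a.
Proof.
rewrite /eGamma -bigcup_E; apply: ge0_nondecreasing_set_cvg_integral.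
- exact: nd_E.
- by move=> i; exact: measurable_itv.
- move=> i; apply/measurable_EFinP/(@measurable_funS _ _ _ _ setT) => //.
  exact: measurable_gint.
- by move=> i t _; rewrite lee_fin gint_ge0.
Qed.

Lemma within_gint a k : {within E_ k, continuous (gint a)}.
Proof.
apply/continuous_in_subspaceT => t; rewrite inE /E_/= in_itv/= => /andP[h _].
by apply: continuous_gint; apply: lt_le_trans h; rewrite invr_gt0.
Qed.

Lemma gint_fin a k : (\int[mu]_(t in E_ k) (gint a t)%:E)%E \is a fin_num.
Proof.
apply: integrable_fin_num; first exact: measurable_itv.
apply: continuous_compact_integrable; first exact: segment_compact.
exact: within_gint.
Qed.

Let bdry a t := t `^ a * expR (- t).

(** Integration by parts on the segments [E_ k], which exhaust the half-line; the
    boundary terms vanish in the limit. *)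
Lemma gint_FTC a k :
  (\int[mu]_(t in E_ k) (gint (a + 1) t)%:E =
   a%:E * \int[mu]_(t in E_ k) (gint a t)%:E
     + (bdry a k.+1%:R^-1 - bdry a k.+2%:R)%:E)%E.
Proof.
have ab : (k.+1%:R^-1 : R) < k.+2%:R.
  apply: (@le_lt_trans _ _ 1); first by rewrite invf_le1// ler1n.
  by rewrite ltr1n.
have p0 : 0 < (k.+1%:R^-1 : R) by rewrite invr_gt0.
have pos t : (k.+1%:R^-1 : R) <= t -> 0 < t by exact: lt_le_trans.
have mE : measurable (E_ k) by exact: measurable_itv.
have iE b : mu.-integrable (E_ k) (EFin \o gint b).
  apply: continuous_compact_integrable; first exact: segment_compact.
  exact: within_gint.
have cb t : 0 < t -> {for t, continuous (bdry a)}.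
  move=> t0; apply: differentiable_continuous; apply/derivable1_diffP.
  by have [] := is_derive_powR_expRN a t0.
have := @continuous_FTC2 R (fun t => a * gint a t - gint (a + 1) t)
  (bdry a) _ _ ab.
rewrite -/(E_ k) => H.
have {}H : (\int[mu]_(x in E_ k) (a * gint a x - gint (a + 1) x)%:E)%E =
    ((bdry a k.+2%:R)%:E - (bdry a (k.+1%:R)^-1)%:E)%E.
  apply: H.
  - apply: continuous_in_subspaceT => t; rewrite inE /E_/= in_itv/= => /andP[h _].
    apply: cvgB; last by apply: continuous_gint; exact: pos.
    by apply: cvgM; [exact: cvg_cst|apply: continuous_gint; exact: pos].
  - split.
    + move=> t; rewrite in_itv/= => /andP[h _].
      by have [] := is_derive_powR_expRN a (pos _ (ltW h)).
    + by apply: cvg_at_right_filter; exact: cb.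
    + by apply: cvg_at_left_filter; apply: cb; exact: ltr0n.
  - move=> t; rewrite in_itv/= => /andP[h _].
    by rewrite derive1E; have [] := is_derive_powR_expRN a (pos _ (ltW h)).
move: H; under eq_integral do rewrite EFinB EFinM.
have iaE : mu.-integrable (E_ k) (fun x => a%:E * (gint a x)%:E)%E.
  by apply: integrableZl => //; exact: iE.
rewrite integralB//; last exact: iE.
rewrite integralZl//; last exact: iE.
rewrite -(fineK (gint_fin a k)) -(fineK (gint_fin (a + 1) k)).
rewrite -!EFinM -!EFinB -!EFinD => -[] H; congr EFin; lra.
Qed.

Lemma bdry0 a : 0 < a -> bdry a k.+1%:R^-1 @[k --> \oo] --> 0.
Proof.
move=> a0; have H : (k.+1%:R^-1 : R) `^ a @[k --> \oo] --> 0.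
  have /cvg_at_rightP := powR_cvg0 a0; apply; split; last exact: cvg_harmonic.
  by move=> k.
apply: squeeze_cvgr (cvg_cst 0) H; apply: nearW => k.
by rewrite mulr_ge0 ?powR_ge0 ?expR_ge0//= ler_piMr ?powR_ge0// expR_le1 oppr_le0.
Qed.

Lemma bdryy a : bdry a k.+2%:R @[k --> \oo] --> 0.
Proof.
(* [expR x] beats [x ^ m], [m > a], by a factor of order [x]. *)
pose m := (Num.trunc a).+1.
have H : (m.+1`!%:R * k.+1%:R^-1 : R) @[k --> \oo] --> 0.
  rewrite -(mulr0 m.+1`!%:R); apply: cvgM; first exact: cvg_cst.
  exact: cvg_harmonic.
apply: squeeze_cvgr (cvg_cst 0) H; apply: nearW => k.
rewrite mulr_ge0 ?powR_ge0 ?expR_ge0//=.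
have x1 : 1 <= (k.+2%:R : R) by rewrite ler1n.
apply: (@le_trans _ _ (k.+2%:R ^+ m * expR (- k.+2%:R))).
  rewrite ler_wpM2r ?expR_ge0//.
  by rewrite -powR_mulrn// ler_powR// ltW// truncnS_gt.
have h := expR_ge1Dxn m (ler0n R k.+2).
rewrite expRN ler_pdivrMr ?expR_gt0//.
have m0 : 0 < (m.+1`!%:R : R) by rewrite ltr0n fact_gt0.
have k0 : 0 < (k.+1%:R : R) by [].
have h2 : (k.+2%:R : R) ^+ m.+1 <= m.+1`!%:R * expR k.+2%:R.
  rewrite -ler_pdivrMl// mulrC; apply: le_trans h; lra.
rewrite -mulrA (mulrC k.+1%:R^-1) mulrA ler_pdivlMr//.
apply: le_trans h2; rewrite exprSr ler_wpM2l ?exprn_ge0// ler_nat.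
by [].
Qed.

Lemma eGamma_rec a : 0 < a -> eGamma (a + 1) = (a%:E * eGamma a)%E.
Proof.
move=> a0; have H1 := @gint_cvg (a + 1).
have H2 : (a%:E * \int[mu]_(t in E_ k) (gint a t)%:E
     + (bdry a k.+1%:R^-1 - bdry a k.+2%:R)%:E)%E @[k --> \oo]
     --> (a%:E * eGamma a + 0)%E.
  apply: cvgeD; first by rewrite fin_num_adde_defl.
    by apply: cvgeZl => //; exact: gint_cvg.
  apply: cvg_EFin; first by apply: nearW.
  rewrite -(subrr (0 : R)); apply: cvgB; first exact: bdry0.
  exact: bdryy.
rewrite adde0 in H2.
apply: (cvg_unique _ H1) => //=.
by rewrite (eq_cvg _ _ (gint_FTC a)).
Qed.

Lemma eGamma1 : eGamma 1 = 1%E.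
Proof.
have H1 := @gint_cvg 1.
have H (k : nat) : (\int[mu]_(t in E_ k) (gint 1 t)%:E)%E =
   (bdry 0 k.+1%:R^-1 - bdry 0 k.+2%:R)%:E.
  by have := gint_FTC 0 k; rewrite add0r mul0e add0e.
apply: (cvg_unique _ H1) => //=; rewrite (eq_cvg _ _ H).
apply: cvg_EFin; first by apply: nearW.
suff Hc : bdry 0 k.+1%:R^-1 @[k --> \oo] --> (1 : R).
  by have := cvgB Hc (@bdryy 0); rewrite (subr0 (1 : R)); apply.
rewrite /bdry; under eq_fun do rewrite powRr0 mul1r.
have H0 : - (k.+1%:R^-1 : R) @[k --> \oo] --> (0 : R).
  by rewrite -oppr0; apply: cvgN; exact: cvg_harmonic.
have H2 : expR (- (k.+1%:R^-1 : R)) @[k --> \oo] --> expR (0 : R).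
  by apply: continuous_cvg => //; exact: continuous_expR.
by rewrite expR0 in H2.
Qed.

Lemma eGamma_nat k : (eGamma k.+1%:R < +oo)%E.
Proof.
elim: k => [|k IH]; first by rewrite eGamma1 ltry.
by rewrite -natr1 eGamma_rec// lte_mul_pinfty.
Qed.

Lemma eGamma_lty1 a : 1 <= a -> (eGamma a < +oo)%E.
Proof.
move=> a1; pose k := (Num.trunc a).+1.
have mg b D : measurable_fun D (EFin \o gint b).
  apply/measurable_EFinP/(@measurable_funS _ _ _ _ setT) => //.
  exact: measurable_gint.
have : (eGamma a <= eGamma 1 + eGamma k.+1%:R)%E.
  have g0 b t : (0 <= (gint b t)%:E)%E by rewrite lee_fin gint_ge0.
  rewrite /eGamma -ge0_integralD//; try exact: mg.
  apply: ge0_le_integral => //.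
  - exact: mg.
  - by apply: emeasurable_funD; exact: mg.
  - move=> t; rewrite /= in_itv/= andbT => t0.
    (* [t ^ (a - 1)] is at most [1] before [1], and [t ^ k] after. *)
    rewrite -EFinD lee_fin /gint -mulrDl ler_wpM2r ?expR_ge0// subrr powRr0.
    have [t1|t1] := leP 1 t.
      rewrite ler_wpDl// ler_powR// -natr1 addrK.
      by rewrite (le_trans (y := a)) ?gerBl// ltW// truncnS_gt.
    rewrite ler_wpDr ?powR_ge0//.
    have := @ge0_ler_powR R (a - 1); rewrite subr_ge0 => /(_ a1 t 1).
    by rewrite powR1; apply; rewrite ?nnegrE// ltW.
move/le_lt_trans; apply; rewrite lte_add_pinfty//; last exact: eGamma_nat.
by rewrite eGamma1 ltry.
Qed.

(** The recurrence brings the singularity at [0] back to the case [1 <= a]. *)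
Lemma eGamma_lty a : 0 < a -> (eGamma a < +oo)%E.
Proof.
move=> a0; have : (eGamma (a + 1) < +oo)%E by apply: eGamma_lty1; rewrite lerDr ltW.
rewrite eGamma_rec// lt_neqAle => /andP[h _].
rewrite lt_neqAle leey andbT; apply: contra h => /eqP ->.
by rewrite gt0_muley.
Qed.

Lemma GammaE a : 0 < a -> eGamma a = (Gamma a)%:E.
Proof.
move=> a0; rewrite /Gamma /Rintegral fineK//.
by rewrite ge0_fin_numE ?eGamma_lty// eGamma_ge0.
Qed.

Lemma Gamma_rec a : 0 < a -> Gamma (a + 1) = a * Gamma a.
Proof.
move=> a0; apply: EFin_inj; rewrite EFinM -!GammaE ?eGamma_rec//.
by rewrite addr_gt0.
Qed.

Lemma eGamma_gt0 a : 1 <= a -> (0 < eGamma a)%E.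
Proof.
move=> a1; apply: (@lt_le_trans _ _ (expR (- 2))%:E).
  by rewrite lte_fin expR_gt0.
have m12 : measurable (`[1%R, 2%R]%classic : set R) by exact: measurable_itv.
have mg D : measurable_fun D (EFin \o gint a).
  apply/measurable_EFinP/(@measurable_funS _ _ _ _ setT) => //.
  exact: measurable_gint.
apply: (@le_trans _ _ (\int[mu]_(t in `[1%R, 2%R]) (gint a t)%:E)%E); last first.
  apply: ge0_subset_integral => //.
  - exact: mg.
  - by move=> t _; rewrite lee_fin gint_ge0.
  - move=> t; rewrite /= !in_itv/= andbT => /andP[t1 _].
    exact: lt_le_trans t1.
apply: (@le_trans _ _ (\int[mu]_(t in `[1%R, 2%R]) (expR (- 2))%:E)%E).
  rewrite integral_cst//=.
  rewrite lebesgue_measure_itv/= lte_fin ltr1n/= -EFinB -EFinM.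
  rewrite lee_fin; have := expR_ge0 (- 2 : R); lra.
apply: ge0_le_integral => //.
- exact: mg.
- move=> t; rewrite /= in_itv/= => /andP[t1 t2]; rewrite lee_fin /gint.
  rewrite -[leLHS]mul1r ler_pM ?expR_ge0//; last by rewrite ler_expR lerN2.
  by have := @ler_powR _ t t1 0 (a - 1); rewrite powRr0; apply; rewrite subr_ge0.
Qed.

Lemma Gamma_gt0 a : 0 < a -> 0 < Gamma a.
Proof.
move=> a0; have : 0 < Gamma (a + 1).
  by rewrite -lte_fin -GammaE ?addr_gt0// eGamma_gt0// lerDr ltW.
by rewrite Gamma_rec// pmulr_rgt0.
Qed.

End GammaFunction.

(** * The Dirichlet-multinomial law *)

Section FiniteExpectation.
Context {R : realType} (T : finType) (w : T -> R).
Hypothesis w_ge0 : forall k, 0 <= w k.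
Hypothesis w_gt0 : 0 < \sum_k w k.
Implicit Types (F : T -> R) (c : R).

Definition fexp F : R := (\sum_k w k * F k) / \sum_k w k.

Lemma fexpD F1 F2 : fexp (fun k => F1 k + F2 k) = fexp F1 + fexp F2.
Proof.
rewrite /fexp -mulrDl -big_split/=; congr (_ / _).
by apply: eq_bigr => k _; rewrite mulrDr.
Qed.

Lemma fexpZ c F : fexp (fun k => c * F k) = c * fexp F.
Proof.
rewrite /fexp mulrA mulr_sumr; congr (_ / _).
by apply: eq_bigr => k _; rewrite mulrCA.
Qed.

Lemma fexpB F1 F2 : fexp (fun k => F1 k - F2 k) = fexp F1 - fexp F2.
Proof.
rewrite -[- fexp F2]mulN1r -fexpZ -fexpD; congr fexp.
by apply/funext => k; rewrite mulN1r.
Qed.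

Lemma fexp_sum (I : Type) (r : seq I) (P : pred I) (F : I -> T -> R) :
  fexp (fun k => \sum_(i <- r | P i) F i k) = \sum_(i <- r | P i) fexp (F i).
Proof.
rewrite /fexp -mulr_suml exchange_big/=; congr (_ / _).
by apply: eq_bigr => k _; rewrite mulr_sumr.
Qed.

Lemma fexp_cst c : fexp (fun=> c) = c.
Proof. by rewrite /fexp -mulr_suml mulrAC divff ?mul1r// gt_eqF. Qed.

(** Only the points of positive weight matter, so that facts valid on the
    support of [w] may be used under the expectation. *)
Lemma eq_fexp F1 F2 : (forall k, 0 < w k -> F1 k = F2 k) -> fexp F1 = fexp F2.
Proof.
move=> h; congr (_ / _); apply: eq_bigr => k _.
by have := w_ge0 k; rewrite le0r => /orP[/eqP ->|/h ->//]; rewrite !mul0r.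
Qed.

Lemma le_fexp F1 F2 : (forall k, 0 < w k -> F1 k <= F2 k) -> fexp F1 <= fexp F2.
Proof.
move=> h; rewrite ler_wpM2r ?invr_ge0//; first exact: ltW.
apply: ler_sum => k _; have := w_ge0 k; rewrite le0r => /orP[/eqP ->|wk]; first by rewrite !mul0r.
by rewrite ler_pM2l ?h.
Qed.

Lemma fexp_ge0 F : (forall k, 0 < w k -> 0 <= F k) -> 0 <= fexp F.
Proof. by move=> h; rewrite -[leLHS](fexp_cst 0); exact: le_fexp. Qed.

Lemma ler_norm_fexp F : `|fexp F| <= fexp (fun k => `|F k|).
Proof.
rewrite ler_norml -mulN1r -fexpZ; apply/andP; split; apply: le_fexp => k _.
  by rewrite mulN1r lerNl ler_normr lexx orbT.
exact: ler_norm.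
Qed.

End FiniteExpectation.

Section DirichletMultinomial.
Context {R : realType} (n N : nat) (a : 'I_n.+1 -> R).
Hypothesis a_gt0 : forall i, 0 < a i.
Local Notation conf := {ffun 'I_n.+1 -> 'I_N.+1}.
Implicit Types (k : conf) (i j l : 'I_n.+1) (F : conf -> R).

(** The rising factorial of [b] of length [m], over [m!]. *)
Definition pochratio (b : R) (m : nat) : R :=
  Gamma (m%:R + b) / (Gamma (m%:R + 1) * Gamma b).

Lemma pochratio_gt0 b m : 0 < b -> 0 < pochratio b m.
Proof.
move=> b0; have m1 : 0 < (m%:R : R) + 1 by rewrite ltr_wpDl.
have mb : 0 < (m%:R : R) + b by rewrite ltr_wpDl.
by rewrite divr_gt0 ?mulr_gt0 ?Gamma_gt0.
Qed.

Lemma pochratioS b m : 0 < b ->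
  pochratio b m.+1 * m.+1%:R = pochratio b m * (m%:R + b).
Proof.
move=> b0; rewrite /pochratio -!natr1.
have m1 : 0 < (m%:R : R) + 1 by rewrite ltr_wpDl.
have mb : 0 < (m%:R : R) + b by rewrite ltr_wpDl.
rewrite (Gamma_rec m1) -addrA (addrC 1) addrA (Gamma_rec mb).
move: (Gamma_gt0 b0) (Gamma_gt0 m1).
move: (Gamma b) (Gamma (m%:R + b)) (Gamma (m%:R + 1)) => x y z x0 z0.
by field; rewrite !gt_eqF.
Qed.

Definition composition k := (\sum_i (k i : nat) == N)%N.

(** The unnormalized Dirichlet-multinomial law, on all arrays of occupation
    numbers at most [N]: those that are not compositions of [N] weigh nothing. *)
Definition dmweight k : R :=
  if composition k then \prod_i pochratio (a i) (k i) else 0.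

Lemma dmweight_ge0 k : 0 <= dmweight k.
Proof.
rewrite /dmweight; case: ifP => // _.
by apply: prodr_ge0 => i _; rewrite ltW ?pochratio_gt0.
Qed.

Lemma dmweight_gt0 k : composition k -> 0 < dmweight k.
Proof.
by rewrite /dmweight => ->; apply: prodr_gt0 => i _; rewrite pochratio_gt0.
Qed.

Lemma dmweight_gt0_composition k : 0 < dmweight k -> composition k.
Proof. by rewrite /dmweight; case: ifP => //; rewrite ltxx. Qed.

Lemma sum_dmweight_gt0 : 0 < \sum_k dmweight k.
Proof.
(* All the particles on the first level. *)
pose k0 : conf := [ffun i => if i == ord0 then ord_max else ord0].
rewrite (bigD1 k0)//= ltr_wpDr ?dmweight_gt0 ?sumr_ge0//.
  by move=> k _; exact: dmweight_ge0.
rewrite /composition (bigD1 ord0)//= big1 ?addn0 ?ffunE ?eqxx//.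
by move=> i /negbTE i0; rewrite ffunE i0.
Qed.

(** One particle goes from level [j] to level [i]; [inord] is faithful when [k] is
    a composition and level [j] is occupied. *)
Definition transfer i j k : conf :=
  [ffun l => if l == i then inord (k i).+1
             else if l == j then inord (k j).-1 else k l].

Lemma sum_split2 i j (f : 'I_n.+1 -> nat) : i != j ->
  (\sum_l f l = f i + (f j + \sum_(l | (l != i) && (l != j)) f l))%N.
Proof.
move=> ij; rewrite (bigD1 i)//=; congr addn.
by rewrite (bigD1 j)//= eq_sym.
Qed.

Lemma prod_split2 i j (f : 'I_n.+1 -> R) : i != j ->
  \prod_l f l = f i * (f j * \prod_(l | (l != i) && (l != j)) f l).
Proof.
move=> ij; rewrite (bigD1 i)//=; congr (_ * _).
by rewrite (bigD1 j)//= eq_sym.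
Qed.

Lemma transferP i j k : i != j -> composition k -> (0 < k j)%N ->
  [/\ transfer i j k i = (k i).+1 :> nat, transfer i j k j = (k j).-1 :> nat,
      forall l, l != i -> l != j -> transfer i j k l = k l &
      composition (transfer i j k)].
Proof.
move=> ij /eqP ck kj; have ji : j != i by rewrite eq_sym.
have e1 : transfer i j k i = (k i).+1 :> nat.
  rewrite ffunE eqxx inordK// ltnS.
  apply: leq_trans (_ : \sum_l k l <= N)%N; last by rewrite ck.
  by rewrite (sum_split2 _ ij) -addn1 leq_add// ltn_addr.
have e2 : transfer i j k j = (k j).-1 :> nat.
  rewrite ffunE (negbTE ji) eqxx inordK//.
  exact: leq_ltn_trans (leq_pred _) (ltn_ord _).
have e3 l : l != i -> l != j -> transfer i j k l = k l.
  by move=> li lj; rewrite ffunE (negbTE li) (negbTE lj).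
split=> //; apply/eqP/(etrans _ ck); rewrite !(sum_split2 _ ij) e1 e2.
rewrite (eq_bigr (fun l => k l : nat)); last first.
  by move=> l /andP[li lj]; rewrite e3.
by rewrite addSn -addnS -addSn prednK.
Qed.

Lemma transferK i j k : i != j -> composition k -> (0 < k j)%N ->
  transfer j i (transfer i j k) = k.
Proof.
move=> ij ck kj; have [e1 e2 e3 cs] := transferP ij ck kj.
have ji : j != i by rewrite eq_sym.
have si : (0 < transfer i j k i)%N by rewrite e1.
have [f1 f2 f3 _] := transferP ji cs si.
apply/ffunP => l; apply/val_inj => /=.
have [->|li] := eqVneq l i; first by rewrite f2 e1.
have [->|lj] := eqVneq l j; first by rewrite f1 e2 prednK.
by rewrite f3// e3.
Qed.

(** Only two factors change, each by a rational function given by the recurrence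
    of [Gamma]. *)
Lemma dmweight_transfer i j k : i != j -> composition k -> (0 < k j)%N ->
  dmweight (transfer i j k) * ((transfer i j k i)%:R * ((transfer i j k j)%:R + a j)) =
  dmweight k * ((k j)%:R * ((k i)%:R + a i)).
Proof.
move=> ij ck kj; have [e1 e2 e3 cs] := transferP ij ck kj.
rewrite /dmweight ck cs.
rewrite [X in X * _ = _](prod_split2 _ ij) [X in _ = X * _](prod_split2 _ ij).
rewrite e1 e2.
have -> : \prod_(l | (l != i) && (l != j)) pochratio (a l) (transfer i j k l) =
          \prod_(l | (l != i) && (l != j)) pochratio (a l) (k l).
  by apply: eq_bigr => l /andP[li lj]; rewrite e3.
have h1 := pochratioS (k i) (a_gt0 i).
have h2 := pochratioS (k j).-1 (a_gt0 j); rewrite prednK// in h2.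
move: h1 h2; move: (\prod_(_ | _) _) => Q.
move: (pochratio (a i) (k i).+1) (pochratio (a i) (k i)) => p p'.
move: (pochratio (a j) (k j).-1) (pochratio (a j) (k j)) => q q' h1 h2.
transitivity (Q * (p * (k i).+1%:R) * (q * ((k j).-1%:R + a j))); first by ring.
by rewrite h1 -h2; ring.
Qed.

(** Detailed balance for the move of one particle from level [j] to level [i]:
    reversing the move exchanges the two sides. *)
Lemma dm_exchange i j F : i != j ->
  fexp dmweight (fun k => (k j)%:R * ((k i)%:R + a i) * F (transfer i j k)) =
  fexp dmweight (fun k => (k i)%:R * ((k j)%:R + a j) * F k).
Proof.
move=> ij; congr (_ / _); have ji : j != i by rewrite eq_sym.
have h0 k l (x : R) : ~~ (composition k && (0 < k l)%N) ->
    dmweight k * ((k l)%:R * x) = 0.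
  rewrite negb_and /dmweight => /orP[/negbTE ->|]; first by rewrite mul0r.
  by rewrite -leqNgt leqn0 => /eqP ->; rewrite mul0r mulr0.
rewrite (bigID (fun k => composition k && (0 < k j)%N))/= addrC big1 ?add0r.
  rewrite [RHS](bigID (fun k => composition k && (0 < k i)%N))/= addrC.
  rewrite [X in _ = X + _]big1 ?add0r; last first.
    by move=> k nk; rewrite -mulrA h0.
  rewrite (reindex_onto (transfer j i) (transfer i j))/=; last first.
    by move=> k /andP[ck kj]; rewrite transferK.
  apply: eq_big => k.
    apply/idP/idP => [/andP[/andP[ck kj] /eqP e]|/andP[ck ki]].
      have [e1 _ _ cs] := transferP ij ck kj.
      by rewrite -e cs e1.
    have [_ e2 _ cs] := transferP ji ck ki.
    rewrite cs transferK// eqxx andbT/=.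
    by have [-> _ _ _] := transferP ji ck ki.
  move=> /andP[/andP[ck kj] /eqP e].
  have := dmweight_transfer ij ck kj; rewrite e => h.
  rewrite mulrA [RHS]mulrA; congr (_ * _); exact: esym.
by move=> k nk; rewrite -mulrA h0.
Qed.

End DirichletMultinomial.

(** * Fluctuations and the discrete Stein identity *)

Ltac nonneg := repeat first
  [ assumption | exact: expR_ge0 | exact: sqr_ge0 | exact: normr_ge0
  | exact: normal_pdf_ge0 | exact: ler0n | exact: ltW
  | apply: addr_ge0 | apply: mulr_ge0 | rewrite invr_ge0 ].

Lemma is_derive_bigsum (R : realType) (I : Type) (r : seq I) (F : I -> R -> R)
    (dF : I -> R) (x : R) :
  (forall i, is_derive x (1 : R) (F i) (dF i)) ->
  is_derive x (1 : R) (fun s => \sum_(i <- r) F i s) (\sum_(i <- r) dF i).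
Proof.
move=> dFF; elim: r => [|i r IH].
  rewrite big_nil (_ : (fun s => _) = cst 0); last first.
    by apply/funext => s; rewrite big_nil.
  exact: is_derive_cst.
rewrite big_cons (_ : (fun s => _) = F i + (fun s => \sum_(j <- r) F j s)).
  exact: is_deriveD.
by apply/funext => s; rewrite big_cons.
Qed.

Section ScaledModel.
Context {R : realType} (n : nat) (g : 'I_n.+1 -> R).
Hypothesis g_gt0 : forall i, 0 < g i.
Hypothesis sum_g : \sum_i g i = 1.
Implicit Types (i j l : 'I_n.+1) (u : 'I_n.+1 -> R) (N : nat) (G h : R).

Lemma g_le1 i : g i <= 1.
Proof.
by rewrite -sum_g (bigD1 i)//= lerDl sumr_ge0// => j _; exact: ltW.
Qed.

Definition dmexp N G : ({ffun 'I_n.+1 -> 'I_N.+1} -> R) -> R :=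
  fexp (dmweight (fun i => g i * G)).

Definition fluct N h i (k : {ffun 'I_n.+1 -> 'I_N.+1}) : R :=
  Num.sqrt h * (g i - (k i)%:R / N%:R).

Definition linfluct N h u (k : {ffun 'I_n.+1 -> 'I_N.+1}) : R :=
  \sum_i u i * fluct h i k.

(** The factor that plays the variance in [dm_stein]; it converges to
    [s2 * g i * g j]. *)
Definition jumprate N G h i j (k : {ffun 'I_n.+1 -> 'I_N.+1}) : R :=
  (k j)%:R * ((k i)%:R + g i * G) * h / (G * N%:R ^+ 2).

Definition varscale N G h : R := (N%:R + G) * h / (N%:R * G).

(** What the three regimes have in common: the mesh of the fluctuations and
    the error on the limit variance are of the order of [(sqrt h)^-1]. *)
Definition scaling (C s2 : R) N G h : Prop :=
  [/\ (0 < N)%N, 0 < G, 1 <= h, Num.sqrt h / N%:R <= C / Num.sqrt h &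
      `|varscale N G h - s2| <= C / Num.sqrt h].

Section FixedParameters.
Variables (N : nat) (G h : R).
Hypotheses (N_gt0 : (0 < N)%N) (G_gt0 : 0 < G) (h_ge1 : 1 <= h).
Local Notation conf := {ffun 'I_n.+1 -> 'I_N.+1}.
Local Notation a := (fun i => g i * G).
Local Notation w := (dmweight a).
Local Notation E := (@dmexp N G).
Local Notation Z := (@fluct N h).
Local Notation D := (@jumprate N G h).
Local Notation eta := (Num.sqrt h / N%:R).
Implicit Types (k : conf) (F : conf -> R).

Lemma a_gt0 i : 0 < g i * G. Proof. by rewrite mulr_gt0. Qed.
Let w_ge0 k : 0 <= w k. Proof. by apply: dmweight_ge0; exact: a_gt0. Qed.
Let w_gt0 : 0 < \sum_(k : conf) w k. Proof. by apply: sum_dmweight_gt0; exact: a_gt0. Qed.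
Let N_gt0R : 0 < (N%:R : R). Proof. by rewrite ltr0n. Qed.
Let sqrth_gt0 : 0 < Num.sqrt h.
Proof. by rewrite sqrtr_gt0 (lt_le_trans ltr01). Qed.

Lemma dmexpD F1 F2 : E (fun k => F1 k + F2 k) = E F1 + E F2.
Proof. exact: fexpD. Qed.
Lemma dmexpB F1 F2 : E (fun k => F1 k - F2 k) = E F1 - E F2.
Proof. exact: fexpB. Qed.
Lemma dmexpZ c F : E (fun k => c * F k) = c * E F.
Proof. exact: fexpZ. Qed.
Lemma dmexp_cst c : E (fun=> c) = c.
Proof. exact: fexp_cst. Qed.
Lemma dmexp_sum (I : Type) (r : seq I) (P : pred I) (F : I -> conf -> R) :
  E (fun k => \sum_(i <- r | P i) F i k) = \sum_(i <- r | P i) E (F i).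
Proof. exact: fexp_sum. Qed.
Lemma le_dmexp F1 F2 : (forall k, composition k -> F1 k <= F2 k) -> E F1 <= E F2.
Proof.
by move=> H; apply: le_fexp => // k /dmweight_gt0_composition; exact: H.
Qed.
Lemma eq_dmexp F1 F2 : (forall k, composition k -> F1 k = F2 k) -> E F1 = E F2.
Proof.
by move=> H; apply: eq_fexp => // k /dmweight_gt0_composition; exact: H.
Qed.
Lemma dmexp_ge0 F : (forall k, 0 <= F k) -> 0 <= E F.
Proof. by move=> H; apply: fexp_ge0. Qed.
Lemma ler_norm_dmexp F : `|E F| <= E (fun k => `|F k|).
Proof. exact: ler_norm_fexp. Qed.

Lemma sum_fluct k : composition k -> \sum_i Z i k = 0.
Proof.
move=> /eqP ck; rewrite -mulr_sumr sumrB sum_g -mulr_suml -natr_sum ck.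
by rewrite divff ?subrr ?mulr0// gt_eqF.
Qed.

Lemma linfluct_transfer u i j k : i != j -> composition k -> (0 < k j)%N ->
  linfluct h u (transfer i j k) = linfluct h u k - eta * (u i - u j).
Proof.
move=> ij ck kj; have [e1 e2 e3 _] := transferP ij ck kj.
rewrite /linfluct (bigD1 i)//= (bigD1 j)/=; last by rewrite eq_sym.
rewrite [in RHS](bigD1 i)//= [in RHS](bigD1 j)/=; last by rewrite eq_sym.
rewrite [X in _ + (_ + X) = _](eq_bigr (fun l => u l * Z l k)); last first.
  by move=> l /andP[li lj]; rewrite /fluct e3.
move: (\sum_(_ | _) _) => Q.
have -> : Z i (transfer i j k) = Z i k - eta.
  by rewrite /fluct e1 -natr1; field; rewrite gt_eqF.
have -> : Z j (transfer i j k) = Z j k + eta.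
  rewrite /fluct e2 -[in RHS](prednK kj) -natr1; field; by rewrite gt_eqF.
ring.
Qed.

Lemma jumprate_ge0 i j k : 0 <= D i j k.
Proof.
have h0 : 0 <= h by exact: le_trans ler01 h_ge1.
by rewrite divr_ge0 ?mulr_ge0 ?exprn_ge0 ?addr_ge0 ?(ltW G_gt0) ?(ltW (a_gt0 _)).
Qed.

(** The frequency of level [j] times the mixture of the frequency of level [i]
    and of [g i]: both tend to the corresponding [g]. *)
Lemma jumprateE i j k :
  D i j k = varscale N G h * ((g j - Z j k / Num.sqrt h) *
     ((k i)%:R + g i * G) / (N%:R + G)).
Proof.
have -> : g j - Z j k / Num.sqrt h = (k j)%:R / N%:R.
  by rewrite /fluct; field; rewrite !gt_eqF.
rewrite /jumprate /varscale; field; rewrite !gt_eqF//.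
by rewrite addr_gt0.
Qed.

Lemma varscale_ge0 : 0 <= varscale N G h.
Proof.
rewrite divr_ge0 ?mulr_ge0 ?addr_ge0// ?(ltW G_gt0)//.
exact: le_trans ler01 h_ge1.
Qed.

Lemma conf_frac i k : 0 <= ((k i)%:R / N%:R : R) <= 1.
Proof.
rewrite divr_ge0//= ler_pdivrMr// mul1r ler_nat -ltnS; exact: ltn_ord.
Qed.

Lemma jumprate_approx i j k : `|D i j k - varscale N G h * (g i * g j)| <=
  varscale N G h * ((`|Z i k| + `|Z j k|) / Num.sqrt h).
Proof.
rewrite jumprateE -mulrBr normrM (ger0_norm varscale_ge0).
apply: ler_wpM2l; first exact: varscale_ge0.
have -> : (g j - Z j k / Num.sqrt h) = (k j)%:R / N%:R.
  by rewrite /fluct; field; rewrite !gt_eqF.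
have NG : 0 < N%:R + G by rewrite addr_gt0.
set q : R := ((k i)%:R + g i * G) / (N%:R + G).
set p : R := (k j)%:R / N%:R.
have pE : p - g j = - (Z j k / Num.sqrt h).
  by rewrite /p /fluct; field; rewrite !gt_eqF.
have qE : q - g i = - (Z i k / Num.sqrt h) * (N%:R / (N%:R + G)).
  by rewrite /q /fluct; field; rewrite !gt_eqF.
have /andP[p0 p1] : 0 <= p <= 1 by exact: conf_frac.
rewrite -mulrA -/q.
have -> : p * q - g i * g j = p * (q - g i) + g i * (p - g j) by ring.
rewrite mulrDl; apply: le_trans (ler_normD _ _) _; apply: lerD.
  rewrite normrM (ger0_norm p0); apply: (@le_trans _ _ `|q - g i|).
      by rewrite ler_piMl.
    rewrite qE normrM normrN normf_div (ger0_norm (ltW sqrth_gt0)).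
    rewrite ler_piMr ?divr_ge0// ?(ltW sqrth_gt0)//.
    rewrite ger0_norm ?divr_ge0// ?(ltW NG)//.
    by rewrite ler_pdivrMr// mul1r lerDl ltW.
rewrite normrM pE normrN normf_div (ger0_norm (ltW sqrth_gt0)).
rewrite ler_piMl ?divr_ge0// ?(ltW sqrth_gt0)//.
by rewrite ger0_norm ?g_le1// ltW.
Qed.

Lemma jumprate_le i j k : D i j k <= varscale N G h.
Proof.
rewrite jumprateE -[leRHS]mulr1; apply: ler_wpM2l; first exact: varscale_ge0.
have NG : 0 < N%:R + G by rewrite addr_gt0.
have -> : (g j - Z j k / Num.sqrt h) = (k j)%:R / N%:R.
  by rewrite /fluct; field; rewrite !gt_eqF.
rewrite -mulrA; have /andP[p0 p1] := conf_frac j k.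
rewrite -[leRHS]mulr1 ler_pM//.
  by rewrite divr_ge0 ?(ltW NG)// addr_ge0// ltW// a_gt0.
rewrite ler_pdivrMr// mul1r lerD//.
  by rewrite ler_nat -ltnS; exact: ltn_ord.
by rewrite ler_piMl ?g_le1// ltW.
Qed.

(** The discrete counterpart of the Gaussian integration by parts
    [E (y F y) = s ^+ 2 * E (F' y)]. *)
Lemma dm_stein i j F : i != j ->
  E (fun k => (Z i k * g j - Z j k * g i) * F k) =
  E (fun k => D i j k * ((F k - F (transfer i j k)) / eta)).
Proof.
move=> ij; have := @dm_exchange R n N a a_gt0 i j F ij.
rewrite -/(@dmexp N G) => H.
pose c : R := Num.sqrt h / (G * N%:R).
transitivity (E (fun k => c * ((k j)%:R * ((k i)%:R + g i * G) * F k -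
    (k i)%:R * ((k j)%:R + g j * G) * F k))).
  apply: eq_dmexp => k _; rewrite /fluct /c; field.
  by rewrite !gt_eqF.
rewrite dmexpZ dmexpB -[in LHS]H -dmexpB -dmexpZ; apply: eq_dmexp => k _.
have DE : D i j k = (k j)%:R * ((k i)%:R + g i * G) * Num.sqrt h ^+ 2
     / (G * N%:R ^+ 2) by rewrite sqr_sqrtr// (le_trans ler01).
rewrite DE /c; field.
by rewrite !gt_eqF.
Qed.

Lemma dm_stein_expR u t i j :
  E (fun k => (Z i k * g j - Z j k * g i) * expR (t * linfluct h u k)) =
  E (fun k => D i j k * ((1 - expR (- (eta * (t * (u i - u j))))) / eta)
              * expR (t * linfluct h u k)).
Proof.
have [->|ij] := eqVneq i j.
  transitivity (E (fun=> 0)); last first.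
    by apply: eq_dmexp => k _; rewrite !subrr !mulr0 oppr0 expR0 subrr mul0r mulr0 mul0r.
  by apply: eq_dmexp => k _; rewrite subrr mul0r.
rewrite dm_stein//; apply: eq_dmexp => k ck.
have [kj|kj] := posnP (k j); first by rewrite /jumprate kj !mul0r.
rewrite linfluct_transfer// mulrBr expRD.
rewrite -[X in _ = _ * X * _]/(_ / _) (mulrCA eta).
ring.
Qed.

(** Summed over [j], and over [i] with weights [u i], the left-hand sides of
    [dm_stein] give back [linfluct], as the fluctuations sum to [0] and [g] to
    [1]. *)
Lemma mgf_stein u t :
  E (fun k => linfluct h u k * expR (t * linfluct h u k)) =
  E (fun k => (\sum_i \sum_j u i *
      (D i j k * ((1 - expR (- (eta * (t * (u i - u j))))) / eta)))
              * expR (t * linfluct h u k)).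
Proof.
transitivity (\sum_i \sum_j u i *
  E (fun k => (Z i k * g j - Z j k * g i) * expR (t * linfluct h u k))).
  under eq_bigr do under eq_bigr do rewrite -dmexpZ.
  under eq_bigr do rewrite -dmexp_sum.
  rewrite -dmexp_sum; apply: eq_dmexp => k ck.
  under eq_bigr do under eq_bigr do rewrite mulrA.
  under eq_bigr do rewrite -mulr_suml.
  rewrite -mulr_suml; congr (_ * _); rewrite /linfluct; apply: eq_bigr => i _.
  by rewrite -mulr_sumr sumrB -mulr_sumr -mulr_suml sum_g mulr1 sum_fluct// mul0r subr0.
under eq_bigr do under eq_bigr do rewrite dm_stein_expR -dmexpZ.
under eq_bigr do rewrite -dmexp_sum.
rewrite -dmexp_sum; apply: eq_dmexp => k ck.
rewrite mulr_suml; apply: eq_bigr => i _; rewrite mulr_suml; apply: eq_bigr => j _.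
by rewrite !mulrA.
Qed.

Lemma is_derive_dmmgf u (t : R) :
  is_derive t (1 : R) (fun s => E (fun k => expR (s * linfluct h u k)))
    (E (fun k => linfluct h u k * expR (t * linfluct h u k))).
Proof.
rewrite /dmexp /fexp.
have H2 : is_derive t (1 : R) (fun s => \sum_(k : conf) w k * expR (s * linfluct h u k))
   (\sum_(k : conf) w k * (linfluct h u k * expR (t * linfluct h u k))).
  have dF (k : conf) : is_derive t (1 : R) (fun s => w k * expR (s * linfluct h u k))
      (w k * (linfluct h u k * expR (t * linfluct h u k))).
    by apply: is_derive_eq; rewrite /GRing.scale/=; ring.
  exact: (is_derive_bigsum (index_enum _) dF).
move: H2; set S := (fun s => \sum_(k : conf) _) => H2.
rewrite (_ : (fun s => _) = (\sum_(k : conf) w k)^-1 *: S); last first.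
  by apply/funext => s; rewrite /S /= [RHS]mulrC.
by rewrite mulrC; exact: is_deriveZ.
Qed.

End FixedParameters.
End ScaledModel.

(** * Moment generating functions *)

Lemma eq_ler (R : realType) (x y : R) : x = y -> x <= y.
Proof. by move=> ->. Qed.

Lemma ltr_sum_norm (R : realType) (n : nat) (u : 'I_n -> R) i :
  `|u i| <= \sum_j `|u j|.
Proof. by rewrite (bigD1 i)//= lerDl sumr_ge0. Qed.

Section ExpBounds.
Context {R : realType}.
Implicit Types x y b : R.

Lemma expR_sub1_bound y : `|1 - expR (- y)| <= `|y| * expR `|y|.
Proof.
have h1 := expR_ge1Dx (- y); have h2 := expR_ge1Dx y.
have p := expR_gt0 (- y); have e1 : expR (- y) * expR y = 1.
  by rewrite -expRD addNr expR0.
have [y0|y0] := leP 0 y.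
  have e2 : 1 <= expR y by apply: le_trans h2; rewrite lerDl.
  have : 0 <= 1 - expR (- y) by rewrite subr_ge0 expR_le1 oppr_le0.
  by move=> /ger0_norm ->; rewrite (ger0_norm y0); nra.
rewrite ler0_norm; last by rewrite subr_le0 -[leLHS]expR0 ler_expR oppr_ge0 ltW.
rewrite (ltr0_norm y0); have := ler_wpM2r (ltW p) h2.
by rewrite (mulrC (expR y)) e1; lra.
Qed.

(** Applied to [y = eta * x], it compares the difference quotient of the
    exponential along a move with its derivative. *)
Lemma expR_sub1_quad y : `|1 - expR (- y) - y| <= y ^+ 2 * expR `|y|.
Proof.
have h1 := expR_ge1Dx (- y); have h2 := expR_ge1Dx y.
have B := expR_sub1_bound y.
have e1 : expR (- y) * expR y = 1 by rewrite -expRD addNr expR0.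
have p := expR_gt0 (- y).
rewrite ler0_norm; last by lra.
apply: (@le_trans _ _ (`|y| * `|1 - expR (- y)|)); last first.
  rewrite -real_normK ?num_real// expr2 -mulrA ler_wpM2l//.
rewrite -normrM; apply: le_trans (ler_norm _).
have := ler_wpM2r (ltW p) h2.
by rewrite (mulrC (expR y)) e1; lra.
Qed.

Variables (b eta x : R).
Hypotheses (eta_gt0 : 0 < eta) (etab : eta * `|x| <= b).

Lemma jump_quot_bound :
  `|(1 - expR (- (eta * x))) / eta| <= `|x| * expR b.
Proof.
rewrite normrM (gtr0_norm (x := eta^-1)) ?invr_gt0// ler_pdivrMr//.
apply: le_trans (expR_sub1_bound _) _.
rewrite normrM (gtr0_norm eta_gt0) [leRHS](_ : _ = eta * `|x| * expR b).
  by rewrite ler_wpM2l ?ler_expR// mulr_ge0// ltW.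
by ring.
Qed.

Lemma jump_quot_approx :
  `|(1 - expR (- (eta * x))) / eta - x| <= eta * (x ^+ 2 * expR b).
Proof.
have -> : (1 - expR (- (eta * x))) / eta - x =
  (1 - expR (- (eta * x)) - eta * x) / eta by field; rewrite gt_eqF.
rewrite normrM (gtr0_norm (x := eta^-1)) ?invr_gt0// ler_pdivrMr//.
apply: le_trans (expR_sub1_quad _) _.
rewrite normrM (gtr0_norm eta_gt0) exprMn.
rewrite [leRHS](_ : _ = eta ^+ 2 * x ^+ 2 * expR b); last by ring.
by rewrite ler_wpM2l ?ler_expR// mulr_ge0 ?sqr_ge0.
Qed.

End ExpBounds.

Section UniformMgf.
Context {R : realType} (n : nat) (g : 'I_n.+1 -> R).
Hypothesis g_gt0 : forall i, 0 < g i.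
Hypothesis sum_g : \sum_i g i = 1.
Variables (C s2 : R).
Hypotheses (C_ge0 : 0 <= C) (s2_ge0 : 0 <= s2).
Implicit Types (i j l : 'I_n.+1) (u : 'I_n.+1 -> R) (N : nat) (G h : R).
Local Notation L := (linfluct g).

(** The limit variance of [linfluct], in the form in which the identity for the
    moment generating function produces it; see [limvar_sqr]. *)
Definition limvar u : R := s2 * \sum_i \sum_j u i * (g i * g j * (u i - u j)).

Lemma scaling_sqrt N G h : scaling C s2 N G h ->
  [/\ 0 < Num.sqrt h, 0 < Num.sqrt h / N%:R, 0 < (Num.sqrt h)^-1 <= 1,
      Num.sqrt h / N%:R <= C & varscale N G h <= s2 + C].
Proof.
move=> [N0 G0 h1 eC vC].
have s1 : 1 <= Num.sqrt h by rewrite -sqrtr1 ler_wsqrtr.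
have s0 : 0 < Num.sqrt h by exact: lt_le_trans s1.
have i1 : (Num.sqrt h)^-1 <= 1 by rewrite invf_le1.
have CC : C / Num.sqrt h <= C by rewrite ler_piMr.
split=> //.
- by rewrite divr_gt0// ltr0n.
- by rewrite invr_gt0 s0.
- exact: le_trans CC.
- rewrite -lerBlDl; apply: le_trans (ler_norm _) _; exact: le_trans CC.
Qed.

Lemma jumprate_lim N G h i j (k : {ffun 'I_n.+1 -> 'I_N.+1}) :
  scaling C s2 N G h ->
  `|jumprate g G h i j k - s2 * (g i * g j)| <=
  (s2 + C) * ((`|fluct g h i k| + `|fluct g h j k|) / Num.sqrt h)
  + C / Num.sqrt h.
Proof.
move=> sc; have [s0 e0 _ eC vC] := scaling_sqrt sc; have [N0 G0 h1 _ vh] := sc.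
set D := jumprate _ _ _ _ _ _.
have -> : D - s2 * (g i * g j) = (D - varscale N G h * (g i * g j)) +
   (varscale N G h - s2) * (g i * g j) by ring.
apply: le_trans (ler_normD _ _) _; apply: lerD.
  apply: le_trans (jumprate_approx g_gt0 sum_g N0 G0 h1 i j k) _.
  by rewrite ler_wpM2r// divr_ge0 ?addr_ge0// ltW.
rewrite normrM; apply: le_trans vh; rewrite ler_piMr//.
have gg l : 0 <= g l <= 1 by rewrite (g_le1 g_gt0 sum_g) ltW.
have /andP[? ?] := gg i; have /andP[? ?] := gg j.
by rewrite ger0_norm ?mulr_ge0// mulr_ile1.
Qed.

Let U u : R := \sum_i `|u i|.

Lemma diff_bound u (t : R) i j : 0 <= t <= 1 -> `|t * (u i - u j)| <= 2 * U u.
Proof.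
move=> /andP[t0 t1]; rewrite normrM (ger0_norm t0).
apply: (@le_trans _ _ (1 * (`|u i| + `|u j|))).
  by rewrite ler_pM// ler_normB.
rewrite mul1r mulr_natl mulr2n.
by apply: lerD; exact: ltr_sum_norm.
Qed.

Lemma U_ge0 u : 0 <= U u. Proof. exact: sumr_ge0. Qed.

(** A Gronwall argument on [t |-> E (expR (t * L))], whose logarithmic
    derivative is bounded because the jump rates are. *)
Lemma dmmgf_bounded u : exists K, forall N G h, scaling C s2 N G h ->
  @dmexp _ _ g N G (fun k => expR (L h u k)) <= K.
Proof.
pose B : R := \sum_(i < n.+1) \sum_(j < n.+1)
  U u * ((s2 + C) * (2 * U u * expR (C * (2 * U u)))).
exists (expR B) => N G h sc.
have [s0 e0 _ eC vC] := scaling_sqrt sc; have [N0 G0 h1 _ _] := sc.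
set E := @dmexp _ _ g N G.
pose M t := E (fun k => expR (t * L h u k)).
pose M' t := E (fun k => L h u k * expR (t * L h u k)).
have dM t : is_derive t (1 : R) M (M' t) by exact: is_derive_dmmgf.
have M'le t : 0 <= t <= 1 -> M' t <= B * M t.
  move=> t01; rewrite /M' /E (mgf_stein g_gt0 sum_g N0 G0 h1).
  rewrite -dmexpZ; apply: le_dmexp => // k ck.
  rewrite ler_wpM2r ?expR_ge0//; apply: ler_sum => i _; apply: ler_sum => j _.
  apply: le_trans (ler_norm _) _; rewrite [X in X <= _]normrM.
  apply: ler_pM => //; first exact: ltr_sum_norm.
  rewrite [X in X <= _]normrM; apply: ler_pM => //.
    rewrite ger0_norm ?jumprate_ge0//; apply: le_trans vC.
    exact: jumprate_le.
  have db := diff_bound u i j t01.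
  apply: le_trans (jump_quot_bound e0 (b := C * (2 * U u)) _) _.
    by rewrite ler_pM// ltW.
  by rewrite ler_wpM2r ?expR_ge0.
(* [psi] is nonincreasing, since [M' <= B * M]. *)
pose psi t := expR (- (B * t)) * M t.
have dpsi t : is_derive t (1 : R) psi (expR (- (B * t)) * (M' t - B * M t)).
  have := dM t => dMt; apply: is_derive_eq.
  rewrite /GRing.scale/=; ring.
have [|c c01] := @MVT_segment R psi _ 0 1 ler01 (fun x _ => dpsi x).
  apply: derivable_within_continuous => t _; exact: (@ex_derive _ _ _ _ _ _ _ (dpsi t)).
have c01' : 0 <= c <= 1 by move: c01; rewrite in_itv.
have M0 : M 0 = 1.
  rewrite /M -[RHS](@dmexp_cst _ _ _ g_gt0 N G G0); apply: eq_dmexp => // k _.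
  by rewrite mul0r expR0.
rewrite /psi mulr0 oppr0 expR0 mul1r !mulr1 M0 addr0 mulr1 => eqc.
have : expR (- B) * M 1 <= 1.
  rewrite -subr_le0 eqc pmulr_rle0 ?expR_gt0// subr_le0; exact: M'le.
rewrite expRN mulrC ler_pdivrMr ?expR_gt0// mul1r => H.
apply: le_trans H; rewrite /M; apply: le_dmexp => // k _.
by rewrite mul1r.
Qed.

Lemma limvarE u (t : R) : t * limvar u =
  \sum_i \sum_j u i * (s2 * (g i * g j) * (t * (u i - u j))).
Proof.
rewrite /limvar mulrA mulr_sumr; apply: eq_bigr => i _.
by rewrite mulr_sumr; apply: eq_bigr => j _; ring.
Qed.

Lemma norm_le_expR (x : R) : `|x| <= expR x + expR (- x).
Proof.
have := expR_ge1Dx x; have := expR_ge1Dx (- x).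
have := expR_gt0 x; have := expR_gt0 (- x).
by case: (ger0P x) => *; lra.
Qed.

Lemma expR_convex01 (t x : R) : 0 <= t <= 1 -> expR (t * x) <= 1 + expR x.
Proof.
move=> /andP[t0 t1]; have [x0|x0] := leP 0 x.
  by rewrite ler_wpDl// ler_expR ler_piMl.
rewrite ler_wpDr ?expR_ge0// -[leRHS]expR0 ler_expR.
by rewrite mulr_ge0_le0// ltW.
Qed.

Lemma linfluctD N h u v (k : {ffun 'I_n.+1 -> 'I_N.+1}) :
  L h (fun i => u i + v i) k = L h u k + L h v k.
Proof. by rewrite -big_split/=; apply: eq_bigr => i _; rewrite mulrDl. Qed.

Lemma linfluct_coord N h i (c : R) (k : {ffun 'I_n.+1 -> 'I_N.+1}) :
  L h (fun j => if j == i then c else 0) k = c * fluct g h i k.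
Proof.
rewrite /linfluct (bigD1 i)//= eqxx big1 ?addr0// => j /negbTE ->.
by rewrite mul0r.
Qed.

(** A fluctuation is dominated by exponentials of linear functions, whose
    expectations are bounded. *)
Lemma fluct_expR_bounded u i : exists K, forall N G h, scaling C s2 N G h ->
  forall t, 0 <= t <= 1 ->
  @dmexp _ _ g N G (fun k => `|fluct g h i k| * expR (t * L h u k)) <= K.
Proof.
pose ei (c : R) := fun j : 'I_n.+1 => if j == i then c else 0.
have [K1 H1] := dmmgf_bounded (ei 1).
have [K2 H2] := dmmgf_bounded (ei (-1)).
have [K3 H3] := dmmgf_bounded (fun l => u l + ei 1 l).
have [K4 H4] := dmmgf_bounded (fun l => u l + ei (-1) l).
exists (K1 + K2 + (K3 + K4)) => N G h sc t t01.
have [N0 G0 h1 _ _] := sc.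
apply: (@le_trans _ _ (@dmexp _ _ g N G (fun k =>
   expR (L h (ei 1) k) + expR (L h (ei (-1)) k) +
   (expR (L h (fun l => u l + ei 1 l) k) +
    expR (L h (fun l => u l + ei (-1) l) k))))).
  (* [|z| * expR (t * l) <= (expR z + expR (- z)) * (1 + expR l)]. *)
  apply: le_dmexp => // k _; rewrite !linfluctD !expRD !linfluct_coord.
  rewrite mul1r mulN1r.
  have h2 := norm_le_expR (fluct g h i k).
  have h3 := expR_convex01 (L h u k) t01.
  apply: le_trans (ler_pM _ _ h2 h3) _ => //.
  by apply: eq_ler; ring.
rewrite !dmexpD; apply: lerD; apply: lerD.
- exact: H1.
- exact: H2.
- exact: H3.
- exact: H4.
Qed.

(** The derivative is given by [mgf_stein]; each jump rate is replaced by its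
    limit and each difference quotient by a derivative, at a cost linear in the
    fluctuations. *)
Lemma dmmgf_derive_approx u : exists K, forall N G h, scaling C s2 N G h ->
  forall t, 0 <= t <= 1 ->
  `|@dmexp _ _ g N G (fun k => L h u k * expR (t * L h u k)) -
    t * limvar u * @dmexp _ _ g N G (fun k => expR (t * L h u k))|
  <= K / Num.sqrt h.
Proof.
have [K0 HK0] := dmmgf_bounded u.
have /(_ _)/cid KZ := fluct_expR_bounded u.
pose Kz i := sval (KZ i); have HKz i := svalP (KZ i).
pose A : R := 2 * U u * expR (C * (2 * U u)).
pose B : R := C * A + s2 * (C * ((2 * U u) ^+ 2 * expR (C * (2 * U u)))).
exists (\sum_i \sum_j U u * ((s2 + C) * A * (Kz i + Kz j) + B * (1 + K0))).
move=> N G h sc t t01.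
have [s0 e0 /andP[i0 i1] eC vC] := scaling_sqrt sc; have [N0 G0 h1 eh vh] := sc.
have A0 : 0 <= A by rewrite !mulr_ge0 ?expR_ge0// U_ge0.
rewrite (mgf_stein g_gt0 sum_g N0 G0 h1) -dmexpZ -dmexpB.
apply: le_trans (ler_norm_dmexp _ _ _) _ => //.
pose T i j (k : {ffun 'I_n.+1 -> 'I_N.+1}) : R := U u *
  (((s2 + C) * A * (`|fluct g h i k| + `|fluct g h j k|) + B) / Num.sqrt h).
apply: (@le_trans _ _ (@dmexp _ _ g N G (fun k =>
    (\sum_i \sum_j T i j k) * expR (t * L h u k)))).
  apply: le_dmexp => // k ck.
  rewrite -mulrBl normrM (ger0_norm (expR_ge0 _)) ler_wpM2r ?expR_ge0//.
  rewrite limvarE -sumrB; apply: le_trans (ler_norm_sum _ _ _) _.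
  apply: ler_sum => i _; rewrite -sumrB; apply: le_trans (ler_norm_sum _ _ _) _.
  apply: ler_sum => j _; rewrite -mulrBr [X in X <= _]normrM.
  apply: ler_pM => //; first exact: ltr_sum_norm.
  have db := diff_bound u i j t01.
  set x := t * (u i - u j) in db *.
  have etab : Num.sqrt h / N%:R * `|x| <= C * (2 * U u) by rewrite ler_pM// ltW.
  set X := (1 - _) / _.
  have X1 : `|X| <= A.
    apply: le_trans (jump_quot_bound e0 etab) _.
    by rewrite ler_wpM2r ?expR_ge0.
  have X2 : `|X - x| <= C / Num.sqrt h * ((2 * U u) ^+ 2 * expR (C * (2 * U u))).
    apply: le_trans (jump_quot_approx e0 etab) _.
    apply: ler_pM; [by []|by rewrite mulr_ge0 ?sqr_ge0 ?expR_ge0|by []|].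
    by rewrite ler_wpM2r ?expR_ge0// -real_normK ?num_real// ler_pXn2r ?nnegrE// ?mulr_ge0 ?U_ge0.
  set D := jumprate _ _ _ _ _ _.
  have D1 := jumprate_lim i j k sc; rewrite -/D in D1.
  (* [X] is the difference quotient and [x] the derivative it approximates. *)
  have -> : D * X - s2 * (g i * g j) * x =
     (D - s2 * (g i * g j)) * X + s2 * (g i * g j) * (X - x) by ring.
  apply: le_trans (ler_normD _ _) _.
  rewrite (normrM (D - _)) (normrM (s2 * _)) (normrM s2) (ger0_norm s2_ge0).
  have gg1 : `|g i * g j| <= 1.
    rewrite ger0_norm ?mulr_ge0 ?(ltW (g_gt0 _))//.
    by rewrite mulr_ile1 ?(ltW (g_gt0 _))// (g_le1 g_gt0 sum_g).
  have Y1 := ler_pM (normr_ge0 _) (normr_ge0 _) D1 X1.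
  have Y2 : s2 * `|g i * g j| * `|X - x| <= s2 * 1 *
      (C / Num.sqrt h * ((2 * U u) ^+ 2 * expR (C * (2 * U u)))).
    apply: ler_pM => //; first by rewrite mulr_ge0.
    exact: ler_wpM2l.
  apply: le_trans (lerD Y1 Y2) _; by apply: eq_ler; rewrite /B; ring.
pose e (k : {ffun 'I_n.+1 -> 'I_N.+1}) : R := expR (t * L h u k).
have -> : @dmexp _ _ g N G (fun k => (\sum_i \sum_j T i j k) * e k) =
    \sum_i \sum_j @dmexp _ _ g N G (fun k => T i j k * e k).
  transitivity (@dmexp _ _ g N G (fun k => \sum_i \sum_j T i j k * e k)).
    apply: eq_dmexp => // k _; rewrite mulr_suml; apply: eq_bigr => i _.
    by rewrite mulr_suml.
  by rewrite dmexp_sum; apply: eq_bigr => i _; rewrite dmexp_sum.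
rewrite mulr_suml; apply: ler_sum => i _; rewrite mulr_suml; apply: ler_sum => j _.
have -> : @dmexp _ _ g N G (fun k => T i j k * e k) = U u *
   ((s2 + C) * A * (@dmexp _ _ g N G (fun k => `|fluct g h i k| * e k) +
     @dmexp _ _ g N G (fun k => `|fluct g h j k| * e k))
     + B * @dmexp _ _ g N G e) / Num.sqrt h.
  rewrite -dmexpD -!dmexpZ -dmexpD -dmexpZ mulrC -dmexpZ; apply: eq_dmexp => // k _.
  by rewrite /T; ring.
rewrite ler_wpM2r//.
rewrite ler_wpM2l ?U_ge0//; apply: lerD; apply: ler_wpM2l.
- by rewrite mulr_ge0// addr_ge0.
- by apply: lerD; exact: HKz.
- apply: addr_ge0; first exact: mulr_ge0.
  by do 2!(apply: mulr_ge0 => //); rewrite mulr_ge0 ?sqr_ge0 ?expR_ge0.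
- apply: (@le_trans _ _ (@dmexp _ _ g N G (fun k => 1 + expR (L h u k)))).
    by apply: le_dmexp => // k _; exact: expR_convex01.
  by rewrite dmexpD dmexp_cst// lerD2l; exact: HK0.
Qed.

Lemma limvar_ge0 u : 0 <= limvar u.
Proof.
rewrite mulr_ge0//; set S := (X in 0 <= X).
(* Half the sum of [S] with its copy under [i <-> j] is a sum of squares. *)
have S2 : S = \sum_i \sum_j u j * (g i * g j * (u j - u i)).
  rewrite /S exchange_big/=; apply: eq_bigr => i _; apply: eq_bigr => j _; ring.
have : 0 <= S + S.
  rewrite {2}S2 -big_split/= sumr_ge0// => i _; rewrite -big_split/= sumr_ge0// => j _.
  rewrite [leRHS](_ : _ = g i * g j * (u i - u j) ^+ 2); last by ring.
  exact: mulr_ge0 (mulr_ge0 (ltW (g_gt0 i)) (ltW (g_gt0 j))) (sqr_ge0 _).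
lra.
Qed.

(** The central limit theorem for moment generating functions, with rate:
    [t |-> expR (- t ^+ 2 * v / 2) * E (expR (t * L))] has a derivative
    of order [1 / sqrt h] on the unit interval. *)
Lemma dmmgf_approx u : exists2 K, 0 <= K & forall N G h, scaling C s2 N G h ->
  `|@dmexp _ _ g N G (fun k => expR (L h u k)) / expR (limvar u / 2) - 1|
   <= K / Num.sqrt h.
Proof.
have [K HK] := dmmgf_derive_approx u; exists `|K| => // N G h sc.
have [s0 e0 _ eC vC] := scaling_sqrt sc; have [N0 G0 h1 _ _] := sc.
set E := @dmexp _ _ g N G; set v := limvar u.
pose M t := E (fun k => expR (t * L h u k)).
pose M' t := E (fun k => L h u k * expR (t * L h u k)).
have dM t : is_derive t (1 : R) M (M' t) by exact: is_derive_dmmgf.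
pose psi t := expR (- (v / 2 * (t * t))) * M t.
have dpsi t : is_derive t (1 : R) psi
    (expR (- (v / 2 * (t * t))) * (M' t - t * v * M t)).
  have := dM t => dMt; apply: is_derive_eq.
  by rewrite /GRing.scale/=; field.
have [|c c01] := @MVT_segment R psi _ 0 1 ler01 (fun x _ => dpsi x).
  apply: derivable_within_continuous => t _; exact: (@ex_derive _ _ _ _ _ _ _ (dpsi t)).
have c01' : 0 <= c <= 1 by move: c01; rewrite in_itv.
have M0 : M 0 = 1.
  rewrite /M -[RHS](@dmexp_cst _ _ _ g_gt0 N G G0); apply: eq_dmexp => // k _.
  by rewrite mul0r expR0.
have M1 : M 1 = E (fun k => expR (L h u k)).
  by apply: eq_dmexp => // k _; rewrite mul1r.
rewrite /psi !mulr0 oppr0 expR0 mul1r !mulr1 M0 M1 addr0 mulr1 expRN mulrC => ->.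
rewrite mulr1 normrM (ger0_norm (expR_ge0 _)) -[leRHS]mul1r; apply: ler_pM => //.
  rewrite expR_le1 oppr_le0; have := limvar_ge0 u; rewrite -/v => v0.
  by rewrite mulr_ge0 ?divr_ge0// -expr2 sqr_ge0.
apply: le_trans (HK N G h sc c c01') _.
by rewrite ler_wpM2r ?ler_norm// ltW// invr_gt0.
Qed.

End UniformMgf.

(** * The one-dimensional Stein equation *)

Section SteinEquation.
Context {R : realType} (s : R).
Hypothesis s_gt0 : 0 < s.
Local Notation mu := (@lebesgue_measure R).
Local Notation p := (normal_pdf 0 s).
Implicit Types (x y t : R).

Let s_neq0 : s != 0. Proof. by rewrite gt_eqF. Qed.

Lemma normal0E t : p t = normal_peak s * expR (- t ^+ 2 / (s ^+ 2 *+ 2)).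
Proof. by rewrite normal_pdfE// /normal_fun subr0. Qed.

Lemma normal0_gt0 t : 0 < p t.
Proof. by rewrite normal0E mulr_gt0 ?expR_gt0 ?normal_peak_gt0. Qed.

Lemma is_derive_normal0V t :
  is_derive t (1 : R) (fun t => (p t)^-1) (t / s ^+ 2 / p t).
Proof.
have pV x : (p x)^-1 = (normal_peak s)^-1 * expR (x ^+ 2 / (s ^+ 2 *+ 2)).
  by rewrite normal0E invfM -expRN -mulNr opprK.
rewrite (_ : (fun t => _) =
    fun t => (normal_peak s)^-1 * expR (t ^+ 2 / (s ^+ 2 *+ 2))); last first.
  by apply/funext => x.
rewrite pV.
apply: is_derive_eq; rewrite /GRing.scale/=.
move: (expR _) => e; field.
by rewrite s_neq0 gt_eqF// normal_peak_gt0.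
Qed.

(** On a tail the Gaussian density is below a multiple of its translate:
    [t ^+ 2 >= y ^+ 2 + (t - y) ^+ 2] when [t] is beyond [y]. *)
Lemma normal0_tail y t : 0 <= y * (t - y) -> p t <= p y / p 0 * normal_pdf y s t.
Proof.
move=> yt; rewrite !normal0E normal_pdfE// /normal_fun.
rewrite expr0n/= oppr0 mul0r expR0 mulr1.
have P0 := normal_peak_gt0 s_neq0.
have -> : normal_peak s * expR (- y ^+ 2 / (s ^+ 2 *+ 2)) / normal_peak s *
   (normal_peak s * expR (- (t - y) ^+ 2 / (s ^+ 2 *+ 2))) =
   normal_peak s * expR ((- y ^+ 2 - (t - y) ^+ 2) / (s ^+ 2 *+ 2)).
  rewrite mulrDl expRD; move: (expR _) (expR _) P0 => e1 e2 P0.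
  by field; rewrite gt_eqF.
rewrite ler_pM2l// ler_expR ler_pM2r; first by nra.
by rewrite invr_gt0 pmulrn_lgt0// exprn_gt0.
Qed.

Variables (psi : R -> R) (B : R).
Hypothesis psi_cont : continuous psi.
Hypothesis psi_bnd : forall t, `|psi t| <= B.

Definition gmean : R := \int[mu]_t (psi t * p t).

Let B_ge0 : 0 <= B. Proof. by apply: le_trans (psi_bnd 0). Qed.

Lemma measurable_cont (f : R -> R) : continuous f -> measurable_fun setT f.
Proof. by move=> cf; exact: continuous_measurable_fun. Qed.

Lemma bounded_integrable (f : R -> R) c m : continuous f ->
  (forall t, `|f t| <= c) ->
  mu.-integrable setT (EFin \o (fun t => f t * normal_pdf m s t)).
Proof.
move=> cf fc.
apply: (@le_integrable _ _ _ mu setT _ _ (fun t => (c * normal_pdf m s t)%:E)) => //.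
- apply/measurable_EFinP/measurable_funM; first exact: measurable_cont.
  exact: measurable_normal_pdf.
- move=> t _ /=; rewrite lee_fin normrM normrM.
  rewrite (ger0_norm (normal_pdf_ge0 _ _ _)) ler_wpM2r ?normal_pdf_ge0//.
  exact: le_trans (fc t) (ler_norm _).
- have := @integrable_normal_pdf R m s.
  move=> /(integrableZl (measurableT) c); exact: eq_integrable.
Qed.

Lemma normal_integrableS (D : set R) m : measurable D ->
  mu.-integrable D (EFin \o normal_pdf m s).
Proof. by move=> mD; apply: integrableS (@integrable_normal_pdf R m s). Qed.

Lemma normal_integrableZ (D : set R) c m : measurable D ->
  mu.-integrable D (EFin \o (fun t => c * normal_pdf m s t)).
Proof.
move=> mD.
have : mu.-integrable D (fun t => c%:E * (EFin \o normal_pdf m s) t)%E.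
  by apply: integrableZl => //; exact: normal_integrableS.
by apply: eq_integrable.
Qed.

Lemma integral_normal0 m : \int[mu]_t normal_pdf m s t = 1.
Proof. by rewrite /Rintegral integral_normal_pdf. Qed.

Lemma gmean_bnd : `|gmean| <= B.
Proof.
rewrite /gmean; apply: le_trans (le_normr_Rintegral _ _) _ => //.
  exact: bounded_integrable psi_cont psi_bnd.
have -> : B = \int[mu]_t (B * p t).
  by rewrite RintegralZl ?integral_normal0 ?mulr1//; exact: integrable_normal_pdf.
apply: le_Rintegral => //.
- have := bounded_integrable 0 psi_cont psi_bnd.
  move=> /integrable_norm; exact: eq_integrable.
- have := integrableZl measurableT B (@integrable_normal_pdf R 0 s).
  exact: eq_integrable.
- move=> t _; rewrite normrM (ger0_norm (normal_pdf_ge0 _ _ _)).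
  by rewrite ler_wpM2r ?normal_pdf_ge0.
Qed.

Let q t := (psi t - gmean) * p t.

Lemma q_bnd t : `|q t| <= 2 * B * p t.
Proof.
rewrite normrM (ger0_norm (normal_pdf_ge0 _ _ _)) ler_wpM2r ?normal_pdf_ge0//.
apply: le_trans (ler_normB _ _) _; rewrite mulr_natl mulr2n.
by apply: lerD => //; exact: gmean_bnd.
Qed.

Lemma centered_cont : continuous (fun t => psi t - gmean).
Proof. by move=> t; apply: cvgB; [exact: psi_cont|exact: cvg_cst]. Qed.

Lemma q_integrable : mu.-integrable setT (EFin \o q).
Proof.
apply: (@bounded_integrable (fun t => psi t - gmean) (B + B)).
  exact: centered_cont.
move=> t; apply: le_trans (ler_normB _ _) _.
by apply: lerD => //; exact: gmean_bnd.
Qed.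

Lemma q_integrableS (D : set R) : measurable D -> mu.-integrable D (EFin \o q).
Proof. by move=> mD; apply: integrableS q_integrable. Qed.

Lemma q_cont : continuous q.
Proof.
by move=> t; apply: cvgM; [exact: centered_cont|exact: continuous_normal_pdf].
Qed.

Lemma q_int0 : \int[mu]_t q t = 0.
Proof.
rewrite /q; have -> : \int[mu]_t ((psi t - gmean) * p t) =
    \int[mu]_t (psi t * p t - gmean * p t).
  by apply: eq_Rintegral => t _; rewrite mulrBl.
rewrite RintegralB//.
- rewrite [X in _ - X]RintegralZl//; last exact: integrable_normal_pdf.
  by rewrite integral_normal0 mulr1 subrr.
- exact: bounded_integrable psi_cont psi_bnd.
- have := integrableZl measurableT gmean (@integrable_normal_pdf R 0 s).
  exact: eq_integrable.
Qed.

Let H y := \int[mu]_(t in `]-oo, y]) q t.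

Lemma is_derive_H y : is_derive y (1 : R) H (q y).
Proof.
have y1 : y < y + 1 by rewrite ltrDl.
have [|h1 h2] := @continuous_FTC1 R q -oo%O y (y + 1) y1
  (q_integrableS (measurable_itv `]-oo, (y + 1)])) _ (@q_cont y).
  by rewrite ltNyr.
by split => //; rewrite -derive1E.
Qed.

Let steinsol y := H y / p y / s ^+ 2.

Lemma is_derive_steinsol y :
  is_derive y (1 : R) steinsol ((y * steinsol y + psi y - gmean) / s ^+ 2).
Proof.
have d1 := is_derive_H y; have d2 := is_derive_normal0V y.
apply: is_derive_eq; rewrite /GRing.scale/= /steinsol /q.
have := normal0_gt0 y => py.
by field; rewrite s_neq0 gt_eqF.
Qed.

Lemma tail_bnd (D : set R) y : measurable D ->
  (forall t, D t -> 0 <= y * (t - y)) ->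
  `|\int[mu]_(t in D) q t| <= 2 * B * (p y / p 0).
Proof.
move=> mD Dy; apply: le_trans (le_normr_Rintegral _ _) _ => //.
  exact: q_integrableS.
apply: (@le_trans _ _ (\int[mu]_(t in D) (2 * B * (p y / p 0) * normal_pdf y s t))).
  apply: le_Rintegral => //.
  - have := q_integrableS mD.
    move=> /integrable_norm; exact: eq_integrable.
  - exact: normal_integrableZ.
  - move=> t Dt; apply: le_trans (q_bnd t) _; rewrite -[leRHS]mulrA.
    apply: ler_wpM2l; first by rewrite mulr_ge0.
    exact: normal0_tail (Dy _ Dt).
rewrite RintegralZl//; last first.
  exact: normal_integrableS.
rewrite -[leRHS]mulr1 ler_wpM2l//.
  by apply: mulr_ge0; [exact: mulr_ge0|rewrite divr_ge0 ?normal_pdf_ge0].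
rewrite -(integral_normal0 y) /Rintegral fine_le//.
- apply: integrable_fin_num => //.
  exact: normal_integrableS.
- apply: integrable_fin_num => //; exact: integrable_normal_pdf.
- apply: ge0_subset_integral => //.
  + by apply/measurable_EFinP; exact: measurable_normal_pdf.
  + by move=> t _; rewrite lee_fin normal_pdf_ge0.
Qed.

Lemma H_bnd y : `|H y| <= 2 * B * (p y / p 0).
Proof.
have [y0|y0] := leP y 0.
  apply: tail_bnd => // t; rewrite /= in_itv/= => ty.
  by rewrite mulr_le0// subr_le0.
(* Since [q] has mean zero, the other tail may be integrated instead. *)
have : H y + \int[mu]_(t in `]y, +oo[) q t = 0.
  rewrite -q_int0 /H -Rintegral_setU//.
  - congr (Rintegral _ _ _); apply/seteqP; split=> t //= _.
    by rewrite !in_itv/= andbT; case: (leP t y) => h; [left|right].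
  - by apply: q_integrableS; apply: measurableU.
  - apply/disj_setPRL => t; rewrite /= !in_itv/= andbT => yt.
    by apply/negP; rewrite -ltNge.
move=> /eqP; rewrite addr_eq0 => /eqP ->; rewrite normrN.
apply: tail_bnd => // t; rewrite /= in_itv/= andbT => ty.
by rewrite mulr_ge0 ?subr_ge0// ltW.
Qed.

Lemma steinsol_bnd y : `|steinsol y| <= 2 * B / p 0 / s ^+ 2.
Proof.
rewrite /steinsol !normrM.
have s2 : 0 < s ^+ 2 by rewrite exprn_gt0.
have py := normal0_gt0 y; have p0 := normal0_gt0 0.
rewrite (gtr0_norm (x := (p y)^-1)) ?invr_gt0//.
rewrite (gtr0_norm (x := (s ^+ 2)^-1)) ?invr_gt0//.
apply: ler_wpM2r; first by rewrite invr_ge0 ltW.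
rewrite ler_pdivrMr//; apply: le_trans (H_bnd y) _; apply: eq_ler; ring.
Qed.

(** With [q = (psi - gmean) * p], the solution is [F y = (s ^+ 2 * p y)^-1 *]
    integral of [q] up to [y]. It is bounded because either tail of [p] beyond
    [y] has mass at most of order [p y]. *)
Lemma stein_equation : exists F : R -> R,
  (forall y, is_derive y (1 : R) F ((y * F y + psi y - gmean) / s ^+ 2)) /\
  (forall y, `|F y| <= 2 * B / p 0 / s ^+ 2).
Proof.
by exists steinsol; split; [exact: is_derive_steinsol|exact: steinsol_bnd].
Qed.

End SteinEquation.

(** * Integration of the last coordinate *)

Section RowVectors.
Context {R : realType}.

Definition snoc j (v : 'rV[R]_j) (t : R) : 'rV[R]_j.+1 :=
  \row_i oapp (v ord0) t (unlift ord_max i).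

Lemma snoc_max j (v : 'rV[R]_j) t : snoc v t ord0 ord_max = t.
Proof. by rewrite mxE unlift_none. Qed.

Lemma lift_max_widen j (i : 'I_j) : lift ord_max i = widen_ord (leqnSn j) i.
Proof. by apply/val_inj; rewrite /= /bump leqNgt ltn_ord. Qed.

Lemma snoc_widen j (v : 'rV[R]_j) t i :
  snoc v t ord0 (widen_ord (leqnSn j) i) = v ord0 i.
Proof. by rewrite -lift_max_widen mxE liftK. Qed.

Lemma cons0 j (t : R) (v : 'rV[R]_j) :
  (row_mx (t%:M : 'rV[R]_1) v : 'rV[R]_j.+1) ord0 ord0 = t.
Proof.
rewrite (_ : ord0 = lshift j (ord0 : 'I_1) :> 'I_j.+1); last exact/val_inj.
by apply: etrans (row_mxEl _ _ _ _) _; rewrite mxE.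
Qed.

Lemma cons_lift j (t : R) (v : 'rV[R]_j) (i : 'I_j) :
  (row_mx (t%:M : 'rV[R]_1) v : 'rV[R]_j.+1) ord0 (lift ord0 i) = v ord0 i.
Proof.
rewrite (_ : lift ord0 i = rshift 1 i :> 'I_j.+1); last exact/val_inj.
exact: row_mxEr.
Qed.

Lemma snoc_row_mx j (t u : R) (v : 'rV[R]_j) :
  snoc (row_mx (t%:M : 'rV[R]_1) v : 'rV[R]_j.+1) u =
  row_mx (t%:M : 'rV[R]_1) (snoc v u) :> 'rV[R]_j.+2.
Proof.
apply/rowP => i; case: (unliftP ord_max i) => [i' ->|->].
  rewrite lift_max_widen snoc_widen.
  case: (unliftP ord0 i') => [l ->|->].
    rewrite cons_lift (_ : widen_ord _ _ = lift ord0 (widen_ord (leqnSn j) l)).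
      by rewrite cons_lift snoc_widen.
    exact/val_inj.
  rewrite cons0 (_ : widen_ord _ _ = ord0); last exact/val_inj.
  by rewrite cons0.
rewrite snoc_max (_ : ord_max = lift ord0 (ord_max : 'I_j.+1)).
  by rewrite cons_lift snoc_max.
exact/val_inj.
Qed.

Lemma snoc0 (v : 'rV[R]_0) t : snoc v t = row_mx (t%:M : 'rV[R]_1) v.
Proof.
apply/rowP => i; case: (unliftP ord_max i) => [[]//|->].
rewrite snoc_max (_ : ord_max = ord0); last exact/val_inj.
by rewrite cons0.
Qed.

(** The outermost integral of [rV_integral] runs over the first coordinate;
    the innermost one, over the last coordinate, can be performed first. *)
Lemma rV_integral_snoc j (F : 'rV[R]_j.+1 -> \bar R) :
  rV_integral F = rV_integral (fun v : 'rV[R]_j =>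
    (\int[lebesgue_measure]_(t in setT) F (snoc v t))%E).
Proof.
elim: j F => [F|j IH F].
  by rewrite /=; apply: eq_integral => t _; rewrite snoc0.
transitivity (\int[lebesgue_measure]_(t in setT) rV_integral (fun v : 'rV[R]_j.+1 =>
    F (row_mx (t%:M : 'rV[R]_1) v)))%E; first by [].
apply: eq_integral => t _; rewrite IH; congr rV_integral; apply/funext => v.
by apply: eq_integral => u _; rewrite snoc_row_mx.
Qed.

Lemma cvg_rowP (T : Type) (F : set_system T) (FF : Filter F) j
    (f : T -> 'rV[R]_j) (l : 'rV[R]_j) :
  (forall i, f x ord0 i @[x --> F] --> l ord0 i) -> f @ F --> l.
Proof.
move=> H; apply/cvg_ballP => e e0.
have : \forall x \near F, forall i, ball (l ord0 i) e (f x ord0 i).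
  by apply: filter_forall => i; have /cvg_ballP := H i; apply.
by apply: filterS => x Hx; split => // a b; rewrite (ord1 a).
Qed.

Lemma cvg_fun_comp (T : Type) (F : set_system T) j (phi : 'rV[R]_j -> R)
    (f : T -> 'rV[R]_j) (l : 'rV[R]_j) :
  {for l, continuous phi} -> f @ F --> l -> phi (f x) @[x --> F] --> phi l.
Proof. by move=> cphi fl; exact: cvg_trans (cvg_app phi fl) cphi. Qed.

Lemma cvg_row_coord (T : Type) (F : set_system T) (FF : Filter F) j
    (f : T -> 'rV[R]_j) (l : 'rV[R]_j) i :
  f @ F --> l -> f x ord0 i @[x --> F] --> l ord0 i.
Proof.
move=> fl; apply: (cvg_fun_comp (phi := fun v : 'rV[R]_j => v ord0 i)) fl.
exact: coord_continuous.
Qed.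

Lemma cvg_snoc (T : Type) (F : set_system T) (FF : Filter F) j
    (f : T -> 'rV[R]_j) (l : 'rV[R]_j) (u : T -> R) (c : R) :
  f @ F --> l -> u @ F --> c -> snoc (f x) (u x) @[x --> F] --> snoc l c.
Proof.
move=> fl uc; apply: cvg_rowP => i; case: (unliftP ord_max i) => [i' ->|->].
  rewrite lift_max_widen snoc_widen; under eq_fun do rewrite snoc_widen.
  exact: cvg_row_coord.
by rewrite snoc_max; under eq_fun do rewrite snoc_max.
Qed.

Definition rsum j (v : 'rV[R]_j) : R := \sum_i v ord0 i.

Lemma cvg_rsum (T : Type) (F : set_system T) (FF : Filter F) j
    (f : T -> 'rV[R]_j) (l : 'rV[R]_j) :
  f @ F --> l -> rsum (f x) @[x --> F] --> rsum l.
Proof.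
move=> fl; apply: (cvg_big (U := R^o) (op := +%R)); first exact: add_continuous.
by move=> i _; exact: cvg_row_coord.
Qed.

(** Sequential continuity suffices, which makes dominated convergence available
    to prove the continuity of [condmean]. *)
Lemma seq_continuous j (f : 'rV[R]_j -> R) (p : 'rV[R]_j) :
  (forall u : nat -> 'rV[R]_j, u n @[n --> \oo] --> p ->
     f (u n) @[n --> \oo] --> f p) ->
  {for p, continuous f}.
Proof.
move=> H; apply/(@cvgrPdist_lt R R _ (nbhs p) (nbhs_filter p)) => e e0.
apply: contrapT => nH.
have K n : exists v, ball p (n.+1%:R^-1 : R) v /\ e <= `|f p - f v|.
  apply: contrapT => nK; apply: nH; apply/nbhs_ballP; exists n.+1%:R^-1 => /=.
    by rewrite invr_gt0.
  move=> v bv /=; rewrite ltNge; apply/negP => ev.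
  by apply: nK; exists v.
have [u Hu] := choice K.
have up : u n @[n --> \oo] --> p.
  apply/cvg_ballP => d d0.
  have := @cvg_harmonic R => /cvgrPdist_lt/(_ d d0); apply: filterS => n.
  rewrite sub0r normrN ger0_norm ?harmonic_ge0// => nd.
  have [bu _] := Hu n; apply: le_ball bu; exact: ltW.
have := H u up => /cvgrPdist_lt/(_ e e0) [n _ /(_ n (leqnn n))/=].
by have [_ ] := Hu n; rewrite leNgt => /negP.
Qed.

(** Only [z] is confined to the compact cube; [z'] is any point close to it. *)
Lemma unif_continuous_compact j (phi : 'rV[R]_j -> R) (K e : R) :
  continuous phi -> 0 < e -> exists2 d, 0 < d &
    forall z z' : 'rV[R]_j, (forall i, `|z ord0 i| <= K) ->
      (forall i, `|z ord0 i - z' ord0 i| <= d) -> `|phi z - phi z'| <= e.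
Proof.
move=> cphi e0.
pose A := [set v : 'rV[R]_j | forall i, `[- K, K]%classic (v ord0 i)].
have cA : compact A by apply: (@rV_compact R j (fun=> `[- K, K]%classic)) => i; exact: segment_compact.
have /compact_near_coveringP H := cA.
pose P (d : R) (z : 'rV[R]_j) := forall z' : 'rV[R]_j,
  (forall i, `|z ord0 i - z' ord0 i| <= d) -> `|phi z - phi z'| <= e.
have : \forall d \near 0^'+, A `<=` P d.
  apply: H => z Az.
  have := cphi z => /cvgrPdist_lt/(_ (e / 2) (divr_gt0 e0 (ltr0n _ 2))).
  move=> /nbhs_ballP [r /= r0 Hr].
  have r2 : 0 < r / 2 by rewrite divr_gt0.
  exists (ball z (r / 2), [set d | d < r / 2]) => /=.
    split; first exact: nbhsx_ballx.
    by apply: nbhs_right_lt.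
  move=> [w d] /= [[_ wz] dr] z' wz'.
  have h1 : `|phi z - phi w| < e / 2.
    apply: Hr; split => // a b; apply: le_ball (wz a b).
    by rewrite ler_pdivrMr// ler_peMr// ?ler1n// ltW.
  have h2 : `|phi z - phi z'| < e / 2.
    apply: Hr; split => // a b; rewrite [r](splitr).
    apply: (ball_triangle (wz a b)); rewrite /ball/= (ord1 a).
    exact: le_lt_trans dr.
  rewrite (_ : phi w - phi z' = (phi z - phi z') - (phi z - phi w)); last by ring.
  apply: le_trans (ler_normB _ _) _; rewrite (splitr e); apply: lerD; exact: ltW.
move=> /(@filterI _ _ _ _ _ (nbhs_right_gt (0 : R))) H2.
have [d [d0 Hd]] := filter_ex H2.
exists d => // z z' zK zz'; apply: Hd => // i.
by rewrite /= in_itv/= -ler_norml.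
Qed.

End RowVectors.

Section ConditionalMean.
Context {R : realType}.
Local Notation mu := (@lebesgue_measure R).

Lemma integral_translate (G : R -> R) (c : R) : continuous G ->
  (forall x, 0 <= G x) ->
  (\int[mu]_x (G x)%:E = \int[mu]_x (G (x + c))%:E)%E.
Proof.
move=> cG G0; pose F (x : R) := x + c.
have dF : (F^`())%classic = cst 1.
  apply/funext => x; rewrite /F derive1E deriveD// derive_id derive_cst addr0//.
rewrite (@increasing_ge0_integration_by_substitutionT R F G).
- by apply: eq_integral => x _; rewrite dF !fctE /= mulr1.
- by move=> x y xy; rewrite ltrD2r.
- by rewrite dF => x; exact: cvg_cst.
- by rewrite dF; exact: is_cvg_cst.
- by rewrite dF; exact: is_cvg_cst.
- by move=> x; apply: derivableD.
- exact: cvg_addrr_Ny.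
- exact: cvg_addrr.
- exact: cG.
- exact: G0.
Qed.

Variables (s rho : R).
Hypothesis s_gt0 : 0 < s.

(** The mean of [phi] when the last coordinate is Gaussian of variance
    [s ^+ 2] and of mean [- rho] times the sum of the previous ones. *)
Definition condmean j (phi : 'rV[R]_j.+1 -> R) (v : 'rV[R]_j) : R :=
  gmean s (fun t => phi (snoc v (t - rho * rsum v))).

Variables (j : nat) (phi : 'rV[R]_j.+1 -> R) (B : R).
Hypothesis phi_cont : continuous phi.
Hypothesis phi_bnd : forall z, `|phi z| <= B.

Lemma fiber_cont v c : continuous (fun t => phi (snoc v (t - c))).
Proof.
move=> t; apply: (cvg_fun_comp (phi := phi) (f := fun t => snoc v (t - c))).
  exact: phi_cont.
apply: cvg_snoc; first exact: cvg_cst.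
by apply: cvgB; [exact: cvg_id|exact: cvg_cst].
Qed.

Lemma condmean_bnd v : `|condmean phi v| <= B.
Proof. by apply: gmean_bnd => //; exact: fiber_cont. Qed.

Lemma condmean_cont : continuous (condmean phi).
Proof.
move=> v; apply: seq_continuous => u uv.
pose f n t := phi (snoc (u n) (t - rho * rsum (u n))) * normal_pdf 0 s t.
pose f0 t := phi (snoc v (t - rho * rsum v)) * normal_pdf 0 s t.
have mf n : measurable_fun setT (EFin \o f n).
  apply/measurable_EFinP/measurable_funM; last exact: measurable_normal_pdf.
  by apply: measurable_cont; exact: fiber_cont.
have mf0 : measurable_fun setT (EFin \o f0).
  apply/measurable_EFinP/measurable_funM; last exact: measurable_normal_pdf.
  by apply: measurable_cont; exact: fiber_cont.
have := @dominated_convergence _ _ _ mu setT measurableT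
  (fun n => EFin \o f n) (EFin \o f0) (EFin \o (fun t => B * normal_pdf 0 s t)) mf mf0.
case.
- apply: aeW => t _; apply: cvg_EFin; first exact: nearW.
  apply: cvgM; last exact: cvg_cst.
  apply: (cvg_fun_comp (phi := phi)
    (f := fun n => snoc (u n) (t - rho * rsum (u n)))); first exact: phi_cont.
  apply: cvg_snoc => //; apply: cvgB; first exact: cvg_cst.
  by apply: cvgM; [exact: cvg_cst|exact: cvg_rsum].
- exact: normal_integrableZ.
- apply: aeW => t n _ /=; rewrite lee_fin normrM.
  by rewrite (ger0_norm (normal_pdf_ge0 _ _ _)) ler_wpM2r ?normal_pdf_ge0.
- move=> i0 _ cv.
  have E0 : (\int[mu]_x (EFin \o f0) x = (condmean phi v)%:E)%E.
    rewrite /condmean /gmean /Rintegral fineK//.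
    exact: (integrable_fin_num measurableT i0).
  by rewrite E0 in cv; move/fine_cvgP : cv => [_]; exact.
Qed.

(** [condmean] is defined with a centred Gaussian; translating the variable of
    integration moves the mean into the density. *)
Lemma condmeanE v : (\int[mu]_t (phi (snoc v t)
    * normal_pdf (- (rho * rsum v)) s t)%:E)%E = (condmean phi v)%:E.
Proof.
set c := rho * rsum v.
have B0 : 0 <= B by apply: le_trans (phi_bnd (snoc v 0)).
have translate_pdf t : normal_pdf (- c) s (t - c) = normal_pdf 0 s t.
  by rewrite !normal_pdfE ?gt_eqF// /normal_fun opprK subrK subr0.
have cp m : continuous (normal_pdf m s).
  by apply: continuous_normal_pdf; rewrite gt_eqF.
have cs : continuous (fun t => phi (snoc v t)).
  have := @fiber_cont v 0; under eq_fun do rewrite subr0; exact.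
(* The change of variables is for nonnegative functions, hence [+ B]. *)
pose G t := (phi (snoc v t) + B) * normal_pdf (- c) s t.
have G0 t : 0 <= G t.
  rewrite mulr_ge0 ?normal_pdf_ge0// -lerBlDr sub0r.
  by have := phi_bnd (snoc v t); rewrite ler_norml => /andP[].
have cG : continuous G.
  move=> t; apply: cvgM; last exact: cp.
  by apply: cvgD; [exact: cs|exact: cvg_cst].
have iP : mu.-integrable setT (EFin \o
    (fun t => phi (snoc v t) * normal_pdf (- c) s t)).
  exact: (@bounded_integrable R s _ B).
have iP0 : mu.-integrable setT (EFin \o
    (fun t => phi (snoc v (t - c)) * normal_pdf 0 s t)).
  by apply: (@bounded_integrable R s _ B) => //; exact: fiber_cont.
have := integral_translate (- c) cG G0.
have -> : (\int[mu]_x (G x)%:E = \int[mu]_t (phi (snoc v t)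
    * normal_pdf (- c) s t)%:E + B%:E)%E.
  under eq_integral do rewrite /G mulrDl EFinD.
  rewrite integralD//; last exact: normal_integrableZ.
  congr (_ + _)%E; under eq_integral do rewrite EFinM.
  rewrite integralZl//; last exact: integrable_normal_pdf.
  by rewrite integral_normal_pdf mule1.
have -> : (\int[mu]_x (G (x + - c))%:E = \int[mu]_t (phi (snoc v (t - c))
    * normal_pdf 0 s t)%:E + B%:E)%E.
  under eq_integral do rewrite /G translate_pdf mulrDl EFinD.
  rewrite integralD//; last exact: normal_integrableZ.
  congr (_ + _)%E; under eq_integral do rewrite EFinM.
  rewrite integralZl//; last exact: integrable_normal_pdf.
  by rewrite integral_normal_pdf mule1.
have key (x y : \bar R) : x \is a fin_num -> y \is a fin_num ->
    (x + B%:E = y + B%:E)%E -> x = (fine y)%:E.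
  by case: x y => [x| |] [y| |] //= _ _ [] /addIr ->.
by apply: key; apply: (integrable_fin_num measurableT).
Qed.

End ConditionalMean.

(** * Replacing one coordinate by a Gaussian *)

(** The residue of the Stein equation when the derivative [F'] is replaced by a
    difference quotient of mesh [eta] and [s ^+ 2] by a rate [D]. As [psi] is
    only continuous, [F'] is only known to be continuous; its variation comes
    from that of [y * F y], which is locally Lipschitz, and from the modulus [om] of
    [psi]. *)
Lemma stein_quot (R : realType) (s A B C m : R) (F psi : R -> R) :
  0 < s -> 0 <= A -> 0 <= B -> 0 <= C ->
  (forall y : R, is_derive y (1 : R) F ((y * F y + psi y - m) / s ^+ 2)) ->
  (forall y, `|F y| <= A) -> (forall y, `|psi y| <= B) -> `|m| <= B ->
  let K := ((1 + C) * A + 2 * B) / s ^+ 2 in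
  forall eta y W D om : R, 0 < eta -> eta <= C -> 1 <= W -> `|y| <= W ->
  (forall c, `|y - c| <= eta -> `|psi y - psi c| <= om) ->
  `|psi y - m - (D * ((F y - F (y - eta)) / eta) - y * F y)| <=
  `|s ^+ 2 - D| * (K * W) + eta * (A + (1 + C) * K) * W ^+ 2 + om.
Proof.
move=> s0 A0 B0 C0 dF FA psiB mB K eta y W D om eta0 etaC W1 yW Hom.
have s2 : 0 < s ^+ 2 by rewrite exprn_gt0.
have K0 : 0 <= K by rewrite /K; nonneg.
pose F' c := (c * F c + psi c - m) / s ^+ 2.
have W0 : 0 <= W by apply: le_trans W1.
have CW : W + C <= (1 + C) * W by rewrite mulrDl mul1r lerD2l ler_peMr.
have F'b c : `|c| <= W + C -> `|F' c| <= K * W.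
  move=> cW; rewrite /F' /K normrM (gtr0_norm (x := (s ^+ 2)^-1)) ?invr_gt0//.
  rewrite [leRHS]mulrAC ler_wpM2r ?invr_ge0 ?(ltW s2)//.
  have h1 : `|c * F c| <= (W + C) * A by rewrite normrM ler_pM.
  have h2 := psiB c; rewrite -addrA.
  apply: le_trans (ler_normD _ _) _; apply: (@le_trans _ _ ((W + C) * A + 2 * B)).
    by apply: lerD => //; apply: le_trans (ler_normB _ _) _; lra.
  rewrite [leRHS]mulrDl; apply: lerD; first by rewrite mulrAC ler_wpM2r.
  by rewrite ler_peMr// mulr_ge0.
have near_y c : `|y - c| <= eta -> `|c| <= W + C.
  move=> yc; rewrite (_ : c = y - (y - c)); last by ring.
  by apply: le_trans (ler_normB _ _) _; apply: lerD => //; exact: le_trans etaC.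
have cF a b : {within `[a, b], continuous F}.
  apply: derivable_within_continuous => t _; exact: (@ex_derive _ _ _ _ _ _ _ (dF t)).
have mvt a b : a <= b -> exists2 c, a <= c <= b & F b - F a = F' c * (b - a).
  move=> ab; have [c cab e] := @MVT_segment R F F' a b ab (fun x _ => dF x) (cF a b).
  by exists c; [move: cab; rewrite in_itv|].
have [c1 /andP[c1a c1b] e1] : exists2 c, y - eta <= c <= y &
    F y - F (y - eta) = F' c * (y - (y - eta)).
  by apply: mvt; rewrite gerBl ltW.
have q1 : (F y - F (y - eta)) / eta = F' c1.
  by rewrite e1 opprB addrC subrK mulfK// gt_eqF.
have yc1 : `|y - c1| <= eta by rewrite ger0_norm ?subr_ge0// lerBlDl -lerBlDr.
have [c2 /andP[c2a c2b] e2] := mvt _ _ c1b.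
have yc2 : `|y - c2| <= eta.
  rewrite ger0_norm ?subr_ge0// lerBlDl -lerBlDr; exact: le_trans c2a.
rewrite q1.
have -> : psi y - m - (D * F' c1 - y * F y) = (s ^+ 2 - D) * F' c1 +
    ((y - c1) * F y + c1 * (F y - F c1)) + (psi y - psi c1).
  by rewrite /F'; field; rewrite gt_eqF.
apply: le_trans (ler_normD _ _) _; apply: lerD; last exact: Hom.
apply: le_trans (ler_normD _ _) _; apply: lerD.
  by rewrite normrM ler_wpM2l// F'b// near_y.
apply: le_trans (ler_normD _ _) _; rewrite [leRHS]mulrAC -[leRHS]mulrA.
rewrite [X in _ <= X](_ : _ = eta * (A * W ^+ 2) + eta * ((1 + C) * W * (K * W))); last first.
  by ring.
apply: lerD.
  rewrite normrM; apply: ler_pM => //.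
  apply: le_trans (FA y) _; rewrite ler_peMr// expr2 -[leLHS]mul1r ler_pM//.
rewrite e2 (normrM c1) (normrM (F' c2)).
rewrite [leLHS](_ : _ = `|y - c1| * (`|c1| * `|F' c2|)); last first.
  by move: (`|F' c2|) (`|c1|) (`|y - c1|) => ? ? ?; ring.
apply: ler_pM => //.
apply: ler_pM => //; last by rewrite F'b// near_y.
by apply: le_trans CW; exact: near_y.
Qed.

Section Prefixes.
Context {R : realType} (n : nat).
Implicit Types (z : 'I_n.+1 -> R) (j : nat).

Definition prefix_rv j z : 'rV[R]_j := \row_(i < j) z (inord i).

Lemma prefix_rvS j z : prefix_rv j.+1 z = snoc (prefix_rv j z) (z (inord j)).
Proof.
apply/rowP => i; case: (unliftP ord_max i) => [i' ->|->].
  by rewrite lift_max_widen snoc_widen !mxE.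
by rewrite snoc_max mxE.
Qed.

Lemma rsum_prefix j z : (j <= n.+1)%N ->
  rsum (prefix_rv j z) = \sum_(l < n.+1 | (l < j)%N) z l.
Proof.
move=> jn; rewrite /rsum; under eq_bigr do rewrite mxE.
rewrite (big_ord_widen n.+1 (fun i => z (inord i)) jn).
by apply: eq_bigr => i _; rewrite inord_val.
Qed.

Definition tailsum (g : 'I_n.+1 -> R) j : R := \sum_(l < n.+1 | (j <= l)%N) g l.

Lemma tailsumS g j : (j <= n)%N ->
  tailsum g j = g (inord j) + tailsum g j.+1.
Proof.
move=> jn; have jE : (inord j : 'I_n.+1) = j :> nat by rewrite inordK.
rewrite /tailsum (bigD1 (inord j)) ?jE//=; congr (_ + _); apply: eq_bigl => l.
by rewrite -val_eqE/= jE [RHS]ltn_neqAle eq_sym andbC.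
Qed.

Lemma sum_prefix_tail z j : (j <= n)%N ->
  \sum_l z l = rsum (prefix_rv j z) + (z (inord j) + tailsum z j.+1).
Proof.
move=> jn; rewrite rsum_prefix; last exact: leqW.
rewrite -tailsumS// (bigID (fun l : 'I_n.+1 => (l < j)%N))/=; congr (_ + _).
by apply: eq_bigl => l; rewrite -leqNgt.
Qed.

End Prefixes.

Section SteinStep.
Context {R : realType} (n : nat) (g : 'I_n.+1 -> R).
Hypothesis g_gt0 : forall i, 0 < g i.
Hypothesis sum_g : \sum_i g i = 1.
Variables (C s2 : R).
Hypotheses (C_ge0 : 0 <= C) (s2_gt0 : 0 < s2).
Implicit Types (i l : 'I_n.+1) (N : nat) (G h : R).
Let s2_ge0 : 0 <= s2. Proof. exact: ltW. Qed.

(** In the limit law, the conditional mean of coordinate [j] given the previous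
    ones is [- condrho j] times their sum, and its conditional variance is
    [condvar j]. *)
Definition condrho j : R := g (inord j) / tailsum g j.
Definition condvar j : R :=
  s2 * (g (inord j) * tailsum g j.+1) / tailsum g j.

Lemma tailsum_gt0 j : (j <= n)%N -> 0 < tailsum g j.
Proof.
move=> jn; rewrite /tailsum (bigD1 ord_max)//= ltr_wpDr// sumr_ge0// => l _.
exact: ltW.
Qed.

Lemma condvar_gt0 j : (j < n)%N -> 0 < condvar j.
Proof.
by move=> jn; rewrite divr_gt0 ?mulr_gt0 ?tailsum_gt0// ltnW.
Qed.

(** A common bound for all the fluctuations, of bounded second moment. *)
Definition maxfluct N h (k : {ffun 'I_n.+1 -> 'I_N.+1}) : R :=
  1 + \sum_i `|fluct g h i k|.

Lemma maxfluct_ge1 N h k : 1 <= @maxfluct N h k.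
Proof. by rewrite lerDl sumr_ge0. Qed.

Lemma fluct_le_max N h i k : `|fluct g h i k| <= @maxfluct N h k.
Proof. by rewrite /maxfluct (bigD1 i)//= ler_wpDl// lerDl sumr_ge0. Qed.

Lemma sqr_sum_le m (x : 'I_m -> R) :
  (\sum_i x i) ^+ 2 <= m%:R * \sum_i x i ^+ 2.
Proof.
have H : \sum_i \sum_j (x i * x j) <= \sum_i \sum_j ((x i ^+ 2 + x j ^+ 2) / 2).
  apply: ler_sum => i _; apply: ler_sum => j _.
  have := sqr_ge0 (x i - x j); rewrite sqrrB; lra.
apply: le_trans (le_trans _ H) _.
  by rewrite expr2 mulr_suml; apply: ler_sum => i _; rewrite mulr_sumr.
under eq_bigr do rewrite -mulr_suml big_split/= sumr_const card_ord.
rewrite -mulr_suml big_split/= sumrMnl sumr_const card_ord.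
move: (\sum_(i < m) _) => S; rewrite -(mulr_natl S m); lra.
Qed.

Lemma sqr_le_expR (x : R) : x ^+ 2 <= 2 * (expR x + expR (- x)).
Proof.
have key (y : R) : 0 <= y -> y ^+ 2 <= 2 * expR y.
  move=> y0; have := expR_ge1Dxn 1 y0; rewrite (_ : 2`! = 2)%N//; lra.
have e1 := expR_ge0 x; have e2 := expR_ge0 (- x).
have [x0|x0] := leP 0 x; first by have := key _ x0; lra.
have := key (- x); rewrite sqrrN oppr_ge0 => /(_ (ltW x0)); lra.
Qed.

Lemma maxfluct_sqr_bounded : exists K, forall N G h, scaling C s2 N G h ->
  @dmexp _ _ g N G (fun k => maxfluct h k ^+ 2) <= K.
Proof.
pose ei i (c : R) := fun j : 'I_n.+1 => if j == i then c else 0.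
have /(_ _)/cid K1 i := dmmgf_bounded g_gt0 sum_g s2 C_ge0 (ei i 1).
have /(_ _)/cid K2 i := dmmgf_bounded g_gt0 sum_g s2 C_ge0 (ei i (-1)).
exists (2 + 2 * (n.+1%:R * \sum_i 2 * (sval (K1 i) + sval (K2 i)))).
move=> N G h sc; have [N0 G0 h1 _ _] := sc.
apply: (@le_trans _ _ (@dmexp _ _ g N G (fun k => 2 + 2 * (n.+1%:R *
   \sum_i 2 * (expR (linfluct g h (ei i 1) k) +
               expR (linfluct g h (ei i (-1)) k)))))).
  apply: le_dmexp => // k _; rewrite /maxfluct.
  set S := \sum_i `|_|.
  apply: (@le_trans _ _ (2 + 2 * S ^+ 2)).
    by have := sqr_ge0 (S - 1); rewrite !sqrrD sqrrN; lra.
  rewrite lerD2l ler_wpM2l//; apply: le_trans (sqr_sum_le _) _.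
  rewrite ler_wpM2l//; apply: ler_sum => i _.
  by rewrite !linfluct_coord mul1r mulN1r real_normK ?num_real// sqr_le_expR.
rewrite dmexpD dmexp_cst// lerD2l !dmexpZ ler_wpM2l// ler_wpM2l//.
rewrite dmexp_sum; apply: ler_sum => i _; rewrite dmexpZ ler_wpM2l// dmexpD.
by apply: lerD; [exact: (svalP (K1 i))|exact: (svalP (K2 i))].
Qed.

Lemma fluct_transfer N h i i' l (k : {ffun 'I_n.+1 -> 'I_N.+1}) :
  (0 < N)%N -> i != l -> composition k -> (0 < k l)%N ->
  fluct g h i' (transfer i l k) =
  fluct g h i' k - Num.sqrt h / N%:R * ((i == i')%:R - (l == i')%:R).
Proof.
move=> N0 il ck kl.
have := linfluct_transfer g h N0 (fun j => if j == i' then 1 else 0) il ck kl.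
by rewrite !linfluct_coord !mul1r => ->; case: ifP; case: ifP.
Qed.

Section Step.
Variables (j : nat) (phi : 'rV[R]_j.+1 -> R) (B : R).
Hypothesis j_lt_n : (j < n)%N.
Hypothesis phi_cont : continuous phi.
Hypothesis phi_bnd : forall z, `|phi z| <= B.
Local Notation s := (Num.sqrt (condvar j)).
Local Notation rho := (condrho j).
Local Notation J := (inord j : 'I_n.+1).

Let JE : J = j :> nat. Proof. by rewrite inordK// ltnW. Qed.
Let s_gt0 : 0 < s. Proof. by rewrite sqrtr_gt0 condvar_gt0. Qed.
Let T_gt0 : 0 < tailsum g j. Proof. by rewrite tailsum_gt0// ltnW. Qed.
Let B_ge0 : 0 <= B. Proof. by apply: le_trans (phi_bnd 0). Qed.

Section Configurations.
Variables (N : nat) (G h : R).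
Hypothesis sc : scaling C s2 N G h.
Local Notation conf := {ffun 'I_n.+1 -> 'I_N.+1}.
Local Notation Z k := (fun i => fluct g h i k).
Local Notation eta := (Num.sqrt h / N%:R).
Implicit Types k : conf.

(** The fluctuation of coordinate [j] centred at its conditional mean. *)
Definition innovation k : R := fluct g h J k + rho * rsum (prefix_rv j (Z k)).

Definition steprate k : R :=
  (\sum_(l < n.+1 | (j < l)%N) jumprate g G h J l k) / tailsum g j.

(** The innovation is a combination of the left-hand sides of the discrete Stein
    identity for the moves between [j] and the later levels only, and these
    moves leave the earlier coordinates fixed. *)
Lemma innovationE k : composition k -> tailsum g j * innovation k =
  \sum_(l < n.+1 | (j < l)%N) (fluct g h J k * g l - fluct g h l k * g J).
Proof.
have [N0 G0 h1 _ _] := sc.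
move=> ck; have := sum_prefix_tail (Z k) (ltnW j_lt_n).
rewrite (sum_fluct sum_g h N0 ck) sumrB -mulr_sumr -mulr_suml.
rewrite -/(tailsum g j.+1) -/(tailsum (Z k) j.+1) => e.
have -> : tailsum (Z k) j.+1 = - rsum (prefix_rv j (Z k)) - fluct g h J k by lra.
rewrite /innovation /condrho; have := tailsumS g (ltnW j_lt_n) => e2.
have -> : tailsum g j.+1 = tailsum g j - g J by rewrite e2; ring.
by field; rewrite gt_eqF.
Qed.

Lemma innovation_le k : `|innovation k| <= maxfluct h k.
Proof.
rewrite /innovation /maxfluct; apply: le_trans (ler_normD _ _) _.
rewrite (normrM rho) (ger0_norm (x := rho)); last by rewrite /condrho; nonneg.
have r1 : rho <= 1.
  rewrite /condrho ler_pdivrMr// mul1r (tailsumS g (ltnW j_lt_n)) lerDl.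
  by rewrite ltW// tailsum_gt0.
apply: (@le_trans _ _ (`|fluct g h J k| + `|rsum (prefix_rv j (Z k))|)).
  by rewrite lerD2l ler_piMl.
rewrite rsum_prefix; last by rewrite leqW// ltnW.
rewrite [X in _ <= 1 + X](bigD1 J)//= ler_wpDl// lerD2l.
apply: le_trans (ler_norm_sum _ _ _) _.
rewrite [leRHS](bigID (fun l : 'I_n.+1 => (l < j)%N))/=.
rewrite ler_wpDr ?sumr_ge0//.
rewrite [leRHS](eq_bigl (fun l : 'I_n.+1 => (l < j)%N))// => l.
by rewrite andb_idl// -val_eqE/= JE => lj; rewrite neq_ltn lj.
Qed.

Lemma steprate_approx k : `|s ^+ 2 - steprate k| <=
  n.+1%:R * (2 * (s2 + C) + C) / tailsum g j / Num.sqrt h * maxfluct h k.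
Proof.
have [sh0 _ _ _ _] := scaling_sqrt C_ge0 sc.
have [N0 G0 h1 _ _] := sc.
rewrite sqr_sqrtr ?(ltW (condvar_gt0 _))// /condvar /steprate -mulrBl.
have -> : s2 * (g J * tailsum g j.+1) =
    \sum_(l < n.+1 | (j < l)%N) s2 * (g J * g l).
  by rewrite -mulr_sumr -mulr_sumr.
rewrite -sumrB normrM (gtr0_norm (x := (tailsum g j)^-1)) ?invr_gt0//.
rewrite [leRHS](_ : _ = n.+1%:R * ((2 * (s2 + C) + C) * maxfluct h k
   / Num.sqrt h) / tailsum g j); last by field; rewrite !gt_eqF.
rewrite ler_wpM2r ?invr_ge0 ?(ltW T_gt0)//.
apply: le_trans (ler_norm_sum _ _ _) _.
apply: (@le_trans _ _ (\sum_(l < n.+1) ((2 * (s2 + C) + C) * maxfluct h k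
   / Num.sqrt h))).
  rewrite [leRHS](bigID (fun l : 'I_n.+1 => (j < l)%N))/= ler_wpDr//.
    apply: sumr_ge0 => l _; rewrite divr_ge0 ?(ltW sh0)// mulr_ge0//.
      by rewrite addr_ge0 ?mulr_ge0 ?addr_ge0.
    by apply: le_trans (maxfluct_ge1 _ _).
  apply: ler_sum => l _; rewrite distrC.
  apply: le_trans (jumprate_lim g_gt0 sum_g C_ge0 J l k sc) _.
  have w1 := fluct_le_max h J k; have w2 := fluct_le_max h l k.
  have w3 := maxfluct_ge1 h k.
  rewrite mulrA -mulrDl ler_wpM2r ?invr_ge0 ?(ltW sh0)// [leRHS]mulrDl.
  apply: lerD; last by rewrite ler_peMr.
  rewrite (mulrC 2) -mulrA ler_wpM2l ?addr_ge0//; lra.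
by rewrite sumr_const card_ord [leRHS]mulr_natl.
Qed.

(** A one-dimensional Stein identity for the innovation, in which the earlier
    coordinates are frozen parameters. *)
Lemma innovation_stein (F : 'rV[R]_j -> R -> R) :
  @dmexp _ _ g N G (fun k => innovation k * F (prefix_rv j (Z k)) (innovation k)) =
  @dmexp _ _ g N G (fun k => steprate k *
    ((F (prefix_rv j (Z k)) (innovation k) -
      F (prefix_rv j (Z k)) (innovation k - eta)) / eta)).
Proof.
have [N0 G0 h1 _ _] := sc.
pose Fk k := F (prefix_rv j (Z k)) (innovation k).
apply: (mulfI (lt0r_neq0 T_gt0)); rewrite -!dmexpZ.
transitivity (\sum_(l < n.+1 | (j < l)%N) @dmexp _ _ g N G
    (fun k => (fluct g h J k * g l - fluct g h l k * g J) * Fk k)).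
  rewrite -dmexp_sum; apply: eq_dmexp => // k ck.
  by rewrite mulrA innovationE// mulr_suml.
transitivity (\sum_(l < n.+1 | (j < l)%N) @dmexp _ _ g N G
    (fun k => jumprate g G h J l k *
    ((F (prefix_rv j (Z k)) (innovation k) -
      F (prefix_rv j (Z k)) (innovation k - eta)) / eta))); last first.
  rewrite -dmexp_sum; apply: eq_dmexp => // k ck.
  by rewrite [RHS]mulrA -mulr_suml /steprate (mulrC (tailsum g j)) divfK// gt_eqF.
apply: eq_bigr => l jl.
have Jl : J != l by rewrite -val_eqE/= JE neq_ltn jl.
rewrite dm_stein//; apply: eq_dmexp => // k ck.
have [kl|kl] := posnP (k l); first by rewrite /jumprate kl !mul0r.
(* The move leaves the first [j] fluctuations fixed. *)
have pre_eq : prefix_rv j (Z (transfer J l k)) = prefix_rv j (Z k).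
  apply/rowP => i; rewrite !mxE (fluct_transfer h _ N0 Jl ck kl).
  have iE : (inord i : 'I_n.+1) = i :> nat.
    by rewrite inordK// (ltn_trans (ltn_ord i)) // ltnW.
  rewrite -!val_eqE/= JE iE [_ == _ :> nat](gtn_eqF (ltn_ord i)).
  by rewrite (gtn_eqF (ltn_trans (ltn_ord i) jl)) subrr mulr0 subr0.
have inn_eq : innovation (transfer J l k) = innovation k - eta.
  rewrite /innovation pre_eq (fluct_transfer h _ N0 Jl ck kl) eqxx.
  by rewrite eq_sym (negbTE Jl) subr0 mulr1; ring.
by rewrite /Fk pre_eq inn_eq.
Qed.

End Configurations.

(** The Stein equation is solved separately on each fiber over the earlier
    coordinates; this suffices because [innovation_stein] stays on the fiber. *)
Lemma stein_step (e : R) : 0 < e -> exists2 e0, 0 < e0 & forall N G h,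
  scaling C s2 N G h -> (Num.sqrt h)^-1 <= e0 ->
  `|@dmexp _ _ g N G (fun k => phi (prefix_rv j.+1 (fun i => fluct g h i k))) -
    @dmexp _ _ g N G (fun k =>
      condmean s rho phi (prefix_rv j (fun i => fluct g h i k)))| <= e.
Proof.
move=> e_gt0.
pose psi v t := phi (snoc v (t - rho * rsum v)).
have psi_cont v : continuous (psi v) by exact: fiber_cont.
have psi_bnd v t : `|psi v t| <= B by exact: phi_bnd.
have [F HF] := choice (fun v => stein_equation s_gt0 (psi_cont v) (psi_bnd v)).
pose A := 2 * B / normal_pdf 0 s 0 / s ^+ 2.
have A_ge0 : 0 <= A by rewrite !divr_ge0 ?mulr_ge0 ?normal_pdf_ge0 ?sqr_ge0.
have [KW HKW] := maxfluct_sqr_bounded.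
pose K := ((1 + C) * A + 2 * B) / s ^+ 2.
have K_ge0 : 0 <= K by rewrite /K; nonneg.
pose K5 := n.+1%:R * (2 * (s2 + C) + C) / tailsum g j.
have K5_ge0 : 0 <= K5 by rewrite /K5; nonneg.
pose K4 := K5 * K + C * (A + (1 + C) * K).
have K4_ge0 : 0 <= K4 by rewrite /K4; nonneg.
(* Beyond [Kc], the oscillation [2 * B] of [phi] is paid for by the second
   moment of [maxfluct]: [2 * B * KW / Kc ^+ 2 <= e / 4]. *)
pose Kc := 8 * B * `|KW| / e + 1.
have Kc1 : 1 <= Kc by rewrite /Kc lerDr; nonneg.
have [d d_gt0 Hd] := unif_continuous_compact Kc phi_cont (divr_gt0 e_gt0 (ltr0n R 2)).
(* Makes the terms of order [1 / sqrt h] at most [e / 4]. *)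
pose e1 := e / (4 * (K4 * `|KW| + 1)).
have q1 : 0 < K4 * `|KW| + 1 by rewrite ltr_wpDl// mulr_ge0.
have e1_gt0 : 0 < e1 by rewrite divr_gt0// mulr_gt0.
(* Keeps the mesh below the modulus of continuity [d]. *)
pose e2 := d / (C + 1).
have C1 : 0 < C + 1 by rewrite ltr_wpDl.
have e2_gt0 : 0 < e2 by rewrite divr_gt0.
exists (Num.min e1 e2); first by rewrite lt_min e1_gt0.
move=> N G h sc; rewrite le_min => /andP[he1 he2].
have [sh0 eta0 /andP[i0 i1] etaC _] := scaling_sqrt C_ge0 sc.
have [N0 G0 h1 etae _] := sc.
set E := @dmexp _ _ g N G.
pose v (k : {ffun 'I_n.+1 -> 'I_N.+1}) := prefix_rv j (fun i => fluct g h i k).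
pose y k := @innovation N h k.
pose q k := (F (v k) (y k) - F (v k) (y k - Num.sqrt h / N%:R)) / (Num.sqrt h / N%:R).
pose m k := condmean s rho phi (v k).
have psiE k : psi (v k) (y k) = phi (prefix_rv j.+1 (fun i => fluct g h i k)).
  by rewrite /psi /y /innovation addrK prefix_rvS.
have st : E (fun k => @steprate N G h k * q k - y k * F (v k) (y k)) = 0.
  by rewrite /E dmexpB (innovation_stein sc F) subrr.
(* Subtracting this zero turns the integrand into the residue bounded by
   [stein_quot]. *)
rewrite /E -dmexpB -[X in `|X|]subr0 -st /E -dmexpB -/E.
apply: le_trans (ler_norm_dmexp _ _ _) _ => //.
pose W k := @maxfluct N h k.
apply: (@le_trans _ _ (E (fun k =>
    ((Num.sqrt h)^-1 * K4 + 2 * B / Kc ^+ 2) * W k ^+ 2 + e / 2))).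
  apply: le_dmexp => // k ck; rewrite -psiE.
  have W1 : 1 <= W k by exact: maxfluct_ge1.
  have yW : `|y k| <= W k by exact: innovation_le.
  have [dF bF] := HF (v k).
  have mB : `|m k| <= B by exact: condmean_bnd.
  pose om := e / 2 + 2 * B / Kc ^+ 2 * W k ^+ 2.
  have Kc2 : 0 < Kc ^+ 2 by rewrite exprn_gt0// (lt_le_trans ltr01).
  have Hom c : `|y k - c| <= Num.sqrt h / N%:R -> `|psi (v k) (y k) - psi (v k) c| <= om.
    move=> yc; have [WK|WK] := leP (W k) Kc.
      rewrite ler_wpDr//.
        by nonneg.
      rewrite psiE; apply: Hd => i.
        by rewrite mxE; apply: le_trans (fluct_le_max _ _ _) WK.
      rewrite prefix_rvS; case: (unliftP ord_max i) => [i' ->|->].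
        by rewrite lift_max_widen !snoc_widen subrr normr0 ltW.
      rewrite !snoc_max.
      rewrite [X in `|X|](_ : _ = y k - c); last first.
        by rewrite /y /innovation; ring.
      apply: le_trans yc (le_trans etae _).
      apply: (@le_trans _ _ ((C + 1) * e2)).
        by apply: ler_pM => //; rewrite lerDl.
      by rewrite mulrC divfK// gt_eqF.
    rewrite ler_wpDl ?divr_ge0 ?(ltW e_gt0)//.
    apply: (@le_trans _ _ (2 * B)).
      apply: le_trans (ler_normB _ _) _.
      by rewrite mulr_natl mulr2n; apply: lerD; exact: psi_bnd.
    rewrite -mulrA ler_peMr ?mulr_ge0// mulrC ler_pdivlMr// mul1r.
    by rewrite ler_pXn2r ?nnegrE ?(ltW WK)// (le_trans ler01)// (le_trans Kc1)// ltW.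
  have := @stein_quot R s A B C (m k) (F (v k)) (psi (v k)) s_gt0 A_ge0 B_ge0 C_ge0
    dF bF (psi_bnd (v k)) mB (Num.sqrt h / N%:R) (y k) (W k)
    (@steprate N G h k) om eta0 etaC W1 yW Hom.
  rewrite -/K -/(q k) => /le_trans; apply.
  have sr := steprate_approx sc k; rewrite -/(W k) -/K5 in sr.
  have W0 : 0 <= W k by apply: le_trans W1.
  have h2 : `|s ^+ 2 - steprate G h k| * (K * W k) <=
      K5 / Num.sqrt h * W k * (K * W k).
    exact: (ler_wpM2r (mulr_ge0 K_ge0 W0) sr).
  have h3 : Num.sqrt h / N%:R * (A + (1 + C) * K) * W k ^+ 2 <=
      C / Num.sqrt h * (A + (1 + C) * K) * W k ^+ 2.
    by apply: ler_wpM2r; [exact: sqr_ge0|apply: ler_wpM2r => //; nonneg].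
  rewrite /om; apply: le_trans (lerD (lerD h2 h3) (lexx _)) _.
  by apply: eq_ler; rewrite /K4; field; rewrite !gt_eqF// (lt_le_trans ltr01).
rewrite /E dmexpD dmexp_cst// (dmexpZ _ _ _ (fun k => W k ^+ 2)) -/E.
have EW : E (fun k => W k ^+ 2) <= `|KW|.
  by apply: le_trans (HKW N G h sc) (ler_norm _).
have Kcp : 0 < Kc by rewrite (lt_le_trans ltr01).
have c0 : 0 <= (Num.sqrt h)^-1 * K4 + 2 * B / Kc ^+ 2.
  by nonneg.
apply: le_trans (lerD (ler_wpM2l c0 EW) (lexx _)) _.
rewrite mulrDl.
have t1 : (Num.sqrt h)^-1 * K4 * `|KW| <= e / 4.
  apply: (@le_trans _ _ (e1 * (K4 * `|KW| + 1))).
    rewrite -mulrA ler_pM ?mulr_ge0 ?(ltW i0)//.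
    by rewrite lerDl.
  by apply: eq_ler; rewrite /e1; field; rewrite gt_eqF.
have t2 : 2 * B / Kc ^+ 2 * `|KW| <= e / 4.
  rewrite mulrAC ler_pdivrMr ?exprn_gt0//.
  apply: (@le_trans _ _ (e / 4 * Kc)).
    by rewrite /Kc mulrDr mulr1 ler_wpDr ?divr_ge0 ?(ltW e_gt0)//;
      apply: eq_ler; field; rewrite gt_eqF.
  by rewrite ler_wpM2l ?divr_ge0 ?(ltW e_gt0)// expr2 ler_peMr// ltW.
lra.
Qed.

End Step.
End SteinStep.

(** * Joint limit and conditioning on the energy *)

Section JointLimit.
Context {R : realType} (n : nat) (g : 'I_n.+1 -> R).
Hypothesis g_gt0 : forall i, 0 < g i.
Hypothesis sum_g : \sum_i g i = 1.
Variables (C s2 : R).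
Hypotheses (C_ge0 : 0 <= C) (s2_gt0 : 0 < s2).
Local Notation sd j := (Num.sqrt (condvar g s2 j)).

(** The Gaussian density in the form given by successive conditioning. *)
Definition jointpdf j (v : 'rV[R]_j) : R :=
  \prod_(i < j) normal_pdf (- (condrho g i * \sum_(l < j | (l < i)%N) v ord0 l))
                           (sd i) (v ord0 i).

Lemma jointpdf_snoc j (v : 'rV[R]_j) (t : R) : jointpdf (snoc v t) =
  jointpdf v * normal_pdf (- (condrho g j * rsum v)) (sd j) t.
Proof.
have prefix_sum m : (m <= j)%N ->
    \sum_(l < j.+1 | (l < m)%N) snoc v t ord0 l = \sum_(l < j | (l < m)%N) v ord0 l.
  move=> mj; rewrite big_mkcond big_ord_recr/= ltnNge mj/= addr0 [RHS]big_mkcond.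
  by apply: eq_bigr => l _; rewrite snoc_widen.
rewrite /jointpdf big_ord_recr/=; congr (_ * _).
  by apply: eq_bigr => i _; rewrite snoc_widen prefix_sum// ltnW.
have -> : rsum v = \sum_(l < j | (l < j)%N) v ord0 l.
  by apply: eq_bigl => l; rewrite ltn_ord.
by rewrite snoc_max prefix_sum.
Qed.

Lemma rV_integral_condmean j (phi : 'rV[R]_j.+1 -> R) B : (j < n)%N ->
  continuous phi -> (forall z, `|phi z| <= B) ->
  rV_integral (fun z => (phi z * jointpdf z)%:E) =
  rV_integral (fun v => (condmean (sd j) (condrho g j) phi v * jointpdf v)%:E).
Proof.
move=> jn cphi bphi; rewrite rV_integral_snoc; congr rV_integral.
apply/funext => v.
have s0 : 0 < sd j by rewrite sqrtr_gt0 condvar_gt0.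
rewrite EFinM -(condmeanE (condrho g j) s0 cphi bphi v) muleC.
rewrite -integralZl//.
  by apply: eq_integral => t _; rewrite jointpdf_snoc -EFinM mulrCA mulrA.
apply: (@bounded_integrable R (sd j) _ B) => //.
by have := @fiber_cont R j phi cphi v 0; under eq_fun do rewrite subr0; exact.
Qed.

(** Integrating out the last coordinate changes the expectations by a
    vanishing amount, and the iterated Gaussian integral not at all. *)
Lemma dm_weak_limit (G h : nat -> R) :
  (\forall N \near \oo, scaling C s2 N (G N) (h N)) ->
  (Num.sqrt (h N))^-1 @[N --> \oo] --> 0 ->
  forall j (phi : 'rV[R]_j -> R) B, (j <= n)%N -> continuous phi ->
  (forall z, `|phi z| <= B) ->
  exists2 l : R, rV_integral (fun z => (phi z * jointpdf z)%:E) = l%:E &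
    @dmexp _ _ g N (G N)
      (fun k => phi (prefix_rv j (fun i => fluct g (h N) i k))) @[N --> \oo] --> l.
Proof.
move=> nsc h0; elim=> [|j IH] phi B jn cphi bphi.
  exists (phi 0); first by rewrite /= /jointpdf big_ord0 mulr1.
  apply/cvgrPdist_le => e e0; near=> N.
  have [N0 G0 _ _ _] : scaling C s2 N (G N) (h N) by near: N.
  rewrite (_ : dmexp _ _ _ = phi 0) ?subrr ?normr0 ?ltW//.
  rewrite -[RHS](@dmexp_cst _ _ _ g_gt0 N (G N) G0); apply: eq_dmexp => // k _.
  by congr phi; apply/rowP => -[].
have [l lE Hl] := IH _ B (ltnW jn) (condmean_cont (s := sd j) (rho := condrho g j) cphi bphi)
   (condmean_bnd (sd j) (condrho g j) cphi bphi).
exists l; first by rewrite (rV_integral_condmean jn cphi bphi).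
apply/cvgrPdist_le => e e0.
have [d d0 Hd] := stein_step g_gt0 sum_g C_ge0 s2_gt0 jn cphi bphi (divr_gt0 e0 (ltr0n R 2)).
near=> N.
have sc : scaling C s2 N (G N) (h N) by near: N.
have hd : (Num.sqrt (h N))^-1 <= d.
  near: N; move/cvgrPdist_le : h0 => /(_ d d0); apply: filterS => N.
  by rewrite sub0r normrN; apply: le_trans; exact: ler_norm.
have H1 := Hd N _ _ sc hd.
have H2 : `|l - @dmexp _ _ g N (G N) (fun k => condmean (sd j) (condrho g j) phi
    (prefix_rv j (fun i => fluct g (h N) i k)))| <= e / 2.
  by near: N; move/cvgrPdist_le : Hl; apply; rewrite divr_gt0.
rewrite distrC in H1; rewrite (splitr e).
apply: le_trans (lerD H2 H1); apply: le_trans (ler_normD _ _); apply: eq_ler.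
by congr `|_|; ring.
Unshelve. all: by end_near. Qed.

End JointLimit.

Section EnergyConstraint.
Context {R : realType} (n : nat) (g energy : 'I_n.+1 -> R) (E0 : R).
Hypothesis g_gt0 : forall i, 0 < g i.
Hypothesis sum_g : \sum_i g i = 1.
Hypothesis meanE : \sum_i energy i * g i < E0.
Variables (C s2 : R).
Hypotheses (C_ge0 : 0 <= C) (s2_ge0 : 0 <= s2).
Implicit Types (u : 'I_n.+1 -> R) (N : nat) (G h : R).
Local Notation L := (linfluct g).

Definition admissible N (k : {ffun 'I_n.+1 -> 'I_N.+1}) : bool :=
  \sum_i energy i * ((k i)%:R / N%:R) <= E0.

Definition dmcond N G (F : {ffun 'I_n.+1 -> 'I_N.+1} -> R) : R :=
  @dmexp _ _ g N G (fun k => F k * (admissible k)%:R) /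
  @dmexp _ _ g N G (fun k => (admissible k)%:R).

(** Exceeding the energy bound is a deviation of order [sqrt h] of a linear
    function of the fluctuations, hence exponentially unlikely. *)
Lemma excess_energy u : exists2 K, 0 <= K & forall N G h, scaling C s2 N G h ->
  @dmexp _ _ g N G (fun k => expR (L h u k) * (~~ admissible k)%:R)
  <= K / Num.sqrt h.
Proof.
have [K HK] := dmmgf_bounded g_gt0 sum_g s2 C_ge0 (fun i => u i + - energy i).
pose c := E0 - \sum_i energy i * g i.
have c0 : 0 < c by rewrite subr_gt0.
exists (`|K| / c) => [|N G h sc]; first by nonneg.
have [N0 G0 h1 _ _] := sc; have [s0 _ _ _ _] := scaling_sqrt C_ge0 sc.
apply: (@le_trans _ _ (@dmexp _ _ g N G (fun k => expR (- (c * Num.sqrt h)) *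
   expR (L h (fun i => u i + - energy i) k)))).
  apply: le_dmexp => // k ck; case: (boolP (admissible k)) => [_|].
    by rewrite mulr0 mulr_ge0 ?expR_ge0.
  rewrite -ltNge => kE; rewrite mulr1 linfluctD mulrC expRD -mulrA ler_peMr ?expR_ge0//.
  rewrite -expRD -[leLHS]expR0 ler_expR.
  have -> : L h (fun i => - energy i) k =
      Num.sqrt h * (\sum_i energy i * ((k i)%:R / N%:R) - \sum_i energy i * g i).
    rewrite -sumrB mulr_sumr; apply: eq_bigr => i _; rewrite /fluct; ring.
  rewrite (mulrC c) -mulrBr; apply: mulr_ge0; [exact: ltW|rewrite /c; lra].
rewrite dmexpZ expRN mulrC ler_pdivrMr ?expR_gt0//.
apply: le_trans (HK N G h sc) (le_trans (ler_norm _) _).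
rewrite [leRHS](_ : _ = `|K| * (expR (c * Num.sqrt h) / (c * Num.sqrt h))).
  rewrite ler_peMr// ler_pdivlMr ?mulr_gt0// mul1r.
  by apply: le_trans (expR_ge1Dx _); rewrite lerDr.
by field; rewrite !gt_eqF.
Qed.

Lemma dmexp_split N G (F : {ffun 'I_n.+1 -> 'I_N.+1} -> R) :
  @dmexp _ _ g N G (fun k => F k * (admissible k)%:R) =
  @dmexp _ _ g N G F - @dmexp _ _ g N G (fun k => F k * (~~ admissible k)%:R).
Proof.
rewrite -dmexpB; congr dmexp; apply/funext => k.
by case: admissible; rewrite /= !(mulr1, mulr0, subr0, subrr).
Qed.

Lemma admissible_prob : exists2 K, 0 <= K & forall N G h, scaling C s2 N G h ->
  0 <= 1 - @dmexp _ _ g N G (fun k => (admissible k)%:R) <= K / Num.sqrt h.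
Proof.
have [K K0 HK] := excess_energy (fun=> 0); exists K => // N G h sc.
have [N0 G0 h1 _ _] := sc; have := HK N G h sc.
have L0 k : L h (fun=> 0) k = 0 :> R by rewrite /linfluct big1// => i _; rewrite mul0r.
under [X in @dmexp _ _ _ _ _ X]eq_fun do rewrite L0 expR0.
have -> : @dmexp _ _ g N G (fun k => (admissible k)%:R) =
    1 - @dmexp _ _ g N G (fun k => 1 * (~~ admissible k)%:R).
  have := @dmexp_split N G (fun=> 1); rewrite dmexp_cst// => <-.
  by congr dmexp; apply/funext => k; rewrite mul1r.
by rewrite subKr => ->; rewrite andbT; apply: dmexp_ge0 => // k; rewrite mul1r.
Qed.

(** Conditioning removes [excess_energy] from the numerator and
    [admissible_prob] from the denominator, both [O (1 / sqrt h)]. *)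
Lemma dmcond_mgf u : exists K e0, [/\ 0 <= K, 0 < e0 & forall N G h,
  scaling C s2 N G h -> (Num.sqrt h)^-1 <= e0 ->
  `|@dmcond N G (fun k => expR (L h u k)) / expR (limvar g s2 u / 2) - 1|
   <= K / Num.sqrt h].
Proof.
have [K1 K10 H1] := excess_energy u.
have [K2 K20 H2] := admissible_prob.
have [K3 K30 H3] := dmmgf_approx g_gt0 sum_g C_ge0 s2_ge0 u.
set V := expR (limvar g s2 u / 2) in H3 *; have V0 : 0 < V by exact: expR_gt0.
exists (2 * (K3 + K1 / V + K2)), (2 * K2 + 1)^-1; split.
- by rewrite ?mulr_ge0 ?addr_ge0 ?divr_ge0// ltW.
- by rewrite invr_gt0 ltr_wpDl// mulr_ge0.
move=> N G h sc he; have [N0 G0 h1 _ _] := sc.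
have [s0 _ _ _ _] := scaling_sqrt C_ge0 sc.
have {}H1 := H1 N G h sc; have {H2}/andP[b0 bK] := H2 N G h sc.
have {}H3 := H3 N G h sc.
rewrite /dmcond dmexp_split.
set a1 := @dmexp _ _ _ _ _ _ in H3 *.
set a2 := @dmexp _ _ _ _ _ _ in H1 *.
set p := @dmexp _ _ _ _ _ _ in b0 bK *.
have a20 : 0 <= a2.
  by apply: dmexp_ge0 => // k; rewrite mulr_ge0 ?expR_ge0.
have bh : 1 - p <= 1 / 2.
  apply: le_trans bK _; apply: (@le_trans _ _ (K2 * (2 * K2 + 1)^-1)).
    by rewrite ler_wpM2l.
  rewrite ler_pdivrMr ?ltr_wpDl ?mulr_ge0//; lra.
have p0 : 1 / 2 <= p by lra.
have pp : 0 < p by lra.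
have -> : (a1 - a2) / p / V - 1 = ((a1 / V - 1) - a2 / V + (1 - p)) / p.
  by field; rewrite !gt_eqF.
rewrite normrM (gtr0_norm (x := p^-1)) ?invr_gt0// ler_pdivrMr//.
apply: (@le_trans _ _ ((K3 + K1 / V + K2) / Num.sqrt h)).
  rewrite !mulrDl; apply: le_trans (ler_normD _ _) _; apply: lerD; last first.
    by rewrite ger0_norm.
  apply: le_trans (ler_normB _ _) _; apply: lerD => //.
  rewrite (ger0_norm (divr_ge0 a20 (ltW V0))) [leRHS]mulrAC; apply: ler_wpM2r => //.
  by rewrite invr_ge0 ltW.
set X := K3 + K1 / V + K2.
have X0 : 0 <= X / Num.sqrt h by rewrite /X; nonneg.
rewrite [leRHS](_ : _ = 2 * p * (X / Num.sqrt h)); last by ring.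
by move: X0; move: (X / Num.sqrt h) => x x0; rewrite ler_peMl//; lra.
Qed.

Lemma dmcond_bounded B : 0 <= B -> exists K e0, [/\ 0 <= K, 0 < e0 & forall N G h,
  scaling C s2 N G h -> (Num.sqrt h)^-1 <= e0 ->
  forall F : {ffun 'I_n.+1 -> 'I_N.+1} -> R, (forall k, `|F k| <= B) ->
  `|dmcond G F - @dmexp _ _ g N G F| <= K / Num.sqrt h].
Proof.
move=> B0; have [K2 K20 H2] := admissible_prob.
exists (4 * B * K2), (2 * K2 + 1)^-1; split.
- by nonneg.
- by rewrite invr_gt0 ltr_wpDl// mulr_ge0.
move=> N G h sc he F FB; have [N0 G0 h1 _ _] := sc.
have [s0 _ _ _ _] := scaling_sqrt C_ge0 sc.
have /andP[b0 bK] := H2 N G h sc.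
have EF : `|@dmexp _ _ g N G F| <= B.
  apply: le_trans (ler_norm_dmexp _ _ _) _ => //.
  by rewrite -[leRHS](@dmexp_cst _ _ _ g_gt0 N G G0); apply: le_dmexp.
have p1 : 1 - @dmexp _ _ g N G (fun k => (admissible k)%:R) =
    @dmexp _ _ g N G (fun k => (~~ admissible k)%:R).
  rewrite -[X in X - _](@dmexp_cst _ _ _ g_gt0 N G G0) -dmexpB.
  congr dmexp; apply/funext => k.
  by case: admissible; rewrite /= ?subrr ?subr0.
have Eb : `|@dmexp _ _ g N G (fun k => F k * (~~ admissible k)%:R)| <=
    B * (1 - @dmexp _ _ g N G (fun k => (admissible k)%:R)).
  apply: le_trans (ler_norm_dmexp _ _ _) _ => //.
  rewrite p1 -dmexpZ; apply: le_dmexp => // k _.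
  by rewrite normrM (ger0_norm (ler0n _ _)) ler_wpM2r.
rewrite /dmcond dmexp_split.
set a1 := @dmexp _ _ _ _ _ _ in EF *.
set a2 := @dmexp _ _ _ _ _ _ in Eb *.
set p := @dmexp _ _ _ _ _ _ in b0 bK Eb *.
have bh : 1 - p <= 1 / 2.
  apply: le_trans bK _; apply: (@le_trans _ _ (K2 * (2 * K2 + 1)^-1)).
    by rewrite ler_wpM2l.
  rewrite ler_pdivrMr ?ltr_wpDl ?mulr_ge0//; lra.
have p0 : 1 / 2 <= p by lra.
have pp : 0 < p by lra.
have -> : (a1 - a2) / p - a1 = ((1 - p) * a1 - a2) / p.
  by field; rewrite !gt_eqF.
rewrite normrM (gtr0_norm (x := p^-1)) ?invr_gt0// ler_pdivrMr//.
apply: (@le_trans _ _ (2 * B * (1 - p))).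
  apply: le_trans (ler_normB _ _) _; rewrite normrM (ger0_norm b0).
  have := ler_wpM2l b0 EF; lra.
apply: (@le_trans _ _ (2 * B * (K2 / Num.sqrt h))); first by rewrite ler_wpM2l ?mulr_ge0.
have Bx0 : 0 <= B * (K2 / Num.sqrt h) by nonneg.
rewrite [leRHS](_ : _ = 4 * p * (B * (K2 / Num.sqrt h))); last by ring.
move: Bx0; move: (K2 / Num.sqrt h) => x Bx; rewrite -mulrA ler_wpM2r//; lra.
Qed.

End EnergyConstraint.

(** * The limit covariance *)

Section Covariance.
Context {R : realType} (n : nat) (g : 'I_n.+1 -> R).
Hypothesis g_gt0 : forall i, 0 < g i.
Hypothesis sum_g : \sum_i g i = 1.
Variable s2 : R.
Hypothesis s2_gt0 : 0 < s2.
Local Notation gi i := (g (inord i)).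
Local Notation glast := (g ord_max).

(** The multinomial covariance of the first [n] coordinates, times [s2]. *)
Definition covmx : 'M[R]_n :=
  \matrix_(i, j) (s2 * ((i == j)%:R * gi i - gi i * gi j)).

Definition precmx : 'M[R]_n :=
  \matrix_(i, j) (s2^-1 * ((i == j)%:R / gi i + glast^-1)).

Lemma sum_ord_max (u : 'I_n.+1 -> R) :
  \sum_l u l = \sum_(i < n) u (inord i) + u ord_max.
Proof.
rewrite big_ord_recr/=; congr (_ + _); apply: eq_bigr => i _; congr u.
by apply/val_inj; rewrite /= inordK// ltnW// ltnS.
Qed.

Lemma precmx_covmx : precmx *m covmx = 1%:M.
Proof.
have gs : \sum_(i < n) gi i = 1 - glast by rewrite -sum_g (sum_ord_max g) addrK.
have gl0 : glast != 0 by rewrite gt_eqF.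
have s20 : s2 != 0 by rewrite gt_eqF.
apply/matrixP => i k; rewrite !mxE.
transitivity (\sum_(j < n) ((i == j)%:R * ((j == k)%:R - gi k) +
   glast^-1 * ((j == k)%:R * gi j - gi k * gi j))).
  apply: eq_bigr => j _; rewrite !mxE; have gj0 : gi j != 0 by rewrite gt_eqF.
  have [->|ij] := eqVneq i j; first by field; rewrite s20 gl0 gj0.
  by rewrite (_ : false%:R = 0)//; field; rewrite !gt_eqF.
rewrite big_split/= -mulr_sumr sumrB -mulr_sumr gs.
rewrite (bigD1 i)//= eqxx mul1r big1 ?addr0; last first.
  by move=> j /negbTE ji; rewrite eq_sym ji mul0r.
rewrite (bigD1 k)//= eqxx mul1r big1 ?addr0; last first.
  by move=> j /negbTE ->; rewrite mul0r.
by field.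
Qed.

Lemma precmx_unit : precmx \in unitmx.
Proof. by have [] := mulmx1_unit precmx_covmx. Qed.

Lemma invmx_precmx : invmx precmx = covmx.
Proof.
by rewrite -[LHS]mulmx1 -precmx_covmx mulmxA mulVmx ?precmx_unit// mul1mx.
Qed.

Lemma invmx_covmx : invmx covmx = precmx.
Proof. by rewrite -invmx_precmx invmxK. Qed.

Lemma quad_formE (A : 'M[R]_n) (z : 'rV[R]_n) :
  quad_form A z = \sum_i \sum_j z ord0 i * A i j * z ord0 j.
Proof.
rewrite /quad_form mxE exchange_big/=; apply: eq_bigr => j _.
by rewrite !mxE mulr_suml.
Qed.

Definition extend0 (xi : 'rV[R]_n) (l : 'I_n.+1) : R :=
  oapp (xi ord0) 0 (unlift ord_max l).

Lemma inord_lift (i : 'I_n) : (inord i : 'I_n.+1) = lift ord_max i.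
Proof.
by apply/val_inj; rewrite lift_max_widen /= inordK// ltnW// ltnS.
Qed.

Lemma extend0_inord xi (i : 'I_n) : extend0 xi (inord i) = xi ord0 i.
Proof. by rewrite inord_lift /extend0 liftK. Qed.

Lemma extend0_max xi : extend0 xi ord_max = 0.
Proof. by rewrite /extend0 unlift_none. Qed.

Lemma limvar_sqr u : limvar g s2 u =
  s2 * (\sum_l g l * u l ^+ 2 - (\sum_l g l * u l) ^+ 2).
Proof.
rewrite /limvar; congr (_ * _).
transitivity (\sum_i (g i * u i ^+ 2 - (g i * u i) * \sum_j g j * u j)).
  apply: eq_bigr => i _; rewrite mulr_sumr -[X in X - _]mulr1 -sum_g mulr_sumr.
  by rewrite -sumrB; apply: eq_bigr => j _; ring.
by rewrite sumrB -mulr_suml expr2.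
Qed.

Lemma quad_form_covmx xi : quad_form covmx xi = limvar g s2 (extend0 xi).
Proof.
rewrite limvar_sqr !sum_ord_max !extend0_max expr0n !mulr0 !addr0 quad_formE.
rewrite expr2 mulr_suml -sumrB mulr_sumr; apply: eq_bigr => i _.
rewrite extend0_inord.
rewrite (bigD1 i)//= mxE eqxx.
rewrite (eq_bigr (fun j : 'I_n => - (s2 * (gi i * xi ord0 i)) * (gi j * xi ord0 j))); last first.
  move=> j /negbTE ji; have -> : covmx i j = - (s2 * (gi i * gi j)).
    by rewrite mxE eq_sym ji (_ : false%:R = 0)//; ring.
  ring.
rewrite -mulr_sumr [in RHS](bigD1 i)//= extend0_inord (_ : true%:R = 1)//.
rewrite [in RHS](eq_bigr (fun j : 'I_n => gi j * xi ord0 j)); last first.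
  by move=> j _; rewrite extend0_inord.
move: (\sum_(_ < n | _) _) => S; ring.
Qed.

Local Notation tail := (tailsum g).
Local Notation rho := (condrho g).
Local Notation cv := (condvar g s2).

(** Completing the square one coordinate at a time. By induction on [m]: the
    conditional variances are such that the cross terms telescope. *)
Lemma square_telescope (z w : nat -> R) m : (m <= n)%N ->
  \sum_(j < m) (z j + rho j * \sum_(i < j) z i) * (w j + rho j * \sum_(i < j) w i)
     / cv j =
  s2^-1 * (\sum_(j < m) z j * w j / gi j
           + (\sum_(i < m) z i) * (\sum_(i < m) w i) / tail m).
Proof.
elim: m => [_|m IH mn]; first by rewrite !big_ord0 mul0r mul0r addr0 mulr0.
rewrite !big_ord_recr/= IH ?(ltnW mn)// /condvar /condrho.
have t1 := tailsum_gt0 g_gt0 (ltnW mn); have t2 := tailsum_gt0 g_gt0 mn.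
have e := tailsumS g (ltnW mn).
have gm := g_gt0 (inord m).
move: (\sum_(j < m) _ / _) (\sum_(i < m) z i) (\sum_(i < m) w i) => Q S S'.
move: t1 e; move: (tail m) (tail m.+1) t2 => t t' t2 t1 e; subst t.
by field; rewrite !gt_eqF.
Qed.

Lemma tailsum_max : tail n = glast.
Proof.
rewrite /tailsum (big_pred1 ord_max)// => l /=; rewrite -val_eqE/= eqn_leq.
by rewrite (leq_ord l).
Qed.

(** The successive conditionings, read on the precision matrix: a unitriangular
    factorization, so that the determinant of [covmx] is the product of the
    conditional variances. *)
Lemma precmx_LDL : precmx =
  (\matrix_(i < n, j < n) ((i == j)%:R + rho j * (i < j)%:R)) *m
  diag_mx (\row_j (cv j)^-1) *m
  (\matrix_(i < n, j < n) ((i == j)%:R + rho j * (i < j)%:R))^T.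
Proof.
have S (a : 'I_n) j : \sum_(i < j) ((a == i :> nat)%:R : R) = (a < j)%:R.
  have [aj|aj] := ltnP a j.
    rewrite (bigD1 (Ordinal aj))//= eqxx big1 ?addr0// => i.
    by rewrite -val_eqE/= eq_sym => /negbTE ->.
  rewrite big1// => i _; rewrite gtn_eqF//; exact: leq_trans (ltn_ord i) aj.
apply/matrixP => a b.
(* The quadratic identity, polarized at two basis vectors. *)
have := @square_telescope (fun i => (a == i :> nat)%:R) (fun i => (b == i :> nat)%:R) n (leqnn n).
rewrite tailsum_max !S !ltn_ord mulr1 div1r => H.
transitivity (s2^-1 * (\sum_(j < n) ((a == j)%:R : R) * (b == j)%:R / gi j + glast^-1)).
  rewrite !mxE (bigD1 a)//= eqxx big1 ?addr0; last first.
    by move=> j /negbTE; rewrite eq_sym => ->; rewrite !mul0r.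
  by rewrite eq_sym mul1r.
rewrite -H !mxE; apply: eq_bigr => j _; rewrite !S !mxE (bigD1 j)//= !mxE eqxx mulr1n.
rewrite big1 ?addr0; last first.
  by move=> i /negbTE ij; rewrite !mxE ij mulr0n mulr0.
by rewrite !val_eqE; ring.
Qed.

Lemma det_covmx : \det covmx = \prod_(j < n) cv j.
Proof.
have Hd : \det precmx = \prod_(j < n) (cv j)^-1.
  rewrite precmx_LDL !det_mulmx det_tr det_diag.
  have -> : \det (\matrix_(i < n, j < n) ((i == j)%:R + rho j * (i < j)%:R : R)) = 1.
    rewrite -det_tr det_trig; last first.
      apply/is_trig_mxP => i j ij; rewrite !mxE ltnNge (ltnW ij) mulr0 addr0.
      by rewrite -val_eqE/= gtn_eqF.
    by rewrite big1// => i _; rewrite !mxE eqxx ltnn mulr0 addr0.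
  by rewrite mul1r mulr1; apply: eq_bigr => j _; rewrite mxE.
have := congr1 determinant precmx_covmx; rewrite det_mulmx det1 Hd prodfV => H.
have P0 : \prod_(j < n) cv j != 0.
  by rewrite gt_eqF// prodr_gt0// => j _; exact: condvar_gt0.
by rewrite -[LHS]mul1r -[X in X * _](divff P0) -mulrA H mulr1.
Qed.

Lemma sqrtr_prod (m : nat) (x : 'I_m -> R) : (forall i, 0 <= x i) ->
  Num.sqrt (\prod_i x i) = \prod_i Num.sqrt (x i).
Proof.
elim: m x => [|m IH] x x0; first by rewrite !big_ord0 sqrtr1.
by rewrite !big_ord_recl sqrtrM// IH.
Qed.

Lemma mvnormal_jointpdf (z : 'rV[R]_n) :
  mvnormal_pdf covmx z = jointpdf g s2 z.
Proof.
have cv0 (j : 'I_n) : 0 < cv j by exact: condvar_gt0.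
pose y (j : 'I_n) := z ord0 j + rho j * \sum_(l < n | (l < j)%N) z ord0 l.
have -> : jointpdf g s2 z =
    \prod_(j < n) ((Num.sqrt (2 * pi * cv j))^-1 * expR (- (y j ^+ 2 / cv j / 2))).
  apply: eq_bigr => j _; rewrite normal_pdfE ?gt_eqF ?sqrtr_gt0//.
  rewrite /normal_peak /normal_fun sqr_sqrtr ?(ltW (cv0 j))// opprK -/(y j).
  congr (_^-1 * expR _).
    by congr Num.sqrt; rewrite -mulr_natr; ring.
  by rewrite -mulr_natr; field; rewrite gt_eqF.
rewrite big_split/= prodfV -expR_sum /mvnormal_pdf invmx_covmx det_covmx.
have -> : (2 * pi) ^+ n * \prod_(j < n) cv j = \prod_(j < n) (2 * pi * cv j).
  by move: (2 * pi) => c; rewrite [RHS]big_split/= big_const_ord iter_mulr_1.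
rewrite sqrtr_prod; last first.
  by move=> j; apply: mulr_ge0; [rewrite mulr_ge0 ?pi_ge0|exact/ltW].
congr (_ * expR _).
rewrite sumrN -mulr_suml; congr (- (_ / _)).
(* [z] extended by [0], to fit the telescoping sum over [nat]. *)
pose zn (i : nat) : R := if insub i is Some i' then z ord0 i' else 0.
have znE (i : 'I_n) : zn i = z ord0 i by rewrite /zn valK.
have := @square_telescope zn zn n (leqnn n).
rewrite tailsum_max => H.
transitivity (s2^-1 * (\sum_(j < n) zn j * zn j / gi j +
  (\sum_(i < n) zn i) * (\sum_(i < n) zn i) / glast)).
  rewrite quad_formE mulr_suml mulr_suml -big_split/= mulr_sumr.
  apply: eq_bigr => i _; rewrite (bigD1 i)//= mxE eqxx.
  rewrite (eq_bigr (fun j : 'I_n => s2^-1 * zn i * glast^-1 * zn j)); last first.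
    move=> j /negbTE ji; have -> : precmx i j = s2^-1 * glast^-1.
      by rewrite mxE eq_sym ji (_ : false%:R = 0)// mul0r add0r.
    rewrite !znE; ring.
  rewrite -mulr_sumr [in RHS](bigD1 i)//= !znE (_ : true%:R = 1)//.
  by move: (\sum_(_ < n | _) _) => S; ring.
rewrite -H; apply: eq_bigr => j _.
have E : \sum_(i < j) zn i = \sum_(l < n | (l < j)%N) z ord0 l.
  rewrite (big_ord_widen n zn (ltnW (ltn_ord j))).
  by apply: eq_bigr => i _; rewrite znE.
by rewrite znE E -/(y j) expr2.
Qed.

End Covariance.

(** * Maximum and Hessian of the limit entropy *)

Section Regimes.
Context {R : realType}.
Implicit Types (r : regime R) (c x : R).

(** The contribution of a level of weight [c] to [f] where [0 < x]; see
    [levelterm] for the boundary. *)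
Definition levelf r c x : R :=
  match r with
  | Regime1 => x * (ln c - ln x)
  | Regime2 alpha => (x + c * alpha) * ln (x + c * alpha) - x * ln x
  | Regime3 => c * ln x
  end.

Definition dlevelf r c x : R :=
  match r with
  | Regime1 => ln c - ln x - 1
  | Regime2 alpha => ln (x + c * alpha) - ln x
  | Regime3 => c * x^-1
  end.

Definition ddlevelf r c x : R :=
  match r with
  | Regime1 => - x^-1
  | Regime2 alpha => (x + c * alpha)^-1 - x^-1
  | Regime3 => - (c * x ^- 2)
  end.

Definition limscale r : R :=
  match r with Regime2 alpha => (1 + alpha) / alpha | _ => 1 end.

Definition regime_pos r := if r is Regime2 alpha then 0 < alpha else True.

Lemma limscale_gt0 r : regime_pos r -> 0 < limscale r.
Proof.
by case: r => [|a|] //= a0; rewrite divr_gt0// addr_gt0.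
Qed.

Lemma is_derive_ln_addr x c : 0 < x + c ->
  is_derive x 1 (fun y => ln (y + c)) (x + c)^-1.
Proof.
move=> xc; have H := is_derive1_ln xc.
have Ds : is_derive x (1 : R) (fun y : R => y + c) 1.
  by apply: is_derive_eq; rewrite addr0.
rewrite -[_^-1]mulr1.
exact: (@is_derive1_comp _ (@ln R) (fun y : R => y + c) _ _ _ H Ds).
Qed.

Lemma is_derive_levelf r c x : regime_pos r -> 0 < c -> 0 < x ->
  is_derive x 1 (levelf r c) (dlevelf r c x).
Proof.
move=> rp c0 x0; have L := is_derive1_ln x0; case: r rp => [_|a /= a0|_] /=.
- apply: is_derive_eq; rewrite /GRing.scale/=; field; exact: lt0r_neq0.
- have xa : 0 < x + c * a by rewrite addr_gt0// mulr_gt0.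
  have L2 := is_derive_ln_addr xa.
  apply: is_derive_eq; rewrite /GRing.scale/=; field.
  by rewrite !gt_eqF.
- by apply: is_derive_eq; rewrite /GRing.scale/=; ring.
Qed.

Lemma is_derive_dlevelf r c x : regime_pos r -> 0 < c -> 0 < x ->
  is_derive x 1 (dlevelf r c) (ddlevelf r c x).
Proof.
move=> rp c0 x0; have L := is_derive1_ln x0; case: r rp => [_|a /= a0|_] /=.
- by apply: is_derive_eq; rewrite /GRing.scale/=; ring.
- have xa : 0 < x + c * a by rewrite addr_gt0// mulr_gt0.
  have L2 := is_derive_ln_addr xa.
  exact: is_derive_eq.
- have xn : x != 0 by rewrite gt_eqF.
  have V : is_derive x (1 : R) (fun y : R => y^-1) (- (x ^- 2) *: 1).
    exact: is_deriveV.
  by apply: is_derive_eq; rewrite /GRing.scale/=; ring.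
Qed.

(** The curvature of [f] at [g] is an inverse variance; this is where the scale
    of each regime is read off. *)
Lemma ddlevelf_diag r c : regime_pos r -> 0 < c ->
  ddlevelf r c c = - ((limscale r)^-1 / c).
Proof.
case: r => [_|a /= a0|_] c0 /=; first by rewrite invr1 mul1r.
- field; rewrite !gt_eqF ?addr_gt0// ?mulr_gt0//.
- by field; rewrite gt_eqF.
Qed.

(** The slope of the contribution of a level at [x = c]; being independent of
    [c], it drops out of the sum over the simplex. *)
Definition slope r : R :=
  match r with Regime1 => -1 | Regime2 alpha => ln (1 + alpha) | Regime3 => 1 end.

Definition levelterm r c x : \bar R :=
  match r with
  | Regime1 => (x * ln (c / x))%:E
  | Regime2 alpha =>
      ((x + c * alpha) * ln (x + c * alpha) - x * ln x)%:E
  | Regime3 => (c%:E * lne x%:E)%E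
  end.

Lemma ffun_limitE m (g : 'rV[R]_m) r (x : 'rV[R]_m) :
  ffun_limit g r x = (\sum_i levelterm r (g ord0 i) (x ord0 i))%E.
Proof. by case: r => [|a|] //=; rewrite sumEFin. Qed.

Lemma levelterm_levelf r c x : 0 < c -> 0 < x -> levelterm r c x = (levelf r c x)%:E.
Proof.
move=> c0 x0; case: r => [|a|] //=; first by rewrite ln_div.
by rewrite leNgt x0/= EFinM.
Qed.

Lemma ln_le_sub1 x : 0 < x -> ln x <= x - 1.
Proof. by move=> x0; rewrite -[X in ln X](subrKC 1) le_ln1Dx// ltrBrDl subrr. Qed.

(** The tangent at [c] lies above. Each case reduces to [ln x <= x - 1]; for
    the second, the inequality is used at both [y / x] and [y / c], where
    [y = (x + c * alpha) / (1 + alpha)]. *)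
Lemma levelterm_le r c x : regime_pos r -> 0 < c -> 0 <= x ->
  (levelterm r c x <= (levelf r c c + slope r * (x - c))%:E)%E.
Proof.
move=> rp c0; rewrite le_eqVlt => /predU1P[<-|x0].
  case: r rp => [_|a /= a0|_] /=; last by rewrite lexx gt0_muleNy ?lte_fin// leNye.
    by rewrite mul0r subrr mulr0 lee_fin; lra.
  rewrite lee_fin mul0r subr0 !add0r.
  have ca : 0 < c * a by rewrite mulr_gt0.
  have a1 : 0 < 1 + a by rewrite addr_gt0.
  have -> : c + c * a = c * (1 + a) by ring.
  rewrite !lnM ?posrE//.
  have H : ln a <= ln (1 + a) by rewrite ler_ln ?posrE// lerDr.
  have := ler_wpM2l (ltW ca) H; lra.
rewrite (levelterm_levelf _ c0 x0) lee_fin; case: r rp => [_|a /= a0|_] /=.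
- have := ln_le_sub1 (divr_gt0 c0 x0); rewrite ln_div ?posrE// => /(ler_wpM2l (ltW x0)).
  have -> : x * (c / x - 1) = c - x by field; exact: lt0r_neq0.
  lra.
- have ca : 0 < c * a by rewrite mulr_gt0.
  have a1 : 0 < 1 + a by rewrite addr_gt0.
  have -> : c + c * a = c * (1 + a) by ring.
  have xa : 0 < x + c * a by rewrite addr_gt0.
  have [y y0 ye] : exists2 y, 0 < y & x + c * a = (1 + a) * y.
    exists ((x + c * a) / (1 + a)); first by rewrite divr_gt0.
    by field; exact: lt0r_neq0.
  rewrite ye.
  rewrite !lnM ?posrE//.
  have := ln_le_sub1 (divr_gt0 y0 x0); rewrite ln_div ?posrE// => /(ler_wpM2l (ltW x0)).
  have -> : x * (y / x - 1) = y - x by field; exact: lt0r_neq0.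
  have := ln_le_sub1 (divr_gt0 y0 c0); rewrite ln_div ?posrE// => /(ler_wpM2l (ltW ca)).
  have -> : c * a * (y / c - 1) = a * (y - c) by field; exact: lt0r_neq0.
  move: (ln y) (ln x) (ln c) (ln (1 + a)) => ly lx lc la H1 H2.
  rewrite -subr_ge0.
  have -> : c * (1 + a) * (lc + la) - c * lc + la * (x - c) - ((1 + a) * y * (la + ly) - x * lx)
    = (a * (y - c) - c * a * (ly - lc)) + ((y - x) - x * (ly - lx))
      + (x + c * a - (1 + a) * y) * (la + ly + 1).
    ring.
  by rewrite ye subrr mul0r addr0 addr_ge0// subr_ge0.
- have := ln_le_sub1 (divr_gt0 x0 c0); rewrite ln_div ?posrE// => /(ler_wpM2l (ltW c0)).
  have -> : c * (x / c - 1) = x - c by field; exact: lt0r_neq0.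
  lra.
Qed.

Lemma ffun_limit_le m (g x : 'rV[R]_m) r : regime_pos r ->
  (forall i, 0 < g ord0 i) -> \sum_i g ord0 i = 1 ->
  (forall i, 0 <= x ord0 i) -> \sum_i x ord0 i = 1 ->
  (ffun_limit g r x <= ffun_limit g r g)%E.
Proof.
move=> rp g0 sg x0 sx; rewrite !ffun_limitE.
have -> : (\sum_i levelterm r (g ord0 i) (g ord0 i) =
   \sum_i (levelf r (g ord0 i) (g ord0 i) + slope r * (x ord0 i - g ord0 i))%:E)%E.
  under eq_bigr do rewrite levelterm_levelf//.
  by rewrite !sumEFin big_split/= -mulr_sumr sumrB sx sg subrr mulr0 addr0.
by apply: lee_sum => i _; exact: levelterm_le.
Qed.

Lemma unique_max_g m (energy g xstar : 'rV[R]_m) E0 r : regime_pos r ->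
  (forall i, 0 < g ord0 i) -> \sum_i g ord0 i = 1 -> dot energy g < E0 ->
  is_unique_max (ffun_limit g r) (simplex_le energy E0) xstar -> xstar = g.
Proof.
move=> rp g0 sg gE [[x0 sx _] M]; apply: contrapT => /eqP; rewrite eq_sym => ne.
have := M g; rewrite ltNge ffun_limit_le// => H; suff : false by [].
by apply: H => //; split=> //; [move=> i; exact: ltW | exact: ltW].
Qed.

Section Hessian.
Variables (n : nat) (g : 'rV[R]_n.+1) (r : regime R).
Hypotheses (g0 : forall i, 0 < g ord0 i) (sg : \sum_i g ord0 i = 1).
Hypothesis rp : regime_pos r.

(** The linear part of the affine map [complete]. *)
Definition dcomplete (v : 'rV[R]_n) (l : 'I_n.+1) : R :=
  oapp (v ord0) (- \sum_j v ord0 j) (unlift ord_max l).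

Lemma complete_line (v a : 'rV[R]_n) (t : R) l :
  complete (t *: v + a) ord0 l = t * dcomplete v l + complete a ord0 l.
Proof.
rewrite !mxE /dcomplete; case: (unlift ord_max l) => [j|]/=; first by rewrite !mxE.
under eq_bigr do rewrite !mxE.
by rewrite big_split/= -mulr_sumr; ring.
Qed.

Lemma complete_drop_last : complete (drop_last g) = g.
Proof.
apply/rowP => l; rewrite mxE; case: unliftP => [j ->|->]/=; first by rewrite mxE.
have := sum_ord_max (g ord0); rewrite sg.
have -> : \sum_(j < n) drop_last g ord0 j = \sum_(j < n) g ord0 (inord j).
  by apply: eq_bigr => j _; rewrite mxE inord_lift.
by move=> ->; rewrite addrC addKr.
Qed.

(** Reduces the Hessian to one-variable calculus on lines, on which [complete]
    is affine. *)
Lemma is_derive_line (F : 'rV[R]_n -> R) (v a : 'rV[R]_n) (f : R -> R) d :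
  (\forall t \near (0 : R), F (t *: v + a) = f t) ->
  is_derive (0 : R) (1 : R) f d -> is_derive a v F d.
Proof.
move=> Ff Df.
have [D1 D2] : is_derive (0 : R) (1 : R) (fun t => F (t *: v + a)) d.
  by apply: near_eq_is_derive Df; near do apply/esym.
have E : (fun t : R => t^-1 *: (F ((t *: (1 : R) + 0) *: v + a) - F (0 *: v + a)))
     = (fun t => t^-1 *: (F (t *: v + a) - F a)).
  apply/funext => t /=; rewrite scale0r add0r addr0; congr (_ *: (F (_ *: _ + _) - _)).
  by rewrite /GRing.scale/= mulr1.
split; first by move: D1; rewrite /derivable/= E.
by move: D2; rewrite /derive/= E.
Unshelve. all: by end_near. Qed.

Lemma near_complete_gt0 (v a : 'rV[R]_n) : (forall l, 0 < complete a ord0 l) ->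
  \forall t \near (0 : R), forall l, 0 < complete (t *: v + a) ord0 l.
Proof.
move=> a0; apply:
  (@filter_forall R 'I_n.+1 (fun l t => 0 < complete (t *: v + a) ord0 l) (nbhs (0 : R))) => l.
under eq_near do rewrite complete_line.
have C : (fun t : R => t * dcomplete v l + complete a ord0 l) @ (0 : R) -->
   0 * dcomplete v l + complete a ord0 l.
  by apply: cvgD; [apply: cvgMl; exact: cvg_id|exact: cvg_cst].
by apply: (cvgr_gt _ C); rewrite mul0r add0r.
Qed.

Lemma freducedE (x' : 'rV[R]_n) : (forall l, 0 < complete x' ord0 l) ->
  freduced g r x' = \sum_l levelf r (g ord0 l) (complete x' ord0 l).
Proof.
move=> x0; rewrite /freduced ffun_limitE.
by under eq_bigr do rewrite levelterm_levelf//; rewrite sumEFin.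
Qed.

Lemma is_derive_along (f : R -> R -> R) (df : R -> R -> R) (F : 'rV[R]_n -> R)
    (w : 'I_n.+1 -> R) v a :
  (forall c x, 0 < c -> 0 < x -> is_derive x (1 : R) (f c) (df c x)) ->
  (forall x' : 'rV[R]_n, (forall l, 0 < complete x' ord0 l) ->
     F x' = \sum_l w l * f (g ord0 l) (complete x' ord0 l)) ->
  (forall l, 0 < complete a ord0 l) ->
  is_derive a v F
    (\sum_l w l * (df (g ord0 l) (complete a ord0 l) * dcomplete v l)).
Proof.
move=> fdf FE a0.
apply: (@is_derive_line _ _ _
  (fun t => \sum_l w l * f (g ord0 l) (t * dcomplete v l + complete a ord0 l))).
  near=> t; rewrite FE; last by near: t; exact: near_complete_gt0.
  by apply: eq_bigr => l _; rewrite complete_line.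
apply: is_derive_bigsum => l.
have Dl : is_derive (0 : R) (1 : R)
    (fun t : R => t * dcomplete v l + complete a ord0 l) (dcomplete v l).
  by apply: is_derive_eq; rewrite /GRing.scale/=; ring.
have := fdf (g ord0 l) (complete a ord0 l) (g0 l) (a0 l).
rewrite -[X in is_derive X]add0r -[X in is_derive (X + _)](mul0r (dcomplete v l)) => Df.
have H := @is_derive1_comp _ (f (g ord0 l))
  (fun t => t * dcomplete v l + complete a ord0 l) 0 _ _ Df Dl.
by have := is_deriveZ (w l) H.
Unshelve. all: by end_near. Qed.

(** The Hessian of [\sum_l levelf l (complete x' l)] is diagonal in the [n + 1]
    coordinates; pulling it back by [complete], whose last coordinate is
    [1 - \sum_j x' j], adds the second derivative of the last level to every
    entry. *)
Lemma hessian_freduced : - hessian (freduced g r) (drop_last g) =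
  precmx (g ord0) (limscale r).
Proof.
apply/matrixP => i j; rewrite !mxE.
have cg l : 0 < complete (drop_last g) ord0 l by rewrite complete_drop_last.
set ei := delta_mx ord0 i; set ej := delta_mx ord0 j.
have D1 (x' : 'rV[R]_n) : (forall l, 0 < complete x' ord0 l) -> 'D_ej (freduced g r) x' =
    \sum_l dcomplete ej l * dlevelf r (g ord0 l) (complete x' ord0 l).
  move=> x0.
  have [_ ->] : is_derive x' ej (freduced g r)
     (\sum_l 1 * (dlevelf r (g ord0 l) (complete x' ord0 l) * dcomplete ej l)).
    apply: is_derive_along x0 => [c x c0 x1|y y0]; first exact: is_derive_levelf.
    by rewrite freducedE//; under [RHS]eq_bigr do rewrite mul1r.
  by apply: eq_bigr => l _; rewrite mul1r mulrC.
have [_ ->] : is_derive (drop_last g) ei ('D_ej (freduced g r))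
     (\sum_l dcomplete ej l *
         (ddlevelf r (g ord0 l) (complete (drop_last g) ord0 l) * dcomplete ei l)).
  apply: (@is_derive_along (dlevelf r) (ddlevelf r) _ (dcomplete ej) _ _ _ D1 cg).
  by move=> c x c0 x1; exact: is_derive_dlevelf.
have dE k (l : 'I_n) : dcomplete (delta_mx ord0 k) (inord l) = (l == k)%:R.
  by rewrite inord_lift /dcomplete liftK/= mxE eqxx.
have dM k : dcomplete (delta_mx ord0 k) ord_max = -1.
  rewrite /dcomplete unlift_none/= (bigD1 k)//= mxE !eqxx big1 ?addr0// => l /negbTE lk.
  by rewrite mxE lk andbF.
rewrite complete_drop_last (sum_ord_max (fun l => _ * (_ * _))) !dM.
under eq_bigr do rewrite !dE.
rewrite (bigD1 j)//= eqxx big1 ?addr0; last by move=> l /negbTE ->; rewrite mul0r.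
rewrite !ddlevelf_diag// mul1r (eq_sym j).
have -> : (i == j)%:R / g ord0 (inord i) = (i == j)%:R / g ord0 (inord j).
  by case: eqVneq => [->//|_]; rewrite !mul0r.
move: (limscale r)^-1 (g ord0 (inord j))^-1 (g ord0 ord_max)^-1 => a b c.
by move: (i == j)%:R => e; ring.
Qed.

Lemma sigma_covmx :
  invmx (- hessian (freduced g r) (drop_last g)) = covmx (g ord0) (limscale r).
Proof. by rewrite hessian_freduced invmx_precmx// limscale_gt0. Qed.

End Hessian.
End Regimes.

(** * From the probability space to finite sums *)

Section SimpleExpectation.
Context {R : realType} d (T : measurableType d) (P : probability T R).

Lemma expectation_simple (I : Type) (s : seq I) (c p : I -> R) (B : I -> set T) :
  (forall i, measurable (B i)) -> (forall i, P (B i) = (p i)%:E) ->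
  ('E_P[fun w => (\sum_(i <- s) c i * \1_(B i) w)%R])%E = (\sum_(i <- s) c i * p i)%:E.
Proof.
move=> mB pB; rewrite unlock.
have iB i : P.-integrable setT (fun w => (c i)%:E * (\1_(B i) w)%:E)%E.
  by apply: integrableZl => //; exact: integrable_indic.
suff [] : P.-integrable setT (fun w => (\sum_(i <- s) c i * \1_(B i) w)%:E) /\
    (\int[P]_w (\sum_(i <- s) c i * \1_(B i) w)%:E = (\sum_(i <- s) c i * p i)%:E)%E by [].
elim: s => [|i s [IH1 IH2]].
  under eq_fun do rewrite big_nil; split; first exact: integrable0.
  by rewrite big_nil integral0.
have E w : ((\sum_(j <- i :: s) c j * \1_(B j) w)%:E =
    (c i)%:E * (\1_(B i) w)%:E + (\sum_(j <- s) c j * \1_(B j) w)%:E)%E.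
  by rewrite big_cons EFinD EFinM.
under eq_fun do rewrite E; split; first exact: integrableD.
rewrite integralD// IH2 integralZl//; last exact: integrable_indic.
by rewrite integral_indic// setIT big_cons EFinD EFinM -pB.
Qed.

Lemma measurable_preimage_point m (Y : T -> 'rV[R]_m) (x : 'rV[R]_m) :
  random_vector Y -> measurable (Y @^-1` [set x]).
Proof.
move=> mY.
have -> : Y @^-1` [set x] = \bigcap_(i in [set: 'I_m]) ((fun w => Y w ord0 i) @^-1` [set x ord0 i]).
  apply/seteqP; split=> w /=; first by move=> <-.
  by move=> H; apply/rowP => i; exact: H.
apply: fin_bigcap_measurable => // i _.
by rewrite -[X in measurable X]setTI; apply: mY => //; exact: measurable_set1.
Qed.

End SimpleExpectation.

Section LatticeModel.
Context {R : realType} (n N : nat) (energy g : 'rV[R]_n.+1) (E0 : R) (G : nat -> R).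
Hypothesis N0 : (0 < N)%N.
Hypothesis G0 : 0 < G N.
Hypothesis g_gt0 : forall i, 0 < g ord0 i.
Local Notation conf := {ffun 'I_n.+1 -> 'I_N.+1}.
Implicit Type k : conf.

Definition lattice_point k : 'rV[R]_n.+1 := \row_i ((k i)%:R / N%:R).

Definition feasible k := composition k && admissible (energy ord0) E0 k.

Let Nn0 : (N%:R : R) != 0. Proof. by rewrite pnatr_eq0 -lt0n. Qed.

Lemma lattice_point_inj : injective lattice_point.
Proof.
move=> k1 k2 /rowP H; apply/ffunP => i; have := H i; rewrite !mxE.
by move=> /(mulIf (invr_neq0 Nn0)) /eqP; rewrite eqr_nat => /eqP/val_inj.
Qed.

Lemma simplex_latticeE : simplex_le energy E0 `&` lattice N =
  [set` [seq lattice_point k | k <- enum feasible]].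
Proof.
apply/seteqP; split => x /=.
  move=> [[x0 sx Ex] [k xk]].
  have sk : (\sum_i k i)%N = N.
    apply/eqP; rewrite -(eqr_nat R) natr_sum; apply/eqP.
    transitivity (\sum_i x ord0 i * N%:R); last by rewrite -mulr_suml sx mul1r.
    by apply: eq_bigr => i _; rewrite xk mxE divfK.
  have kN i : (k i < N.+1)%N by rewrite ltnS -sk (bigD1 i)//= leq_addr.
  apply/mapP; exists [ffun i => Ordinal (kN i)].
    rewrite mem_enum unfold_in /feasible /composition /admissible.
    apply/andP; split; first by apply/eqP; rewrite -[RHS]sk; apply: eq_bigr => i _; rewrite ffunE.
    apply: le_trans Ex; rewrite /dot; apply/eq_ler/eq_bigr => i _.
    by rewrite xk mxE ffunE.
  by rewrite xk; apply/rowP => i; rewrite !mxE ffunE.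
move=> /mapP[k]; rewrite mem_enum unfold_in => /andP[/eqP sk ak] ->.
split; last by exists (fun i => nat_of_ord (k i)).
split=> [i||]; first by rewrite mxE divr_ge0.
  under eq_bigr do rewrite mxE.
  by rewrite -mulr_suml -natr_sum sk divff.
by rewrite /dot; under eq_bigr do rewrite mxE.
Qed.

(** The factorial quotients of the entropy are the ratios [pochratio], so that
    the normalization and the energy bound are all that separates the law of [X N]
    from a Dirichlet-multinomial one. *)
Lemma expR_entropy k : composition k ->
  expR (entropy g G (lattice_point k) N) = dmweight (fun i => g ord0 i * G N) k.
Proof.
move=> ck; rewrite /dmweight ck /entropy expR_sum; apply: eq_bigr => i _.
rewrite mxE divfK// /rfact !subrK lnK//.
by rewrite posrE; apply: pochratio_gt0; rewrite mulr_gt0.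
Qed.

Lemma expectation_dmcond d (T : measurableType d) (P : probability T R)
    (Y : T -> 'rV[R]_n.+1) (F : 'rV[R]_n.+1 -> R) :
  entropy_distributed energy g E0 G N P Y ->
  'E_P[fun w => F (Y w)]%E =
  (dmcond (g ord0) (energy ord0) E0 (G N) (fun k => F (lattice_point k)))%:E.
Proof.
move=> [mY AY pY].
pose w k := dmweight (fun i => g ord0 i * G N) k.
have uq : uniq [seq lattice_point k | k <- enum feasible].
  by rewrite map_inj_uniq ?enum_uniq//; exact: lattice_point_inj.
have S0 : \sum_(y \in simplex_le energy E0 `&` lattice N) expR (entropy g G y N) =
    \sum_(k <- enum feasible) w k.
  rewrite simplex_latticeE -fsbig_seq// big_map big_seq [RHS]big_seq.
  by apply: eq_bigr => k; rewrite mem_enum => /andP[ck _]; rewrite expR_entropy.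
set S := \sum_(k <- enum feasible) w k in S0.
have FY : (fun t => F (Y t)) = (fun t => \sum_(k <- enum feasible) F (lattice_point k) *
     \1_(Y @^-1` [set lattice_point k]) t).
  apply/funext => t; have := AY t; rewrite simplex_latticeE => /= /mapP[k kf Yk].
  rewrite (bigD1_seq k)//= ?enum_uniq// big1_seq ?addr0; last first.
    move=> k' /andP[k'k _]; rewrite indicE memNset ?mulr0//= Yk => /lattice_point_inj.
    by move=> /eqP; rewrite eq_sym (negbTE k'k).
  by rewrite indicE mem_set//= ?mulr1 Yk.
have pk k : k \in enum feasible -> P (Y @^-1` [set lattice_point k]) = (w k / S)%:E.
  move=> kf; rewrite pY; last by rewrite simplex_latticeE; apply/mapP; exists k.
  by rewrite S0 expR_entropy//; move: kf; rewrite mem_enum => /andP[].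
rewrite FY (@expectation_simple _ _ _ _ _ _ _
  (fun k => fine (P (Y @^-1` [set lattice_point k])))); last 2 first.
- by move=> k; exact: measurable_preimage_point.
- by move=> k; rewrite fineK// fin_num_measure//; exact: measurable_preimage_point.
congr EFin; rewrite /dmcond /dmexp /fexp.
have W0 := sum_dmweight_gt0 N (fun i => mulr_gt0 (g_gt0 i) G0).
rewrite invf_div mulrA divfK ?gt_eqF//.
have E (f : conf -> R) : \sum_k w k * (f k * (admissible (energy ord0) E0 k)%:R) =
   \sum_(k <- enum feasible) w k * f k.
  rewrite big_enum/= [RHS]big_mkcond/=; apply: eq_bigr => k _.
  rewrite unfold_in /feasible /w /dmweight; case: composition => /=; last by rewrite mul0r.
  by case: admissible; rewrite ?mulr1 ?mulr0.
rewrite E.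
under [X in _ / X]eq_bigr do rewrite -[X in _ * X]mul1r.
rewrite (E (fun=> 1)).
under [X in _ / X]eq_bigr do rewrite mulr1.
rewrite -/S mulr_suml big_seq [RHS]big_seq; apply: eq_bigr => k kf.
by rewrite (pk k kf)/= mulrCA mulrA.
Qed.

End LatticeModel.

(** * The three regimes *)

Section Asymptotics.
Context {R : realType}.
Implicit Types (G : nat -> R) (r : regime R).

Lemma powR32 (x : R) : 0 < x -> x `^ (3 / 2) = x * Num.sqrt x.
Proof.
move=> x0; have -> : 3 / 2 = 1 + 2^-1 :> R by field.
by rewrite powRD ?gt_eqF ?implybT// powRr1 ?powR12_sqrt// ltW.
Qed.

Lemma in_regime_pos G r : in_regime G r -> regime_pos r.
Proof. by case: r => //= a []. Qed.

Lemma hfun_pinfty G r : G N @[N --> \oo] --> +oo -> hfun G r N @[N --> \oo] --> +oo.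
Proof. by move=> Goo; case: r => [|a|] //=; exact: cvgr_idn. Qed.

Lemma varscaleE N (x h : R) : (0 < N)%N -> 0 < x ->
  varscale N x h = h / x + h / N%:R.
Proof.
move=> N0 x0; have Nn : (N%:R : R) != 0 by rewrite pnatr_eq0 -lt0n.
by rewrite /varscale; field; rewrite Nn gt_eqF.
Qed.

(** Multiplied by [sqrt h], the error on the variance is [N ^ (3/2) / G],
    [- beta * sqrt N / (alpha * (alpha + beta))] and [G ^ (3/2) / N]
    respectively: the hypothesis made in each regime is exactly that this
    vanishes. *)
Lemma scaling_regime G r : (forall N, (0 < N)%N -> 0 < G N) ->
  G N @[N --> \oo] --> +oo -> in_regime G r ->
  \forall N \near \oo, scaling 1 (limscale r) N (G N) (hfun G r N).
Proof.
move=> G0 Goo Gr.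
have N1 : \forall N \near \oo, (0 < N)%N by exists 1%N.
have h1 : \forall N \near \oo, 1 <= hfun G r N by exact: cvgry_ge (hfun_pinfty r Goo) 1.
have hN : \forall N \near \oo, hfun G r N <= N%:R.
  case: r Gr {h1} => [_|a _|[Gr _]] /=; [by near=> N|by near=> N|].
  near=> N; have N0 : (0 < N)%N by near: N.
  have : `|G N / N%:R| <= 1 by near: N; exact: cvgr0_norm_le Gr _ ltr01.
  by rewrite ger0_norm ?divr_ge0 ?(ltW (G0 _ N0))// ler_pdivrMr ?ltr0n// mul1r.
have vs : \forall N \near \oo, (0 < N)%N ->
    `|varscale N (G N) (hfun G r N) - limscale r| * Num.sqrt (hfun G r N) <= 1.
  case: r Gr {h1 hN} => [|a|] /=.
  - move=> [_ Gr]; near=> N => N0.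
    have : `|N%:R `^ (3 / 2) / G N| <= 1 by near: N; exact: cvgr0_norm_le Gr _ ltr01.
    rewrite powR32 ?ltr0n// varscaleE ?G0// divff ?pnatr_eq0 -?lt0n// addrK.
    by rewrite mulrAC normrM [`|Num.sqrt _|]ger0_norm ?sqrtr_ge0.
  - move=> [a0 b0 bN]; near=> N => N0.
    have bN1 : `|beta G a N * Num.sqrt N%:R| <= a ^+ 2 / 2.
      by near: N; apply: (cvgr0_norm_le _ bN); rewrite divr_gt0// exprn_gt0.
    have bN2 : `|beta G a N| <= a / 2.
      by near: N; apply: (cvgr0_norm_le _ b0); rewrite divr_gt0.
    have Np : 0 < (N%:R : R) by rewrite ltr0n.
    have Gp := G0 _ N0.
    rewrite varscaleE// divff ?gt_eqF//.
    have E : N%:R / G N + 1 - (1 + a) / a = - (beta G a N) * (a * (G N / N%:R))^-1.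
      by rewrite /beta; field; rewrite !gt_eqF.
    have aq : a / 2 <= G N / N%:R.
      move: bN2; rewrite ler_norml /beta => /andP[+ _].
      by rewrite lerBrDr; apply: le_trans; lra.
    have q0 : 0 < G N / N%:R by rewrite divr_gt0.
    rewrite E normrM normrN mulrAC -[X in _ * X * _ <= _]ger0_norm ?sqrtr_ge0//.
    have z0 := mulr_gt0 a0 q0.
    rewrite -normrM normfV [X in _ / X <= _]gtr0_norm// ler_pdivrMr//.
    rewrite mul1r (le_trans bN1)//.
    by rewrite expr2 -mulrA ler_wpM2l// ltW.
  - move=> [_ Gr]; near=> N => N0.
    have : `|G N `^ (3 / 2) / N%:R| <= 1 by near: N; exact: cvgr0_norm_le Gr _ ltr01.
    have Gp := G0 _ N0.
    rewrite powR32// varscaleE// divff ?gt_eqF// addrAC subrr add0r.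
    by rewrite mulrAC normrM [`|Num.sqrt _|]ger0_norm ?sqrtr_ge0.
near=> N.
have N0 : (0 < N)%N by near: N.
have hh : 1 <= hfun G r N by near: N.
have sh : 0 < Num.sqrt (hfun G r N) by rewrite sqrtr_gt0 (lt_le_trans ltr01).
split => //; first exact: G0.
  rewrite div1r ler_pdivrMr ?ltr0n// mulrC ler_pdivlMr// -expr2 sqr_sqrtr ?(le_trans ler01)//.
  by near: N.
by rewrite ler_pdivlMr//; have := N0; near: N.
Unshelve. all: by end_near. Qed.

Lemma cvg_invsqrt (h : nat -> R) : h N @[N --> \oo] --> +oo ->
  (Num.sqrt (h N))^-1 @[N --> \oo] --> 0.
Proof.
move=> hoo; apply/cvgr0Pnorm_le => e e0; near=> N.
have H : e ^- 2 <= h N by near: N; exact: cvgry_ge.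
have h0 : 0 < h N by apply: lt_le_trans H; rewrite invr_gt0 exprn_gt0.
rewrite ger0_norm ?invr_ge0// -[e]invrK lef_pV2 ?posrE ?invr_gt0 ?sqrtr_gt0//.
have <- : Num.sqrt (e ^- 2) = e^-1 by rewrite -exprVn sqrtr_sqr ger0_norm ?invr_ge0 ?ltW.
by rewrite ler_wsqrtr.
Unshelve. all: by end_near. Qed.

End Asymptotics.

(** * The limit theorem *)

Section ReducedVector.
Context {R : realType} (n N : nat) (g : 'rV[R]_n.+1) (h : R).
Implicit Type k : {ffun 'I_n.+1 -> 'I_N.+1}.

Lemma deviation_lattice_point k :
  Num.sqrt h *: (drop_last g - drop_last (lattice_point k)) =
  prefix_rv n (fun i => fluct (g ord0) h i k).
Proof. by apply/rowP => j; rewrite !mxE inord_lift. Qed.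

Lemma dot_fluct (xi : 'rV[R]_n) k :
  dot xi (prefix_rv n (fun i => fluct (g ord0) h i k)) =
  linfluct (g ord0) h (extend0 xi) k.
Proof.
rewrite /linfluct (sum_ord_max (fun i => extend0 xi i * _)) extend0_max mul0r addr0.
by apply: eq_bigr => j _; rewrite extend0_inord mxE.
Qed.

End ReducedVector.

Theorem theorem2 (R : realType) (n : nat)
    (energy g : 'rV[R]_n.+1) (E : R) (G : nat -> R) (r : regime R)
    (xstar : 'rV[R]_n.+1) (delta : R)
    (d : nat -> measure_display) (T : forall N, measurableType (d N))
    (P : forall N, probability (T N) R)
    (X : forall N, T N -> 'rV[R]_n.+1) :
  (forall i j : 'I_n.+1, (i < j)%N -> energy ord0 i < energy ord0 j) ->
  (forall i, 0 < g ord0 i) ->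
  \sum_i g ord0 i = 1 ->
  energy ord0 ord0 < E ->
  (forall N, (0 < N)%N -> 0 < G N) ->
  (forall M N, (0 < M)%N -> (M <= N)%N -> G M <= G N) ->
  G N @[N --> \oo] --> +oo ->
  dot energy g < E ->
  in_regime G r ->
  is_unique_max (ffun_limit g r) (simplex_le energy E) xstar ->
  (forall N, (0 < N)%N ->
     entropy_distributed energy g E G N (P N) (X N)) ->
  0 < delta < 1 / (3 * n.+2%:R) ->
  let h := hfun G r in
  let Sigma := invmx (- hessian (freduced g r) (drop_last xstar)) in
  let Z := fun N (w : T N) =>
    Num.sqrt (h N) *: (drop_last xstar - drop_last (X N w)) in
  cvg_in_distribution P Z (mvnormal_pdf Sigma) /\
  forall xi : 'rV[R]_n,
    exists c1 c2 c3 : nat -> R,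
      [/\ bounded_near c1 \oo, bounded_near c2 \oo, bounded_near c3 \oo &
          \forall N \near \oo,
            mgf (P N) (Z N) xi =
            (expR (quad_form Sigma xi / 2) *
             (1 + c1 N / h N `^ (1 / 2 - 3 * delta)
                + c2 N * (h N `^ (1 / 2 + n.+2%:R * delta) / N%:R)
                + c3 N * epsfun G r N * Num.sqrt (h N)))%:E].
Proof.
move=> _ g0 sg _ G0 _ Goo gE Gr xmax EX /andP[d0 _] h Sigma Z.
have rp := in_regime_pos Gr.
pose s2 := limscale r; have s20 : 0 < s2 := limscale_gt0 rp.
have SigmaE : Sigma = covmx (g ord0) s2.
  by rewrite /Sigma (unique_max_g rp g0 sg gE xmax) sigma_covmx.
have ZE N w : Z N w = Num.sqrt (h N) *: (drop_last g - drop_last (X N w)).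
  by rewrite /Z (unique_max_g rp g0 sg gE xmax).
have {xmax} sc := scaling_regime G0 Goo Gr; rewrite -/s2 -/h in sc.
have hoo : (Num.sqrt (h N))^-1 @[N --> \oo] --> 0.
  exact: cvg_invsqrt (hfun_pinfty r Goo).
have mE : \sum_i energy ord0 i * g ord0 i < E by [].
have EZ N (F : 'rV[R]_n -> R) : (0 < N)%N -> ('E_(P N)[fun w => F (Z N w)] =
    (dmcond (g ord0) (energy ord0) E (G N) (fun k : {ffun 'I_n.+1 -> 'I_N.+1} =>
       F (prefix_rv n (fun i => fluct (g ord0) (h N) i k))))%:E)%E.
  move=> N0; under eq_fun do rewrite ZE.
  rewrite (expectation_dmcond N0 (G0 _ N0) g0
    (fun x => F (Num.sqrt (h N) *: (drop_last g - drop_last x))) (EX N N0)).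
  by under eq_fun do rewrite deviation_lattice_point.
have N1 : \forall N \near \oo, (0 < N)%N by exists 1%N.
have hsmall e : 0 < e -> \forall N \near \oo, (Num.sqrt (h N))^-1 <= e.
  move=> e0; near=> N; rewrite -[leLHS]ger0_norm ?invr_ge0//.
  by near: N; exact: cvgr0_norm_le hoo _ e0.
split.
  move=> phi cphi [M [_ bphi]].
  pose B := `|M| + 1; have B0 : 0 <= B by rewrite addr_ge0.
  have {}bphi z : `|phi z| <= B.
    by apply: bphi => //; rewrite (le_lt_trans (ler_norm M))// ltrDl.
  have [l lE Hl] := dm_weak_limit g0 sg ler01 s20 sc hoo (leqnn n) cphi bphi.
  have -> : rV_integral (fun z => (phi z * mvnormal_pdf Sigma z)%:E) = l%:E.
    by rewrite -lE; congr rV_integral; apply/funext => z; rewrite SigmaE mvnormal_jointpdf.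
  pose c N := dmcond (g ord0) (energy ord0) E (G N) (fun k : {ffun 'I_n.+1 -> 'I_N.+1} =>
     phi (prefix_rv n (fun i => fluct (g ord0) (h N) i k))).
  apply: (@cvg_trans _ ((c N)%:E @[N --> \oo])).
    by apply: near_eq_cvg; near=> N; rewrite EZ//; near: N.
  apply: cvg_EFin; first by near=> N.
  have [K [e0 [K0 e00 HK]]] := dmcond_bounded g0 sg mE s2 ler01 B0.
  rewrite -[l]add0r.
  pose m N := @dmexp _ _ (g ord0) N (G N) (fun k =>
    phi (prefix_rv n (fun i => fluct (g ord0) (h N) i k))).
  have -> : c = (fun N => (c N - m N) + m N) by apply/funext => N; rewrite subrK.
  apply: cvgD Hl; apply/cvgr0Pnorm_le => e epos.
  have K1 : 0 < K + 1 by rewrite ltr_wpDl.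
  have H1 := hsmall _ e00; have H2 := hsmall _ (divr_gt0 epos K1).
  near=> N.
  apply: (@le_trans _ _ (K / Num.sqrt (h N))).
    by apply: HK => //; near: N.
  apply: (@le_trans _ _ (K * (e / (K + 1)))); first by rewrite ler_wpM2l//; near: N.
  by rewrite mulrCA ler_piMr ?(ltW epos)// ler_pdivrMr// mul1r lerDl.
move=> xi; pose M N := dmcond (g ord0) (energy ord0) E (G N)
  (fun k : {ffun 'I_n.+1 -> 'I_N.+1} => expR (linfluct (g ord0) (h N) (extend0 xi) k)).
pose Q := expR (quad_form Sigma xi / 2).
(* The relative error itself, so that the expansion holds identically. *)
pose c1 N := (M N / Q - 1) * h N `^ (1 / 2 - 3 * delta).
exists c1, (fun=> 0), (fun=> 0).
have b0 : bounded_near (fun _ : nat => 0 : R) \oo.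
  by exists 0; split => // b bb; near=> N; rewrite normr0 ltW.
split=> //.
  have [K [e0 [K0 e00 HK]]] := dmcond_mgf g0 sg mE ler01 (ltW s20) (extend0 xi).
  have he := hsmall _ e00.
  exists K; split; [exact: num_real|move=> b /ltW Kb]; near=> N.
  apply: le_trans Kb.
  have [N0 _ h1 _ _] : scaling 1 s2 N (G N) (h N) by near: N.
  have h0 : 0 < h N := lt_le_trans ltr01 h1.
  have sh0 : 0 < Num.sqrt (h N) by rewrite sqrtr_gt0.
  have HM : `|M N / Q - 1| <= K / Num.sqrt (h N).
    rewrite /Q SigmaE quad_form_covmx//; apply: HK; first by near: N.
    by near: N.
  rewrite /c1 normrM [X in _ * X]ger0_norm ?powR_ge0//.
  apply: (le_trans (ler_wpM2r (powR_ge0 _ _) HM)).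
  rewrite -mulrA ler_piMr// mulrC ler_pdivrMr// mul1r -powR12_sqrt ?(ltW h0)// mul1r.
  by apply: ler_powR => //; lra.
near=> N.
have N0 : (0 < N)%N by near: N.
have [_ _ h1 _ _] : scaling 1 s2 N (G N) (h N) by near: N.
rewrite /mgf (EZ N (fun z => expR (dot xi z)) N0).
under eq_fun do rewrite dot_fluct.
rewrite -/(M N) -/Q /c1 !mul0r !addr0 mulfK; last first.
  by rewrite gt_eqF// powR_gt0// (lt_le_trans ltr01).
by rewrite subrKC mulrC divfK// gt_eqF// expR_gt0.
Unshelve. all: by end_near. Qed.
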